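(* An undirected graph with $n$ vertices and $m$ edges can be preprocessed to build a data structure in $O(m\log n)$ time such that, after a single update in the graph, a DFS tree of the updated graph can be reported in $O(n\log^3 n)$ time.
   Context: An update is one of: insertion of a vertex (with its incident edges), deletion of a vertex, insertion of an edge, or deletion of an edge. A DFS tree of an undirected graph rooted at $r$ is a rooted spanning tree in which every non-tree edge joins a vertex to one of its ancestors in the tree; to handle disconnected graphs, a dummy vertex $r$ adjacent to all vertices is added and the DFS tree is rooted at $r$. *)

(* Defs.v *)
From mathcomp Require Import all_boot.

Set Implicit Arguments.
Unset Strict Implicit.
Unset Printing Implicit Defensive.

(** * A word RAM

    Programs are structured rather than flat lists of jumps, which changes
    running times by a constant factor only.  A machine has registers,
    a random-access memory, a sequential read-only input tape and a write-only
    output tape.  Every value it handles, addresses included, is an unsigned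
    [w]-bit word. *)

Record state := State {
  regs : nat -> nat;
  ram : nat -> nat;
  tape_in : seq nat;
  tape_out : seq nat }.

Inductive binop := OpAdd | OpSub | OpMul | OpDiv | OpMod | OpLt | OpEq.

Definition binop_sem (o : binop) : nat -> nat -> nat :=
  match o with
  | OpAdd => addn
  | OpSub => subn
  | OpMul => muln
  | OpDiv => divn
  | OpMod => modn
  | OpLt => fun a b => nat_of_bool (a < b)
  | OpEq => fun a b => nat_of_bool (a == b)
  end.

Inductive expr :=
| Const of nat
| Reg of nat
| Fetch of expr
| Bin of binop & expr & expr.

Inductive cmd :=
| Skip
| Assign of nat & expr
| Store of expr & expr
| Input of nat
| Output of expr
| Seq of cmd & cmd
| If of expr & cmd & cmd
| While of expr & cmd.

Definition word (w k : nat) : option nat := if k < 2 ^ w then Some k else None.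

(** [None] signals an overflow: the machine is then stuck, so a program that
    has an execution never exceeds its word size. *)
Fixpoint eval (w : nat) (s : state) (e : expr) : option nat :=
  match e with
  | Const k => word w k
  | Reg x => Some (regs s x)
  | Fetch e1 => omap (ram s) (eval w s e1)
  | Bin o e1 e2 =>
      obind (fun a => obind (fun b => word w (binop_sem o a b)) (eval w s e2))
            (eval w s e1)
  end.

(** The time to evaluate an expression: unit cost per operation. *)
Fixpoint ecost (e : expr) : nat :=
  match e with
  | Const _ | Reg _ => 1
  | Fetch e1 => (ecost e1).+1
  | Bin _ e1 e2 => (ecost e1 + ecost e2).+1
  end.

Definition set_reg (s : state) (x a : nat) : state :=
  State [eta regs s with x |-> a] (ram s) (tape_in s) (tape_out s).

Definition set_mem (s : state) (i a : nat) : state :=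
  State (regs s) [eta ram s with i |-> a] (tape_in s) (tape_out s).

(** [exec w p s t s']: with [w]-bit words, the program [p] started in state [s]
    halts after exactly [t] steps in state [s']. *)
Inductive exec (w : nat) : cmd -> state -> nat -> state -> Prop :=
| ExecSkip s :
    exec w Skip s 1 s
| ExecAssign x e s a :
    eval w s e = Some a ->
    exec w (Assign x e) s (ecost e).+1 (set_reg s x a)
| ExecStore e1 e2 s i a :
    eval w s e1 = Some i -> eval w s e2 = Some a ->
    exec w (Store e1 e2) s (ecost e1 + ecost e2).+1 (set_mem s i a)
| ExecInput x r m a l o :
    a < 2 ^ w ->
    exec w (Input x) (State r m (a :: l) o) 1
         (set_reg (State r m l o) x a)
| ExecOutput e s a :
    eval w s e = Some a ->
    exec w (Output e) s (ecost e).+1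
         (State (regs s) (ram s) (tape_in s) (rcons (tape_out s) a))
| ExecSeq p1 p2 s t1 s1 t2 s2 :
    exec w p1 s t1 s1 -> exec w p2 s1 t2 s2 ->
    exec w (Seq p1 p2) s (t1 + t2) s2
| ExecIfTrue e p1 p2 s a t s' :
    eval w s e = Some a -> a != 0 -> exec w p1 s t s' ->
    exec w (If e p1 p2) s ((ecost e).+1 + t) s'
| ExecIfFalse e p1 p2 s t s' :
    eval w s e = Some 0 -> exec w p2 s t s' ->
    exec w (If e p1 p2) s ((ecost e).+1 + t) s'
| ExecWhileTrue e p s a t1 s1 t2 s2 :
    eval w s e = Some a -> a != 0 ->
    exec w p s t1 s1 -> exec w (While e p) s1 t2 s2 ->
    exec w (While e p) s ((ecost e).+1 + t1 + t2) s2
| ExecWhileFalse e p s :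
    eval w s e = Some 0 ->
    exec w (While e p) s (ecost e).+1 s.

Definition blank : state := State (fun=> 0) (fun=> 0) [::] [::].

(** Registers and memory survive from one run to the next; the tapes do not. *)
Definition feed (l : seq nat) (s : state) : state :=
  State (regs s) (ram s) l [::].

(** Words of [O(log n)] bits; [n.+2] keeps them nonempty when [n <= 1]. *)
Definition word_size (c n : nat) : nat := c * up_log 2 n.+2.

(** * Graphs and DFS trees *)

Definition edges (T : finType) (adj : rel T) : {set {set T}} :=
  [set [set x; y] | x in T, y in adj x].

(** A rooted spanning tree is given by its parent map, with the root as its own
    parent; [fconnect par v u] says that [u] is an ancestor of [v]. *)
Definition rooted_spanning_tree (V : finType) (adj : rel V) (r : V)
    (par : V -> V) : Prop :=
  [/\ par r = r,
      forall v, v != r -> adj v (par v)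
    & forall v, fconnect par v r].

Definition dfs_tree (V : finType) (adj : rel V) (r : V) (par : V -> V) : Prop :=
  rooted_spanning_tree adj r par /\
  forall x y, adj x y -> par x != y -> par y != x ->
    fconnect par x y || fconnect par y x.

(** The graph with a new vertex [None] whose neighbours satisfy [a]. *)
Definition add_vertex (T : finType) (adj : rel T) (a : pred T) :
    rel (option T) :=
  fun x y => match x, y with
  | Some u, Some v => adj u v
  | Some u, None | None, Some u => a u
  | None, None => false
  end.

(** * Updates *)

Inductive update (T : finType) :=
| InsertVertex of seq T
| DeleteVertex of T
| InsertEdge of T & T
| DeleteEdge of T & T.

Definition valid_update (T : finType) (adj : rel T) (U : update T) : bool :=
  match U with
  | InsertVertex s => uniq s
  | DeleteVertex _ => true
  | InsertEdge u v => (u != v) && ~~ adj u v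
  | DeleteEdge u v => adj u v
  end.

Definition updated_vertex (T : finType) (U : update T) : finType :=
  match U with
  | InsertVertex _ => option T
  | DeleteVertex v => {x : T | x != v}
  | InsertEdge _ _ | DeleteEdge _ _ => T
  end.

Definition updated_adj (T : finType) (adj : rel T) (U : update T) :
    rel (updated_vertex U) :=
  match U return rel (updated_vertex U) with
  | InsertVertex s => add_vertex adj (fun v => v \in s)
  | DeleteVertex v => fun x y => adj (val x) (val y)
  | InsertEdge u v => fun x y => adj x y || ([set x; y] == [set u; v])
  | DeleteEdge u v => fun x y => adj x y && ([set x; y] != [set u; v])
  end.

(** * Input and output formats

    The vertices [0], ..., [n - 1] are denoted by their numbers, an inserted
    vertex by [n], and the dummy root by [n.+1]. *)

(** [es] lists every edge once, in any order and in either orientation. *)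
Definition edge_list (T : finType) (adj : rel T) (es : seq (T * T)) : bool :=
  perm_eq [seq [set e.1; e.2] | e <- es] (enum (edges adj)).

Definition graph_code (n : nat) (es : seq ('I_n * 'I_n)) : seq nat :=
  n :: size es :: flatten [seq [:: nat_of_ord e.1; nat_of_ord e.2] | e <- es].

Definition update_code (n : nat) (U : update 'I_n) : seq nat :=
  match U with
  | InsertVertex s => 0 :: size s :: map (@nat_of_ord n) s
  | DeleteVertex v => [:: 1; nat_of_ord v]
  | InsertEdge u v => [:: 2; nat_of_ord u; nat_of_ord v]
  | DeleteEdge u v => [:: 3; nat_of_ord u; nat_of_ord v]
  end.

Definition vertex_code (n : nat) (U : update 'I_n) : updated_vertex U -> nat :=
  match U return updated_vertex U -> nat with
  | InsertVertex _ => fun x => if x is Some v then nat_of_ord v else n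
  | DeleteVertex _ => fun x => nat_of_ord (val x)
  | InsertEdge _ _ | DeleteEdge _ _ => fun x => nat_of_ord x
  end.

(** [l] consists of the pairs (vertex, parent), in some order of the vertices,
    of a DFS tree of the updated graph plus a dummy root [None] adjacent to all
    its vertices. *)
Definition reports_dfs_tree (n : nat) (adj : rel 'I_n) (U : update 'I_n)
    (l : seq nat) : Prop :=
  exists (par : option (updated_vertex U) -> option (updated_vertex U))
         (vs : seq (updated_vertex U)),
    [/\ dfs_tree (add_vertex (updated_adj adj (U := U)) xpredT) None par,
        perm_eq vs (enum (updated_vertex U))
      & l = flatten [seq [:: vertex_code v;
                             oapp (@vertex_code n U) n.+1 (par (Some v))]
                    | v <- vs]].

(* Main.v *)
Require Import Defs.
From mathcomp Require Import all_boot zify.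

(** Number the vertices in the preorder of a DFS tree [T] rooted at the dummy
    vertex, whose label is [0], so that the subtree of [c] is an interval
    [c, ..., e c - 1] of labels and every edge joins a label to one of its
    ancestors.  The vertex [n] to be inserted is present from the start, without
    edges.  Then an update only changes edges at one vertex [U].  The tree of
    the updated graph is obtained by rerooting: when the subtree of [w] is
    rerooted at [x], the tree path from [x] up to [w] is traversed downwards,
    and every subtree [c] that hangs from this path is in turn rerooted at the
    lower endpoint [x'] of an edge [(x', y')] with [y'] as high in [T] as
    possible among the vertices of the path.  The highest endpoint on the old
    path is the deepest one on the new path, so all edges leaving the subtree of
    [c] go to ancestors of [y'] in the new tree.  The component of [U] is
    rerooted at [U] itself and any other component at a neighbour of [U]; an
    edge to [U] is then the last choice for every hanging subtree, so the index
    need not reflect the update.  A single scan of the labels in increasing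
    order carries out all the rerootings, because a label is on the path of [w]
    exactly when its subtree contains [x].

    The highest edges are found in a segment tree over the labels in which a
    node stores the edges leaving its labels upwards, sorted by upper endpoint:
    building it takes [O(log n)] per edge, and a query is a binary search in
    each of [O(log n)] nodes. *)

Set Implicit Arguments.
Unset Strict Implicit.
Unset Printing Implicit Defensive.

(** * Programs over arrays, and their total-correctness logic *)

(** Choosing [U] as a root is what treats the four updates alike. A root is comparable with every
    vertex of its component, so a change at [U] cannot spoil the ancestor condition as long as every
    current neighbour of [U] ends up in its component; one row of the adjacency matrix settles that.
    The one edge at [U] that must survive is the edge to its old parent, because the reversed path
    uses it. Hence an edge update takes for [U] the endpoint with the smaller label, and a deleted
    vertex keeps this edge until its label is erased from the answer. At most one query is made per
    hanging subtree, and a query takes O(log^2 n) time, which leaves a factor log n to spare in the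
    bound for the report. The tables are never cleared: memory starts blank, so lists may sit at a
    stride of [N ^ 3] without costing time, at the price of addresses of order [N ^ 5] and hence of
    a larger constant in the word size. *)

Inductive aexpr :=
| K of nat
| R of nat
| Get of nat & aexpr
| Op of binop & aexpr & aexpr.

Inductive prog :=
| Nop
| Set_ of nat & aexpr
| Put of nat & aexpr & aexpr
| In of nat
| Out of aexpr
| Sq of prog & prog
| Cond of aexpr & prog & prog
| Loop of aexpr & prog.

(* The memory holds sixteen interleaved arrays *)
Definition cell (k : nat) (e : expr) : expr :=
  Bin OpAdd (Bin OpMul (Const 16) e) (Const k).

Fixpoint cexpr (e : aexpr) : expr :=
  match e with
  | K k => Const k
  | R x => Reg x
  | Get k e1 => Fetch (cell k (cexpr e1))
  | Op o e1 e2 => Bin o (cexpr e1) (cexpr e2)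
  end.

Fixpoint cprog (p : prog) : cmd :=
  match p with
  | Nop => Skip
  | Set_ x e => Assign x (cexpr e)
  | Put k e1 e2 => Store (cell k (cexpr e1)) (cexpr e2)
  | In x => Input x
  | Out e => Output (cexpr e)
  | Sq p1 p2 => Seq (cprog p1) (cprog p2)
  | Cond e p1 p2 => If (cexpr e) (cprog p1) (cprog p2)
  | Loop e p1 => While (cexpr e) (cprog p1)
  end.

Record astate := AState {
  rg : nat -> nat;
  mm : nat -> nat -> nat;
  ain : seq nat;
  aout : seq nat }.

(** [Nat.eqb] lets simplification decide lookups at literal register and array numbers, while
    [simpl nomatch] keeps lookups at variable indices folded. *)
Definition upd (A : Type) (f : nat -> A) (x : nat) (a : A) : nat -> A :=
  fun y => if Nat.eqb y x then a else f y.
Arguments upd {A} f x a y / : simpl nomatch.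

Lemma updE A (f : nat -> A) x a y : upd f x a y = if y == x then a else f y.
Proof. by rewrite /upd; case: eqP => [->|ne]; rewrite ?PeanoNat.Nat.eqb_refl //; case: PeanoNat.Nat.eqb_spec. Qed.

Lemma upd_same A (f : nat -> A) x a : upd f x a x = a.
Proof. by rewrite updE eqxx. Qed.

Lemma upd_other A (f : nat -> A) x a y : y != x -> upd f x a y = f y.
Proof. by rewrite updE => /negPf ->. Qed.

Fixpoint ev (s : astate) (e : aexpr) : nat :=
  match e with
  | K k => k
  | R x => rg s x
  | Get k e1 => mm s k (ev s e1)
  | Op o e1 e2 => binop_sem o (ev s e1) (ev s e2)
  end.

(** Evaluation [ev] is total; all overflow conditions, those on addresses included, are collected
    here, so that values can be reasoned about without options. *)
Fixpoint fits (w : nat) (s : astate) (e : aexpr) : Prop :=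
  match e with
  | K k => k < 2 ^ w
  | R x => True
  | Get k e1 => [/\ fits w s e1, 16 * ev s e1 + k < 2 ^ w & k < 16]
  | Op o e1 e2 => [/\ fits w s e1, fits w s e2
                    & binop_sem o (ev s e1) (ev s e2) < 2 ^ w]
  end.

Definition setr s x a := AState (upd (rg s) x a) (mm s) (ain s) (aout s).
Definition setm s k i a :=
  AState (rg s) (upd (mm s) k (upd (mm s k) i a)) (ain s) (aout s).

Definition cost (e : aexpr) := ecost (cexpr e).

Inductive aexec (w : nat) : prog -> astate -> nat -> astate -> Prop :=
| ANop s : aexec w Nop s 1 s
| ASet x e s : fits w s e -> aexec w (Set_ x e) s (cost e).+1 (setr s x (ev s e))
| APut k e1 e2 s : fits w s (Get k e1) -> fits w s e2 ->
    aexec w (Put k e1 e2) s (cost (Get k e1) + cost e2) (setm s k (ev s e1) (ev s e2))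
| AIn x r m a l o : a < 2 ^ w ->
    aexec w (In x) (AState r m (a :: l) o) 1 (AState (upd r x a) m l o)
| AOut e s : fits w s e ->
    aexec w (Out e) s (cost e).+1
          (AState (rg s) (mm s) (ain s) (rcons (aout s) (ev s e)))
| ASq p1 p2 s t1 s1 t2 s2 :
    aexec w p1 s t1 s1 -> aexec w p2 s1 t2 s2 -> aexec w (Sq p1 p2) s (t1 + t2) s2
| ACondT e p1 p2 s t s' : fits w s e -> ev s e != 0 ->
    aexec w p1 s t s' -> aexec w (Cond e p1 p2) s ((cost e).+1 + t) s'
| ACondF e p1 p2 s t s' : fits w s e -> ev s e = 0 ->
    aexec w p2 s t s' -> aexec w (Cond e p1 p2) s ((cost e).+1 + t) s'
| ALoopT e p s t1 s1 t2 s2 : fits w s e -> ev s e != 0 ->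
    aexec w p s t1 s1 -> aexec w (Loop e p) s1 t2 s2 ->
    aexec w (Loop e p) s ((cost e).+1 + t1 + t2) s2
| ALoopF e p s : fits w s e -> ev s e = 0 -> aexec w (Loop e p) s (cost e).+1 s.

Definition implements (st : state) (s : astate) : Prop :=
  [/\ regs st =1 rg s, forall k i, k < 16 -> ram st (16 * i + k) = mm s k i,
      tape_in st = ain s & tape_out st = aout s].

Section Simulation.
Variable w : nat.
Hypothesis w_large : 16 < 2 ^ w.

Lemma eval_cell st k e a : eval w st e = Some a -> k < 16 -> 16 * a + k < 2 ^ w ->
  eval w st (cell k e) = Some (16 * a + k).
Proof.
move=> ea k16 lt /=; rewrite ea /word w_large /= ifT; last by lia.
by rewrite /= ifT /= ?lt //; lia.
Qed.

Lemma eval_cexpr st s e : implements st s -> fits w s e ->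
  eval w st (cexpr e) = Some (ev s e).
Proof.
case=> hr hm _ _; elim: e => [k|x|k e IH|o e1 IH1 e2 IH2].
- by rewrite /= /word => ->.
- by rewrite /= hr.
- case=> /IH he lt k16; rewrite [eval _ _ _]/(omap (ram st) (eval w st (cell k (cexpr e)))).
  by rewrite (eval_cell he) //= hm.
- by case=> /= /IH1 -> /IH2 -> /=; rewrite /word => ->.
Qed.

(** A lock-step simulation: the step count is preserved exactly, so time bounds for array programs
    carry over to the machine. *)
Lemma aexec_exec p s t s' st : aexec w p s t s' -> implements st s ->
  exists2 st', exec w (cprog p) st t st' & implements st' s'.
Proof.
move=> H; elim: H st => {p s t s'}.
- by move=> s st; exists st => //; constructor.
- move=> x e s he st ist; exists (set_reg st x (ev s e)).
    by constructor; apply: eval_cexpr.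
  by case: ist => h1 h2 h3 h4; split=> // y; rewrite /= h1.
- move=> k e1 e2 s [he1 lt k16] he2 st ist.
  exists (set_mem st (16 * ev s e1 + k) (ev s e2)).
    by apply: ExecStore; [apply: eval_cell => //|]; apply: eval_cexpr.
  case: ist => h1 h2 h3 h4; split=> // k' i k'16 /=.
  rewrite !updE; have [->|ne] := eqVneq k' k; last by rewrite -h2 // ifF //; lia.
  by rewrite updE; have [->|ne] := eqVneq i (ev s e1); [rewrite eqxx | rewrite -h2 // ifF //; lia].
- move=> x r m a l o alt [r' m' i' o'] [/= h1 h2 h3 h4]; subst i' o'.
  eexists; first by constructor.
  by split=> //= y; rewrite updE /= h1.
- move=> e s he st ist; eexists; first by constructor; apply: eval_cexpr ist he.
  by case: ist => h1 h2 h3 h4; split=> //=; rewrite h4.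
- move=> p1 p2 s t1 s1 t2 s2 _ IH1 _ IH2 st /IH1 [st1 e1 /IH2 [st2 e2 i2]].
  by exists st2 => //; apply: ExecSeq e1 e2.
- move=> e p1 p2 s t s' he nz _ IH st ist; have [st' e' i'] := IH _ ist.
  by exists st' => //; apply: ExecIfTrue nz e'; apply: eval_cexpr.
- move=> e p1 p2 s t s' he z _ IH st ist; have [st' e' i'] := IH _ ist.
  by exists st' => //; apply: ExecIfFalse e'; rewrite -z; apply: eval_cexpr.
- move=> e p s t1 s1 t2 s2 he nz _ IH1 _ IH2 st ist.
  have [st1 e1 i1] := IH1 _ ist; have [st2 e2 i2] := IH2 _ i1.
  by exists st2 => //; apply: ExecWhileTrue nz e1 e2; apply: eval_cexpr.
- move=> e p s he z st ist; exists st => //.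
  by constructor; rewrite -z; apply: eval_cexpr.
Qed.

End Simulation.

(** * What a program can modify, read off its syntax *)

Fixpoint written (p : prog) : seq nat :=
  match p with
  | Set_ x _ | In x => [:: x]
  | Sq p1 p2 | Cond _ p1 p2 => written p1 ++ written p2
  | Loop _ p1 => written p1
  | _ => [::]
  end.

Fixpoint touched (p : prog) : seq nat :=
  match p with
  | Put k _ _ => [:: k]
  | Sq p1 p2 | Cond _ p1 p2 => touched p1 ++ touched p2
  | Loop _ p1 => touched p1
  | _ => [::]
  end.

Fixpoint reads (p : prog) : bool :=
  match p with
  | In _ => true
  | Sq p1 p2 | Cond _ p1 p2 => reads p1 || reads p2
  | Loop _ p1 => reads p1
  | _ => false
  end.

Fixpoint prints (p : prog) : bool :=
  match p with
  | Out _ => true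
  | Sq p1 p2 | Cond _ p1 p2 => prints p1 || prints p2
  | Loop _ p1 => prints p1
  | _ => false
  end.

(** With this, a specification needs to mention only what its program changes; every other fact
    survives by computation on the syntax. *)
Record frame (p : prog) (s s' : astate) : Prop := Frame {
  fr_rg : forall x, x \notin written p -> rg s' x = rg s x;
  fr_mm : forall k, k \notin touched p -> mm s' k = mm s k;
  fr_in : ~~ reads p -> ain s' = ain s;
  fr_out : ~~ prints p -> aout s' = aout s }.

Lemma frame_trans p s1 s2 s3 : frame p s1 s2 -> frame p s2 s3 -> frame p s1 s3.
Proof.
by move=> [a b c d] [a' b' c' d']; split=> [x h|k h|h|h];
  rewrite ?a' ?b' ?c' ?d' // ?a ?b ?c ?d.
Qed.

Lemma frame_sub p q s s' : {subset written p <= written q} ->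
  {subset touched p <= touched q} -> (reads p -> reads q) -> (prints p -> prints q) ->
  frame p s s' -> frame q s s'.
Proof.
move=> h1 h2 h3 h4 [a b c d]; split=> [x h|k h|h|h].
- by apply: a; apply: contra h => /h1.
- by apply: b; apply: contra h => /h2.
- by apply: c; apply: contra h => /h3.
- by apply: d; apply: contra h => /h4.
Qed.

Lemma aexec_frame w p s t s' : aexec w p s t s' -> frame p s s'.
Proof.
have subl (q1 q2 : seq nat) : {subset q1 <= q1 ++ q2} by move=> x; rewrite mem_cat => ->.
have subr (q1 q2 : seq nat) : {subset q2 <= q1 ++ q2}.
  by move=> x; rewrite mem_cat => ->; rewrite orbT.
elim=> {p s t s'} //.
- by move=> x e s _; split=> //= y; rewrite inE => h; apply: upd_other.
- by move=> k e1 e2 s _ _; split=> //= y; rewrite inE => h; apply: upd_other.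
- by move=> x r m a l o _; split=> //= y; rewrite inE => h; apply: upd_other.
- move=> p1 p2 s t1 s1 t2 s2 _ IH1 _ IH2; apply: (@frame_trans _ _ s1).
    by apply: frame_sub IH1 => //= ->.
  by apply: frame_sub IH2 => //= ->; rewrite orbT.
- by move=> e p1 p2 s t s' _ _ _ IH; apply: frame_sub IH => //= ->.
- by move=> e p1 p2 s t s' _ _ _ IH; apply: frame_sub IH => //= ->; rewrite orbT.
- by move=> e p s t1 s1 t2 s2 _ _ _ IH1 _ IH2; apply: frame_trans IH2; case: IH1.
Qed.

(** The postcondition also takes the running time. The run is asserted to exist, so termination and
    absence of overflow are part of the claim. *)
Definition wp (w : nat) (p : prog) (Q : nat -> astate -> Prop) (s : astate) : Prop :=
  exists t s', aexec w p s t s' /\ Q t s'.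

Section WeakestPreconditions.
Variable w : nat.
Implicit Types (Q : nat -> astate -> Prop) (s : astate).

Lemma wp_mono p Q Q' s : wp w p Q s ->
  (forall t s', frame p s s' -> Q t s' -> Q' t s') -> wp w p Q' s.
Proof.
by move=> [t [s' [h q]]] QQ'; exists t, s'; split=> //; apply: QQ' q; apply: aexec_frame h.
Qed.

Lemma wp_nop Q s : Q 1 s -> wp w Nop Q s.
Proof. by move=> q; exists 1, s; split=> //; constructor. Qed.

Lemma wp_set x e Q s : fits w s e -> Q (cost e).+1 (setr s x (ev s e)) ->
  wp w (Set_ x e) Q s.
Proof. by move=> h q; eexists _, _; split; [constructor|]. Qed.

Lemma wp_put k e1 e2 Q s : fits w s (Get k e1) -> fits w s e2 ->
  Q (cost (Get k e1) + cost e2) (setm s k (ev s e1) (ev s e2)) ->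
  wp w (Put k e1 e2) Q s.
Proof. by move=> h1 h2 q; eexists _, _; split; [constructor|]. Qed.

Lemma wp_in x Q s a l : ain s = a :: l -> a < 2 ^ w ->
  Q 1 (AState (upd (rg s) x a) (mm s) l (aout s)) -> wp w (In x) Q s.
Proof.
by case: s => r m i o /= -> h q; eexists _, _; split; [constructor|].
Qed.

Lemma wp_out e Q s : fits w s e ->
  Q (cost e).+1 (AState (rg s) (mm s) (ain s) (rcons (aout s) (ev s e))) ->
  wp w (Out e) Q s.
Proof. by move=> h q; eexists _, _; split; [constructor|]. Qed.

Lemma wp_sq p1 p2 Q s :
  wp w p1 (fun t1 => wp w p2 (fun t2 => Q (t1 + t2))) s -> wp w (Sq p1 p2) Q s.
Proof.
by move=> [t1 [s1 [h1 [t2 [s2 [h2 q]]]]]]; exists (t1 + t2), s2; split=> //; econstructor; eauto.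
Qed.

Lemma wp_cond e p1 p2 Q s : fits w s e ->
  (ev s e != 0 -> wp w p1 (fun t => Q ((cost e).+1 + t)) s) ->
  (ev s e = 0 -> wp w p2 (fun t => Q ((cost e).+1 + t)) s) ->
  wp w (Cond e p1 p2) Q s.
Proof.
move=> h h1 h2; have [z|nz] := eqVneq (ev s e) 0.
  by have [t [s' [e2 q]]] := h2 z; eexists _, s'; split; [apply: ACondF e2|].
by have [t [s' [e1 q]]] := h1 nz; eexists _, s'; split; [apply: ACondT e1|].
Qed.

(* The invariant carries the time still available to the loop, so that an
   amortized bound also proves termination *)
Lemma wp_loop e p (I : nat -> astate -> Prop) b s :
  I b s ->
  (forall b s', frame p s s' -> I b s' -> fits w s' e /\
     (ev s' e != 0 ->
      wp w p (fun t s'' => exists2 b', I b' s'' & t + (cost e).+1 + b' <= b) s')) ->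
  wp w (Loop e p) (fun t s' => ev s' e = 0 /\
                  exists2 b', I b' s' & t + b' <= (cost e).+1 + b) s.
Proof.
move=> Ib step; suff H b1 s1 : I b1 s1 -> frame p s s1 ->
    wp w (Loop e p) (fun t s' => ev s' e = 0 /\
                  exists2 b', I b' s' & t + b' <= (cost e).+1 + b1) s1 by exact: H.
(* Each iteration pays at least for its guard, so the budget strictly decreases. *)
elim/ltn_ind: b1 s1 {Ib} => {}b IH s1 Ib F.
have [h1 h2] := step b s1 F Ib; have [z|nz] := eqVneq (ev s1 e) 0.
  by eexists _, s1; split; [apply: ALoopF|split=> //; exists b].
have [t [s2 [e2 [b' Ib' le]]]] := h2 nz; have [||t' [s3 [e3 [z [b3 I3 le3]]]]] := IH b' _ s2 Ib'.
- lia.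
- exact: frame_trans F (aexec_frame e2).
by eexists _, s3; split; [apply: ALoopT e2 e3|split=> //; exists b3 => //; lia].
Qed.

End WeakestPreconditions.

(** * Rerooting a depth-first search tree in preorder *)

Definition anc (P : nat -> nat) (b v : nat) : Prop := exists k, iter k P v = b.

Lemma anc_refl P v : anc P v v.
Proof. by exists 0. Qed.

Lemma anc_step P b v : anc P b (P v) -> anc P b v.
Proof. by case=> k <-; exists k.+1; rewrite iterSr. Qed.

Lemma anc_trans P b c v : anc P b c -> anc P c v -> anc P b v.
Proof. by case=> j <- [k <-]; exists (j + k); rewrite iterD. Qed.

(** The last field says that the parent is the innermost interval properly enclosing a label. This
    makes the intervals laminar, and ancestry becomes interval membership. *)
Record preorder_tree (N : nat) (par e : nat -> nat) : Prop := PreorderTree {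
  pt_end0 : e 0 = N;
  pt_par : forall x, 0 < x < N -> par x < x;
  pt_end : forall x, 0 < x < N -> x < e x <= e (par x);
  pt_anc : forall x a, 0 < x < N -> a < x < e a -> a <= par x }.

Record dfs_numbering (N : nat) (G : rel nat) (par e : nat -> nat) : Prop :=
  DfsNumbering {
  dn_tree :> preorder_tree N par e;
  dn_edge : forall x, 0 < x < N -> 0 < par x -> G (par x) x;
  dn_back : forall y x, 0 < y -> y < x < N -> G y x -> x < e y }.

(** Edges to labels smaller than [w] are left out on purpose: they leave the whole subtree of [w],
    and the way [w] itself is attached takes care of them. That [y] lies on the path is not demanded
    but follows from minimality, see [highest_on_path]. *)
Definition highest_edge (G : rel nat) (e : nat -> nat) (c w x y : nat) : Prop :=
  [/\ c <= x < e c, w <= y < x, G y x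
    & forall x' y', c <= x' < e c -> w <= y' < x' -> G y' x' -> y <= y'].

Definition attach_to (U : nat) (row : pred nat) (e : nat -> nat) (c x y : nat) :=
  [/\ y = U, c <= x < e c & row x] \/
  [/\ y = 0, x = c & forall z, c <= z < e c -> ~~ row z].

(** If the best old edge ends at [U], the path offers nothing higher, and that edge may have been
    deleted; the current row of [U] decides instead. A subtree without neighbours of [U] then
    becomes a component of its own, under label 0. *)
Definition hook (G : rel nat) (U : nat) (row : pred nat) (par e top : nat -> nat)
    (c x y : nat) : Prop :=
  if par c == 0 then
    if c <= U < e c then x = U /\ y = 0 else attach_to U row e c x y
  else exists x0 y0, highest_edge G e c (top (par c)) x0 y0 /\
    if y0 == U then attach_to U row e c x y else x = x0 /\ y = y0.

(** With the number of labels processed so far in place of [N], the same record is the loop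
    invariant of the scan. *)
Record sweep (N : nat) (G : rel nat) (U : nat) (row : pred nat)
    (par e top X P : nat -> nat) : Prop := Sweep {
  sw_top0 : top 0 = 0;
  sw_X0 : X 0 = 0;
  sw_P0 : P 0 = 0;
  sw_path : forall c, 0 < c < N -> c <= X (top (par c)) < e c ->
    top c = top (par c) /\ P (par c) = c;
  sw_hang : forall c, 0 < c < N -> ~~ (c <= X (top (par c)) < e c) ->
    top c = c /\ hook G U row par e top c (X c) (P (X c)) }.

(** * Intervals of a preorder numbering *)

Section PreorderTree.
Variables (N : nat) (par e : nat -> nat).
Hypothesis T : preorder_tree N par e.

(** Climbing from [b] to its parent does not leave the interval of [a] before reaching [a], by
    [pt_anc]. *)
Lemma nested a b : b < N -> a <= b < e a -> e b <= e a.
Proof.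
elim/ltn_ind: b => b IH bN ab; have [->//|nab] := eqVneq a b.
have b0 : 0 < b < N by lia.
have := pt_anc T b0 (a := a); have := pt_par T b0; have := pt_end T b0.
move=> h1 h2 h3; have := IH (par b); lia.
Qed.

Lemma end_le a : a < N -> e a <= N.
Proof. by move=> aN; rewrite -(pt_end0 T) nested // (pt_end0 T). Qed.

Lemma end_gt a : a < N -> a < e a.
Proof.
case: a => [|a] aN; first by rewrite (pt_end0 T).
by have := @pt_end _ _ _ T a.+1; lia.
Qed.

Lemma child_towards v x : v < x < e v -> x < N ->
  exists c, [/\ 0 < c < N, par c = v & c <= x < e c].
Proof.
elim/ltn_ind: x => x IH vx xN; have x0 : 0 < x < N by lia.
have h1 := pt_anc T x0 vx; have h2 := pt_par T x0; have h3 := pt_end T x0.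
have [eq|ne] := eqVneq (par x) v; first by exists x; split => //; lia.
have [|||c [h4 h5 h6]] := IH (par x); [lia..|exists c; split=> //].
have := @nested c (par x); lia.
Qed.

Lemma siblings a b x : 0 < a < N -> 0 < b < N -> par a = par b ->
  a <= x < e a -> b <= x < e b -> a = b.
Proof.
move=> aN bN eq ax bx; have := pt_par T aN; have := pt_par T bN.
have := pt_anc T aN (a := b); have := pt_anc T bN (a := a); lia.
Qed.

End PreorderTree.

(** * The scan after a prefix of the labels *)

Section PartialSweep.
Variables (N k U : nat) (G : rel nat) (row : pred nat) (par e top X P : nat -> nat).
Hypothesis T : preorder_tree N par e.
Hypothesis kN : k <= N.
Hypothesis N0 : 0 < N.
Hypothesis S : sweep k G U row par e top X P.

Lemma hook_in c x y : 0 < c < N -> hook G U row par e top c x y -> c <= x < e c.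
Proof.
move=> cN; have cc := @end_gt _ _ _ T c; rewrite /hook.
have A : attach_to U row e c x y -> c <= x < e c by case=> -[]; lia.
case: ifP => _; first by case: ifP => // h [-> _].
by move=> [x0 [y0 [[h1 _ _ _]]]]; case: ifP => // _ [-> _].
Qed.

Lemma top_spec v : v < k ->
  [/\ top v <= v < e (top v), top (top v) = top v,
      v <= X (top v) < e v & 0 < v -> 0 < top v].
Proof.
elim/ltn_ind: v => v IH vk; have [->|v0] := posnP v.
  by rewrite (sw_top0 S) (sw_top0 S) (sw_X0 S) (pt_end0 T); split; lia.
have vN : 0 < v < N by lia.
have vk' : 0 < v < k by lia.
have h1 := pt_par T vN; have h3 := pt_end T vN.
have [h|h] := boolP (v <= X (top (par v)) < e v).
  have [-> _] := sw_path S vk' h; have [||a b c d] := IH (par v); [lia..|].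
  split=> //; first by have := @nested _ _ _ T (top (par v)) (par v); lia.
  move=> _; case: (posnP (par v)) => [z|/d//].
  by move: h; rewrite z (sw_top0 S) (sw_X0 S); lia.
have [-> /(hook_in vN) h2] := sw_hang S vk' h; split=> //; try lia.
by have [] := sw_hang S vk' h.
Qed.

(** The membership test passes from parent to child along the tree path from [c] down to [X c], so
    the whole path carries the mark of [c]. *)
Lemma top_unique c v : v < k -> top c = c -> c <= v < e c -> v <= X c < e v ->
  top v = c.
Proof.
elim/ltn_ind: v => v IH vk tc cv vX; have [<-//|ncv] := eqVneq c v.
have vN : 0 < v < N by lia.
have vk' : 0 < v < k by lia.
have h1 := pt_par T vN; have h3 := pt_end T vN; have h4 := pt_anc T vN (a := c).
have tp : top (par v) = c by apply: IH => //; lia.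
by have [] := sw_path S vk'; rewrite tp.
Qed.

Lemma hook_top top' c x y : (forall v, v < c -> top' v = top v) -> 0 < c < N ->
  hook G U row par e top c x y -> hook G U row par e top' c x y.
Proof. by move=> eq cN; rewrite /hook eq //; apply: (pt_par T cN). Qed.

Hypothesis kN' : 0 < k < N.

(** The point is that [P (par k)] has not been set before. A path step would come from a sibling of
    [k] that also contains the end of the path, and a hook at [par k] would make [par k] itself that
    end. *)
Lemma sweep_extend_path : k <= X (top (par k)) < e k ->
  sweep k.+1 G U row par e (upd top k (top (par k))) X (upd P (par k) k).
Proof.
move=> Xk; have pk := pt_par T kN'.
have old v : v < k -> upd top k (top (par k)) v = top v.
  by move=> vk; rewrite upd_other //; lia.
(* The path of label 0 is 0 alone, so its children always hang. *)
have p0 : par k != 0.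
  by apply: contraTneq Xk => ->; rewrite (sw_top0 S) (sw_X0 S); lia.
split.
- by rewrite old ?(sw_top0 S) //; lia.
- exact: sw_X0 S.
- by rewrite upd_other ?(sw_P0 S) // eq_sym.
- move=> c ck; have cN : 0 < c < N by lia.
  have pc := pt_par T cN; rewrite old; last lia.
  move=> Xc; have [lt|le] := ltnP c k; last first.
    have ck' : c = k by lia.
    by rewrite ck' !upd_same.
  have [|h1 h2] := sw_path S _ Xc; first lia.
  rewrite old //; split=> //; rewrite upd_other //; apply/eqP => eq.
  by rewrite eq in Xc; have := siblings T cN kN' eq Xc Xk; lia.
- move=> c ck; have cN : 0 < c < N by lia.
  have pc := pt_par T cN; rewrite old; last lia.
  move=> Xc; have [lt|le] := ltnP c k; last first.
    have ck' : c = k by lia.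
    by move: Xc; rewrite ck' Xk.
  have [|h1 h2] := sw_hang S _ Xc; first lia.
  rewrite old //; split=> //.
  have cX := hook_in cN h2.
  rewrite upd_other; first by apply: (hook_top _ cN h2) => v vc; apply: old; lia.
  apply/eqP => eq; rewrite eq in cX.
  have tp : top (par k) = c.
    by apply: top_unique => //; rewrite eq (@end_gt _ _ _ T) ?leqnn //; lia.
  by move: Xk; rewrite tp eq; lia.
Qed.

(** The slot [P x] is fresh as well: path steps so far were written at labels below [k], while
    [k <= x], and an earlier subtree rerooted at [x] would have [k] on its path. *)
Lemma sweep_extend_hang x y : ~~ (k <= X (top (par k)) < e k) ->
  hook G U row par e top k x y ->
  sweep k.+1 G U row par e (upd top k k) (upd X k x) (upd P x y).
Proof.
move=> Xk hk; have pk := pt_par T kN'; have kx := hook_in kN' hk.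
have old v : v < k -> upd top k k v = top v by move=> vk; rewrite upd_other //; lia.
have oldX v : v < k -> upd X k x v = X v by move=> vk; rewrite upd_other //; lia.
have topk v : v < k -> top v < k by move=> vk; have [] := top_spec vk; lia.
split.
- by rewrite old ?(sw_top0 S) //; lia.
- by rewrite oldX ?(sw_X0 S) //; lia.
- by rewrite upd_other ?(sw_P0 S) //; lia.
- move=> c ck; have cN : 0 < c < N by lia.
  have pc := pt_par T cN; have pck : par c < k by lia.
  rewrite old // [upd X k x (top (par c))]oldX; last exact: topk.
  move=> Xc; have [lt|le] := ltnP c k; last first.
    have ck' : c = k by lia.
    by move: Xk; rewrite -ck' Xc.
  have [|h1 h2] := sw_path S _ Xc; first lia.
  by rewrite old // upd_other //; lia.
- move=> c ck; have cN : 0 < c < N by lia.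
  have pc := pt_par T cN; have pck : par c < k by lia.
  rewrite old // [upd X k x (top (par c))]oldX; last exact: topk.
  move=> Xc; have [lt|le] := ltnP c k; last first.
    have -> : c = k by lia.
    by rewrite !upd_same; split=> //; apply: (hook_top old kN' hk).
  have [|h1 h2] := sw_hang S _ Xc; first lia.
  rewrite old // oldX //; split=> //.
  have cX := hook_in cN h2.
  rewrite upd_other; first by apply: (hook_top _ cN h2) => v vc; apply: old; lia.
  apply/eqP => eq; rewrite eq in cX.
  have ek := pt_end T kN'; have := pt_anc T kN' (a := c) => ank.
  have tp : top (par k) = c by apply: top_unique => //; rewrite ?eq; lia.
  by move: Xk; rewrite tp eq kx.
Qed.

End PartialSweep.

(** * The new parents form a depth-first search tree *)

Section Correctness.
Variables (N U : nat) (G G' : rel nat) (row : pred nat) (par e top X P : nat -> nat).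
Hypothesis T : dfs_numbering N G par e.
Hypothesis S : sweep N G U row par e top X P.
Hypothesis U_range : 0 < U < N.
Hypothesis G_G' : forall a b, 0 < a < N -> 0 < b < N -> a != U -> b != U ->
  G' a b = G a b.
Hypothesis G'_sym : forall a b, G' a b = G' b a.
Hypothesis G_sym : forall a b, G a b = G b a.
(** The row may disagree at [par U], as it can after a vertex deletion: no subtree attached to [U]
    contains [par U]. *)
Hypothesis row_G' : forall x, 0 < x < N -> x != par U -> row x = G' U x.
Hypothesis G'_parU : 0 < par U -> G' (par U) U.

Let in_range x : 0 < x < N -> e x <= N.
Proof. by move=> h; apply: (end_le T); lia. Qed.

Let N0 : 0 < N. Proof. by lia. Qed.
Let top_spec := top_spec T (leqnn N) N0 S.
Let top_unique := top_unique T (leqnn N) N0 S.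

(** Paths get reversed: [P] leads from a label to its child on the path, so the larger labels become
    ancestors of the smaller ones. *)
Lemma path_chain a b : a < N -> b < N -> top a = top b -> a <= b -> anc P b a.
Proof.
move=> aN bN; move: {2}(b - a).+1 (ltnSn (b - a)) => k.
elim: k a aN => // k IH a aN hk eq ab.
have [->|ne] := eqVneq a b; first exact: anc_refl.
have [a1 a2 a3 _] := top_spec aN; have [b1 b2 b3 _] := top_spec bN.
rewrite -eq in b3; have rN := end_le T bN.
have [||c [cN pc cX]] := @child_towards _ _ _ T a (X (top a)); [lia|lia|].
have := sw_path S cN; rewrite pc => /(_ cX) [tc Pa].
have := pt_anc T cN (a := b); have := pt_par T cN; rewrite pc => h1 h2.
by apply: anc_step; rewrite Pa; apply: IH; [lia..|congruence|lia].
Qed.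

Lemma top_anc v : v < N -> anc P (X (top v)) v.
Proof.
move=> vN; have [a1 a2 a3 _] := top_spec vN; have := end_le T vN.
have := @nested _ _ _ T (top v) v; move=> h1 h2.
by apply: path_chain => //; [lia| |lia]; rewrite (@top_unique (top v)) //; try lia;
  have := @end_gt _ _ _ T (X (top v)); lia.
Qed.

Lemma hanging c : 0 < c < N -> top c = c ->
  hook G U row par e top c (X c) (P (X c)) /\ top (par c) < c.
Proof.
move=> cN tc; have h1 := pt_par T cN; have [|a1 a2 a3 _] := @top_spec (par c); first lia.
have [h|h] := boolP (c <= X (top (par c)) < e c); last first.
  by have [_ ?] := sw_hang S cN h; split=> //; lia.
by have [] := sw_path S cN h; lia.
Qed.

(** The path of [r] already ends at [U], so it takes in every label of this subtree whose interval
    contains [U]; hence no other rerooted subtree contains [U]. *)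
Lemma root_of_U : exists r, [/\ 0 < r < N, par r = 0, r <= U < e r, top r = r
  & [/\ X r = U, P U = 0, top U = r
      & forall c, 0 < c < N -> top c = c -> c <= U < e c -> c = r]].
Proof.
have [||r [rN pr rU]] := @child_towards _ _ _ T 0 U; [by rewrite (pt_end0 T)|lia|].
have [] := sw_hang S rN; first by rewrite pr (sw_top0 S) (sw_X0 S); lia.
move=> tr; rewrite /hook pr eqxx rU => -[Xr]; rewrite Xr => PU.
have tU : top U = r.
  by apply: top_unique; rewrite ?Xr //; have := @end_gt _ _ _ T U; lia.
exists r; split=> //; split=> // c cN tc cU.
have [lt|le] := ltnP c r; first by have := pt_anc T rN (a := c); lia.
by rewrite -tc; apply: top_unique; rewrite ?Xr //; lia.
Qed.

(** The tree edge from [par c] to [c] is itself a candidate, so the minimum lies at or above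
    [par c]. By the DFS property the upper end is an ancestor of [c], hence on the same path. *)
Lemma highest_on_path c x y : 0 < c < N -> top c = c -> 0 < par c ->
  highest_edge G e c (top (par c)) x y ->
  [/\ y <= par c, top y = top (par c), 0 < y & y < N].
Proof.
move=> cN tc pc [cx wy Gyx minE]; have h1 := pt_par T cN; have h3 := pt_end T cN.
have [|a1 a2 a3 a4] := @top_spec (par c); first lia.
have xN := in_range cN.
have yp : y <= par c by apply: (minE c); [lia..|apply: dn_edge T _ cN pc].
have := @dn_back _ _ _ _ T y x _ _ Gyx; move=> h4.
split=> //; try lia; apply: top_unique => //; try lia.
by have := @nested _ _ _ T y (par c); lia.
Qed.

Lemma attach_cases c : 0 < c < N -> top c = c ->
  [\/ [/\ c <= U < e c, X c = U & P U = 0],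
      ~~ (c <= U < e c) /\
      (par c = 0 \/ par c = U /\ exists x0, highest_edge G e c (top U) x0 U) /\
      attach_to U row e c (X c) (P (X c))
    | ~~ (c <= U < e c) /\ 0 < par c /\ P (X c) != U /\
      highest_edge G e c (top (par c)) (X c) (P (X c))].
Proof.
move=> cN tc; have [hk lt] := hanging cN tc.
have [r [rN pr rU tr [Xr PU tU uniqr]]] := root_of_U.
have [cU|cU] := boolP (c <= U < e c).
  by have cr := uniqr c cN tc cU; subst c; constructor 1.
move: hk; rewrite /hook (negPf cU).
case: eqP => [pc at_|pc [x0 [y0 [hi]]]]; first by constructor 2; auto.
have pc0 : 0 < par c by lia.
case: eqP => [yU at_|yU [Xc Pc]]; last first.
  by constructor 3; rewrite Pc Xc; do !split=> //; apply/eqP.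
constructor 2; split=> //; split; last by [].
have [h1 h2 h3 h4] := highest_on_path cN tc pc0 hi; subst y0.
have [|a1 a2 a3 a4] := @top_spec (par c); first by have := pt_par T cN; lia.
(* [U] is the last label of its path, and [par c] lies on that path at or after [U]. *)
have pcU : par c = U by move: a3; rewrite -h2 tU Xr; lia.
by right; split=> //; exists x0; rewrite -[in top _]pcU.
Qed.

(** An edge leaving a rerooted subtree goes to an old proper ancestor [b] of [c], or to [U]. If [b]
    is on the path from which [c] hangs, the chosen endpoint is at least as high in the old tree, so
    [b] is above it on the reversed path. If [b] is higher up, the edge also leaves the subtree of
    the top of that path, and induction applies there. *)
Lemma outside_edge c z b : 0 < c < N -> top c = c -> c <= z < e c -> z != U ->
  0 < b < N -> ~~ (c <= b < e c) -> G' z b -> anc P b (P (X c)).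
Proof.
have [r [rN pr rU tr [Xr PU tU uniqr]]] := root_of_U.
elim/ltn_ind: c z b => c IH z b cN tc cz zU bN cb Gzb.
have zN : 0 < z < N by have := in_range cN; lia.
have old : b != U -> [/\ b < c, c < e b & b <= par c].
  move=> bU; move: Gzb; rewrite G_G' // => Gzb.
  have [zb|bz] := ltnP z b.
    have := @dn_back _ _ _ _ T z b _ _ Gzb; have := @nested _ _ _ T c z; move=> *; split; lia.
  have bz' : b < z by lia.
  have := @dn_back _ _ _ _ T b z; rewrite G_sym => /(_ _ _ Gzb) h.
  by have := pt_anc T cN (a := b); split; lia.
have hc := pt_par T cN.
have [[cU Xc _]|[cU [side at_]]|[cU [pc [PcU hi]]]] := attach_cases cN tc.
- have cr := uniqr c cN tc cU; subst c.
  have [bU|bU] := eqVneq b U; first lia.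
  by have [] := old bU; lia.
(* The subtree of [c] does not contain [par U], so the row of [U] can be trusted on it. *)
- have cp : c <= par U -> c <= par U < e c -> False.
    move=> _ h; case: side => [pc|].
      have UN := pt_par T U_range; have := pt_end T U_range.
      by have := @nested _ _ _ T c (par U); lia.
    by have := pt_par T U_range; lia.
  have [bU|bU] := eqVneq b U.
    subst b; case: at_ => [[-> _ _]|[_ _ no]]; first exact: anc_refl.
    move: (no z cz); rewrite row_G' 1?G'_sym ?Gzb //.
    by apply/eqP => zp; apply: cp; lia.
  have [b1 b2 b3] := old bU.
  case: side cp => [|[pcU [x0 hi]]] cp; first lia.
  (* [b] is a proper ancestor of [U]: in the subtree of [r] it would be a higher choice than [U] *)
  have [br|br] := boolP (r <= b < e r).
    have [h1 _ _ minE] := hi; move: (Gzb); rewrite G_G' // G_sym => Gbz.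
    by have := minE z b cz _ Gbz; rewrite tU; lia.
  have : c <= U < e c -> False by lia.
  have rc : r < c by lia.
  have zr : r <= z < e r.
    by have := @nested _ _ _ T r U; have := @nested _ _ _ T U c; have := pt_end T cN; rewrite pcU; lia.
  (* The subtree of [r] is attached to label 0, whose only ancestor is 0, so no edge from [z] can
     leave it. *)
  have := IH r rc z b rN tr zr zU bN br Gzb; rewrite Xr PU.
  case=> k; have -> : iter k P 0 = 0 by elim: k => //= k ->; exact: sw_P0 S.
  by lia.
have [y1 ty y0 yN] := highest_on_path cN tc pc hi.
have pcN : par c < N by lia.
have [w1 w2 w3 w4] := top_spec pcN; have wc : top (par c) < c by lia.
have wN : 0 < top (par c) < N by lia.
have zw : top (par c) <= z < e (top (par c)).
  have := @nested _ _ _ T (top (par c)) (par c); have := pt_end T cN; lia.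
have pathy : anc P (X (top (par c))) (P (X c)) by rewrite -ty; apply: top_anc.
have [bw|bw] := boolP (top (par c) <= b < e (top (par c))); last first.
  apply: anc_trans pathy; apply: anc_step.
  exact: (IH _ wc z b wN).
(* If the enclosing rerooted subtree contains [U], it is that of [r], and [U] is the topmost label
   of its reversed path. *)
have [bU|bU] := eqVneq b U.
  by subst b; move: pathy; rewrite (uniqr _ wN w2 bw) Xr.
have [b1 b2 b3] := old bU.
have [_ _ _ minE] := hi; move: (Gzb); rewrite G_G' // G_sym => Gbz.
have yb := minE z b cz _ Gbz.
apply: path_chain => //; try lia.
rewrite ty; symmetry; apply: top_unique => //; try lia.
have := @nested _ _ _ T b (par c); lia.
Qed.

(** If one endpoint is outside the rerooted subtree whose path contains the other, [outside_edge]
    puts it above. If neither is, the two subtrees contain each other's endpoints and must coincide,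
    and the labels of one path form a chain. An edge at [U] is examined from its other end. *)
Theorem sweep_comparable a b : 0 < a < N -> 0 < b < N -> G' a b ->
  anc P a b \/ anc P b a.
Proof.
have [r [rN pr rU tr [Xr PU tU uniqr]]] := root_of_U.
have key x y : 0 < x < N -> 0 < y < N -> x != U -> G' x y ->
    ~~ (top x <= y < e (top x)) -> anc P y x.
  move=> xN yN xU Gxy out.
  have xN' : x < N by lia.
  have [x1 x2 x3 x4] := top_spec xN'.
  apply: anc_trans (top_anc xN'); apply: anc_step.
  by apply: (outside_edge (z := x)) => //; lia.
have same x y : x < N -> y < N -> top x = top y -> anc P x y \/ anc P y x.
  move=> xN yN eq; have [le|/ltnW le] := leqP x y.
    by right; apply: path_chain.
  by left; apply: path_chain.
move=> aN bN Gab; have aN' : a < N by lia. have bN' : b < N by lia.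
have [a1 a2 a3 a4] := top_spec aN'; have [b1 b2 b3 b4] := top_spec bN'.
have [ba|ba] := boolP (top a <= b < e (top a)); last first.
  have [aU|aU] := eqVneq a U; last by right; apply: key.
  have [bU|bU] := eqVneq b U; first by apply: same => //; congruence.
  have [ab|ab] := boolP (top b <= a < e (top b)); last first.
    by left; apply: key => //; rewrite G'_sym.
  by apply: same => //; rewrite aU tU; symmetry; apply: uniqr => //; rewrite -?aU; lia.
have [ab|ab] := boolP (top b <= a < e (top b)); last first.
  have [bU|bU] := eqVneq b U; last by left; apply: key => //; rewrite G'_sym.
  by apply: same => //; rewrite bU tU; apply: uniqr => //; rewrite -?bU; lia.
have sub x y : 0 < x < N -> 0 < y < N -> top x <= y < e (top x) -> top y <= x < e (top y) ->
   top x <= top y -> top x = top y.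
  move=> xN yN xy yx le.
  have xN' : x < N by lia. have yN' : y < N by lia.
  have [x1 x2 x3 x4] := top_spec xN'; have [y1 y2 y3 y4] := top_spec yN'.
  rewrite -[RHS]y2; symmetry; apply: top_unique => //; try lia.
  by have := @nested _ _ _ T (top y) x; lia.
by apply: same => //; have [|/ltnW] := leqP (top a) (top b) => le; [|symmetry]; apply: sub.
Qed.

(** A label inside its path is reparented to its child there, along an old tree edge; only the end
    of a path uses the hook. *)
Theorem sweep_parent v : 0 < v < N -> P v = 0 \/ 0 < P v < N /\ G' v (P v).
Proof.
have [r [rN pr rU tr [Xr PU tU uniqr]]] := root_of_U.
move=> vN; have vN' : v < N by lia.
have [v1 v2 v3 v4] := top_spec vN'; have := end_le T vN'; move=> h1.
have tN : 0 < top v < N by lia.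
have [eq|ne] := eqVneq v (X (top v)); last first.
  have [||c [cN pc cX]] := @child_towards _ _ _ T v (X (top v)); [lia..|].
  have := sw_path S cN; rewrite pc => /(_ cX) [tc Pv].
  have pc0 : 0 < par c by lia.
  have := dn_edge T cN pc0; rewrite pc Pv => Gvc; right; split=> //.
  (* The step into [U] is the tree edge above [U], the one edge at [U] required to survive. *)
  have [cU|cU] := eqVneq c U; first by rewrite cU -pc cU G'_parU // -cU.
  by rewrite G_G' //; apply: contra ne => /eqP ->; rewrite tU Xr.
have [[cU Xc PU0]|[cU [side at_]]|[cU [pc [PcU hi]]]] := attach_cases tN v2.
- by left; rewrite eq Xc.
- rewrite -eq in at_; case: at_ => [[-> h rv]|[-> _ _]]; last by left.
  right; split=> //; rewrite G'_sym -row_G' //; apply/eqP => vp.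
  have := pt_par T U_range; have := pt_end T U_range; have := pt_anc T U_range (a := top v).
  have := pt_par T tN; have := @nested _ _ _ T (top v) (par U).
  case: side => [|[]] *; lia.
rewrite -eq in PcU hi.
have [y1 ty y0 yN] := highest_on_path tN v2 pc hi; have [h2 h3 h4 _] := hi.
right; split; first lia.
rewrite G_G' 1?G_sym //; try lia; apply/eqP => vU; rewrite vU in h2; lia.
Qed.

(** Each hook leads to 0, to [U], which sits directly below 0, or to a path whose top is a smaller
    label. *)
Theorem sweep_root v : v < N -> anc P 0 v.
Proof.
have [r [rN pr rU tr [Xr PU tU uniqr]]] := root_of_U.
have U0 : anc P 0 U by exists 1.
move: {2}(top v) (erefl (top v)) => c; elim/ltn_ind: c v => c IH v tv vN.
have [v1 v2 v3 v4] := top_spec vN.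
apply: anc_trans (top_anc vN).
have [c0|c0] := posnP (top v); first by rewrite c0 (sw_X0 S); exact: anc_refl.
have tN : 0 < top v < N by lia.
have [[cU Xc PU0]|[cU [side at_]]|[cU [pc [PcU hi]]]] := attach_cases tN v2.
- by rewrite Xc.
- by apply: anc_step; case: at_ => [[-> h rv]|[-> _ _]] //; exact: anc_refl.
have [y1 ty y0 yN] := highest_on_path tN v2 pc hi.
apply: anc_step; apply: (IH (top (par (top v)))) => //.
have pN := pt_par T tN; have [|t1 t2 t3 _] := @top_spec (par (top v)); lia.
Qed.

Lemma sweep_U : P U = 0.
Proof. by have [r [rN pr rU tr [Xr PU tU uniqr]]] := root_of_U. Qed.

End Correctness.

(** * Reading the graph *)

Notation "p ;; q" := (Sq p q) (at level 90, right associativity).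
Notation "x ::= e" := (Set_ x e) (at level 85, e at level 80).
Notation "a [+] b" := (Op OpAdd a b) (at level 50, left associativity).
Notation "a [-] b" := (Op OpSub a b) (at level 50, left associativity).
Notation "a [*] b" := (Op OpMul a b) (at level 40, left associativity).
Notation "a [/] b" := (Op OpDiv a b) (at level 40, left associativity).
Notation "a [%] b" := (Op OpMod a b) (at level 40, left associativity).
Notation "a [<] b" := (Op OpLt a b) (at level 70).
Notation "a [=] b" := (Op OpEq a b) (at level 70).

Notation rN := 0.
Notation rZ := 1.
Notation rn := 2.
Notation rm := 3.
Notation ri := 4.
Notation ra := 5.
Notation rb := 6.

Notation aL := 0.
Notation aD := 1.

(** [B k] bounds iteration [k]; an evaluation of the guard costs 4, once per iteration and once on
    exit. *)
Lemma wp_for w x b p (I : nat -> astate -> Prop) (B : nat -> nat) k0 n s :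
  b \notin x :: written p -> rg s x = k0 -> rg s b = n -> k0 <= n -> 1 < 2 ^ w -> I k0 s ->
  (forall k s', frame p s s' -> rg s' x = k -> rg s' b = n -> k0 <= k < n -> I k s' ->
     wp w p (fun t s'' => [/\ rg s'' x = k.+1, I k.+1 s'' & t <= B k]) s') ->
  wp w (Loop (R x [<] R b) p)
     (fun t s' => [/\ rg s' x = n, I n s' & t <= \sum_(k0 <= k < n) (B k + 4) + 4]) s.
Proof.
rewrite inE negb_or => /andP[_ bp] xk bn kn w1 Ik step.
pose J c s' := exists2 k, [/\ rg s' x = k, k0 <= k <= n & I k s'] &
  \sum_(k <= i < n) (B i + 4) <= c.
have J0 : J (\sum_(k0 <= k < n) (B k + 4)) s by exists k0; rewrite // leqnn kn.
apply: (wp_mono (wp_loop J0 _)) => [c s' F [k [xk' kn' Ik'] le]|t s' F [z [c [k [xk' kn' Ik'] le] tc]]].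
  have bn' : rg s' b = n by rewrite (fr_rg F).
  split; first by split=> //=; case: (rg s' x < rg s' b); lia.
  rewrite /= xk' bn' => lt; have {}lt : k < n by case: (k < n) lt.
  apply: (wp_mono (step k s' F xk' bn' _ Ik')); first lia.
  move=> t s'' _ [x'' I'' tB]; exists (\sum_(k.+1 <= i < n) (B i + 4)).
    by exists k.+1; rewrite // lt; split=> //; lia.
  by move: le; rewrite big_ltn //= /cost /=; lia.
have bn' : rg s' b = n by rewrite (fr_rg F).
move: z; rewrite /= xk' bn' => z; have {}z : n <= k by case: ltnP z.
have kE : k = n by lia.
by split; [lia|rewrite -kE|move: tc; rewrite /cost /=; lia].
Qed.

(** [N] counts the [n] vertices, the vertex [n] that may be inserted, and the dummy root [n + 1].
    Lists are stored at stride [Z], at most [N * N] of them in one array, and the factor 16 comes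
    from interleaving the arrays. *)
Record bounds (w n N Z : nat) : Prop := Bounds {
  b_N : N = n + 2;
  b_Z : Z = N * N * N;
  b_w : 16 * (N * N * Z) + 16 < 2 ^ w }.

Lemma bounds_le w n N Z : bounds w n N Z ->
  [/\ N <= N * N, N * N <= Z, Z <= N * Z & N * Z <= N * N * Z] /\
  [/\ 2 * N <= N * N, n.+1 < N, N <= n.+2, n * n <= N * N & 2 * (n * n) + 2 * N < Z].
Proof. by move=> [-> -> _]; do !split; nia. Qed.

Lemma index_lt v N i Z : v < N -> i < Z -> v * Z + i < N * Z.
Proof. nia. Qed.

Definition lists (L D : nat -> nat) (Z N : nat) (nbs : nat -> seq nat) : Prop :=
  forall v, v < N -> D v = size (nbs v) /\
    forall i, i < size (nbs v) -> L (v * Z + i) = nth 0 (nbs v) i.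

Definition push (nbs : nat -> seq nat) (a x : nat) : nat -> seq nat :=
  fun v => if v == a then rcons (nbs v) x else nbs v.

Lemma lists_push L D Z N nbs a x : lists L D Z N nbs -> a < N ->
  (forall v, v < N -> size (nbs v) < Z) ->
  lists (upd L (a * Z + D a) x) (upd D a (D a + 1)) Z N (push nbs a x).
Proof.
move=> H aN cap v vN; have [D1 L1] := H v vN; rewrite /push updE.
have [Da _] := H a aN; have capa := cap a aN; have capv := cap v vN.
have [->|ne] := eqVneq v a.
  rewrite size_rcons Da addn1; split=> // i; rewrite ltnS leq_eqVlt updE nth_rcons => /orP[/eqP->|lt].
    by rewrite eqxx ltnn eqxx.
  by rewrite lt ifF; [have [_ ->] := H a aN | lia].
split=> // i lt; rewrite updE ifF ?L1 //; apply: contraNF ne => /eqP.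
(* Cells in different blocks of length [Z] have different quotients by [Z]. *)
rewrite Da => eq; have := congr1 (divn^~ Z) eq; rewrite !divnMDl ?divn_small //; try lia.
Qed.

Definition incident (v : nat) (es : seq (nat * nat)) : seq nat :=
  flatten [seq (if e.1 == v then [:: e.2] else [::]) ++ (if e.2 == v then [:: e.1] else [::]) | e <- es].

Lemma incident_rcons v es e : incident v (rcons es e) =
  push (push (incident^~ es) e.1 e.2) e.2 e.1 v.
Proof.
rewrite /incident map_rcons flatten_rcons /push !(eq_sym v).
by case: (e.1 == v); case: (e.2 == v); rewrite -?cats1 ?catA ?cats0.
Qed.

Lemma mem_incident v u es : (u \in incident v es) = ((v, u) \in es) || ((u, v) \in es).
Proof.
elim: es => // -[a b] es IH; rewrite /incident /= !mem_cat -/(incident v es) IH !inE !xpair_eqE.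
rewrite [v == a]eq_sym [v == b]eq_sym.
by case: (a == v); case: (b == v); rewrite ?inE ?andbF ?andbT /=;
  case: (u == a); case: (u == b); case: ((v, u) \in es).
Qed.

Lemma sum_incident n es : all (fun e => (e.1 < n) && (e.2 < n)) es ->
  \sum_(v < n) size (incident v es) = 2 * size es.
Proof.
elim: es => [_|[a b] es IH /= /andP[/andP[an bn] /IH h]].
  by rewrite big1 // => i _; rewrite /incident.
rewrite mulnS -h /incident /=.
transitivity (\sum_(v < n) ((a == v) + (b == v) + size (incident v es))).
  by apply: eq_bigr => v _; rewrite !size_cat; case: (a == v); case: (b == v).
have one c : c < n -> \sum_(v < n) (c == v) = 1.
  move=> cn; rewrite (bigD1 (Ordinal cn)) //= eqxx big1 // => i.
  by rewrite -val_eqE /= eq_sym => /negPf ->.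
by rewrite !big_split /= !one.
Qed.

Lemma incident_size es v : size (incident v es) <= 2 * size es.
Proof.
elim: es => // -[a b] es IH; rewrite /incident /= !size_cat -/(incident v es).
by case: (a == v); case: (b == v) => /=; lia.
Qed.

Definition flat (es : seq (nat * nat)) := flatten [seq [:: e.1; e.2] | e <- es].

Definition read_edges :=
  In rn ;; In rm ;; rN ::= R rn [+] K 2 ;; rZ ::= R rN [*] R rN [*] R rN ;; ri ::= K 0 ;;
  Loop (R ri [<] R rm)
   (In ra ;; In rb ;;
    Put aL (R ra [*] R rZ [+] Get aD (R ra)) (R rb) ;; Put aD (R ra) (Get aD (R ra) [+] K 1) ;;
    Put aL (R rb [*] R rZ [+] Get aD (R rb)) (R ra) ;; Put aD (R rb) (Get aD (R rb) [+] K 1) ;;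
    ri ::= R ri [+] K 1).

Lemma read_edgesP w n N Z es s : bounds w n N Z -> all (fun e => (e.1 < n) && (e.2 < n)) es -> size es <= n * n ->
  ain s = n :: size es :: flat es -> (forall k i, mm s k i = 0) ->
  wp w read_edges (fun t s' =>
    [/\ rg s' rN = N, rg s' rZ = Z, rg s' rn = n & rg s' rm = size es] /\
    lists (mm s' aL) (mm s' aD) Z N (incident^~ es) /\ t <= 200 * (size es + 1)) s.
Proof.
move=> bd esn esz tape zero.
have [[h1 h2 h3 h4] [h5 h6 h7 nn nZ]] := bounds_le bd; have hw := b_w bd.
apply: wp_sq; apply: (wp_in tape); first lia.
apply: wp_sq; apply: wp_in; [by []|lia|].
apply: wp_sq; apply: wp_set; first by split=> //=; lia.
rewrite [ev _ _]/= -(b_N bd).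
apply: wp_sq; apply: wp_set; first by rewrite /= -(b_Z bd); do !split=> //=; lia.
rewrite [ev _ _]/= -(b_Z bd).
apply: wp_sq; apply: wp_set; first by rewrite /=; lia.
rewrite [ev _ _]/=.
set s0 := setr _ ri _.
pose I k s' := [/\ ain s' = flat (drop k es), k <= size es &
  lists (mm s' aL) (mm s' aD) Z N (incident^~ (take k es))].
apply: (wp_mono (wp_for (I := I) (B := fun=> 96) (k0 := 0) (n := size es) _ _ _ _ _ _ _)) => //.
- lia.
- split=> //=; first by rewrite drop0.
  by rewrite take0 => v _; rewrite !zero.
- move=> k s' F xk bk /andP[_ ks] [tape' _ L].
  have [eq0 eq1] : rg s' rZ = Z /\ rg s' rN = N by rewrite !(fr_rg F).
  have [[a b] ee] : exists e, nth (0, 0) es k = e by eexists.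
  have /andP[/= an bn] : (a < n) && (b < n).
    by have := allP esn (a, b); rewrite -ee mem_nth // => /(_ isT); rewrite ee.
  rewrite (drop_nth (0, 0)) // ee -[flat _]/[:: a, b & flat (drop k.+1 es)] in tape'.
  have cap v : size (incident v (take k es)) < Z - 1.
    by have := incident_size (take k es) v; rewrite size_take ks; lia.
  have cap1 v : v < N -> size (incident v (take k es)) < Z by move: (cap v); lia.
  have aN : a < N by lia. have bN : b < N by lia.
  have L1 := lists_push b L aN cap1.
  have cap2 v : v < N -> size (push (incident^~ (take k es)) a b v) < Z.
    by move=> _; rewrite /push; case: ifP => _; rewrite ?size_rcons; move: (cap v); lia.
  have L2 := lists_push a L1 bN cap2.
  have [Da _] := L a aN; have [Db _] := L1 b bN.
  have ia := index_lt aN (cap1 a aN); have ib := index_lt bN (cap2 b bN).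
  rewrite -Da in ia; rewrite -Db in ib.
  have da : mm s' aD a < Z by rewrite Da; apply: cap1.
  have db : upd (mm s' aD) a (mm s' aD a + 1) b < Z by rewrite Db; apply: cap2.
  apply: wp_sq; apply: (wp_in tape'); first lia.
  apply: wp_sq; apply: wp_in; [by []|lia|].
  apply: wp_sq; apply: wp_put.
  + rewrite /= eq0; do !split=> //=; lia.
  + by [].
  rewrite [ev _ _]/= [ev _ (R rb)]/=.
  apply: wp_sq; apply: wp_put; rewrite /=.
  + do !split=> //; lia.
  + do !split=> //; lia.
  apply: wp_sq; apply: wp_put; rewrite /=.
  + rewrite eq0; do !split=> //; lia.
  + by [].
  apply: wp_sq; apply: wp_put; rewrite /=.
  + do !split=> //; lia.
  + do !split=> //; lia.
  apply: wp_set; rewrite /=.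
  + by do !split=> //; lia.
  split=> //; first by rewrite xk addn1.
  split=> //=.
  by rewrite (take_nth (0, 0)) // ee eq0 => v vN; rewrite incident_rcons; apply: L2.
move=> t s' F [_ [_ _]]; rewrite take_size => L tB.
split; first by split; rewrite (fr_rg F).
by split=> //; move: tB; rewrite sum_nat_const_nat /cost /=; lia.
Qed.

(** * The initial depth-first search *)

Section DfsInvariant.
Variables (N : nat) (nbs : nat -> seq nat).
Hypothesis N1 : 1 < N.
Hypothesis nbs_lt : forall v (x : nat), v < N -> x \in nbs v -> x < N.-1.
Hypothesis nbs_root : nbs N.-1 = iota 0 N.-1.

(* Unfinished vertices have [e a = 0], and their subtree interval is still open on the right *)
Record dfs_inv (orig pre par e ptr : nat -> nat) (cur time run : nat) : Prop := DfsInv {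
  di_time : 0 < time <= N;
  di_root : orig 0 = N.-1;
  di_pre_root : pre N.-1 = 0;
  di_orig : forall a, 0 < a < time -> orig a < N.-1 /\ pre (orig a) = a;
  di_pre : forall v, v < N.-1 -> pre v < time /\ (0 < pre v -> orig (pre v) = v);
  di_par : forall a, 0 < a < time -> par a < a /\ orig a \in nbs (orig (par a));
  di_new : forall a, time <= a -> e a = 0;
  di_end : forall a, a < time -> e a != 0 ->
    a < e a <= time /\ forall x : nat, x \in nbs (orig a) -> 0 < pre x < e a;
  di_anc : forall a b, 0 < a < time -> b < a -> (e b == 0) || (a < e b) -> b <= par a;
  di_nest : forall a, 0 < a < time -> e a != 0 -> e (par a) != 0 -> e a <= e (par a);
  di_open : run != 0 -> [/\ cur < time, e cur = 0 &
    forall a, a < time -> e a = 0 -> a <= cur /\ (0 < a -> e (par a) = 0)];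
  di_done : run = 0 -> forall a, a < time -> e a != 0;
  di_ptr : forall v i, v < N -> i < ptr v -> 0 < pre (nth 0 (nbs v) i);
  di_ptr_le : forall v, v < N -> ptr v <= size (nbs v) }.

Lemma dfs_inv_init orig : 
  dfs_inv (upd orig 0 N.-1) (fun=> 0) (fun=> 0) (fun=> 0) (fun=> 0) 0 1 1.
Proof. by split=> //= *; lia. Qed.

Section Step.
Variables (orig pre par e ptr : nat -> nat) (cur time run : nat).
Hypothesis I : dfs_inv orig pre par e ptr cur time run.
Hypothesis run0 : run != 0.

Lemma orig_lt a : a < time -> orig a < N.
Proof.
case: a => [|a] h; first by rewrite (di_root I); lia.
by have [] := di_orig I (a := a.+1); lia.
Qed.

Lemma dfs_inv_skip : let v := orig cur in let x := nth 0 (nbs v) (ptr v) in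
  ptr v < size (nbs v) -> 0 < pre x ->
  dfs_inv orig pre par e (upd ptr v (ptr v + 1)) cur time run.
Proof.
move=> v x lt px; split; try by case: I.
- move=> u i uN; rewrite updE; have [->|_] := eqVneq u v; last exact: (di_ptr I uN).
  rewrite addn1 ltnS leq_eqVlt => /orP[/eqP ->//|]; apply: (di_ptr I).
  by have [h _ _] := di_open I run0; apply: orig_lt.
- move=> u uN; rewrite updE; have [->|_] := eqVneq u v; first by lia.
  exact: (di_ptr_le I uN).
Qed.

(** Pigeonhole: the positive labels given so far belong to [time - 1] distinct vertices other than
    the root, and [x] is one more. *)
Lemma time_lt x : x < N.-1 -> pre x = 0 -> time < N.
Proof.
move=> xN px; have [t0 tN] := andP (di_time I).
pose l := x :: map orig (iota 1 time.-1).
have : size l <= size (iota 0 N.-1); last by rewrite /= size_map !size_iota; lia.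
apply: uniq_leq_size.
  rewrite /= map_inj_in_uniq ?iota_uniq ?andbT.
    apply/negP => /mapP[a]; rewrite mem_iota => ha xa.
    by have [|_] := di_orig I (a := a); rewrite -?xa ?px; lia.
  move=> a b; rewrite !mem_iota => ha hb eq.
  have [|_ <-] := di_orig I (a := a); first lia.
  by have [|_ <-] := di_orig I (a := b); [lia|rewrite eq].
move=> y; rewrite inE mem_iota => /orP[/eqP->|/mapP[a]]; first by lia.
by rewrite mem_iota => ha ->; have [] := di_orig I (a := a); lia.
Qed.

Lemma dfs_inv_visit : let v := orig cur in let x := nth 0 (nbs v) (ptr v) in
  ptr v < size (nbs v) -> pre x = 0 ->
  dfs_inv (upd orig time x) (upd pre x time) (upd par time cur) e
    (upd ptr v (ptr v + 1)) time (time + 1) run.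
Proof.
move=> v x lt px; have [cl ec cmax] := di_open I run0.
have vN : v < N by apply: orig_lt.
have xv : x \in nbs v by rewrite mem_nth.
have xN : x < N.-1 by apply: nbs_lt xv.
have tN := time_lt xN px; have t0 := di_time I.
have oldpre y : 0 < pre y -> upd pre x time y = pre y.
  by rewrite updE; have [->|] := eqVneq y x; rewrite ?px.
have oldorig a : a < time -> upd orig time x a = orig a.
  by move=> at_; rewrite updE ifF //; lia.
have oldpar a : a < time -> upd par time cur a = par a.
  by move=> at_; rewrite updE ifF //; lia.
split.
- by lia.
- by rewrite oldorig ?(di_root I) //; lia.
- by rewrite updE ifF ?(di_pre_root I) //; lia.
- move=> a ha; have [ltat|le] := ltnP a time.
    by have [|h1 h2] := di_orig I (a := a); rewrite ?oldorig ?oldpre //; lia.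
  have -> : a = time by lia.
  by rewrite upd_same upd_same.
- move=> y yN; have [h1 h2] := di_pre I yN; have [->|ne] := eqVneq y x.
    by rewrite !upd_same; split; first lia.
  by rewrite (upd_other _ _ ne); split=> [|h3]; [lia|rewrite oldorig ?h2].
- move=> a ha; have [ltat|le] := ltnP a time.
    have [|h1 h2] := di_par I (a := a); first lia.
    by rewrite oldpar // !oldorig //; lia.
  have -> : a = time by lia.
  by rewrite !upd_same oldorig.
- by move=> a ha; apply: (di_new I); lia.
- move=> a ha ea; have [ltat|le] := ltnP a time; last by rewrite (di_new I) in ea.
  have [h1 h2] := di_end I ltat ea; split; first lia.
  by move=> y; rewrite oldorig // => /h2 h; rewrite oldpre; lia.
- move=> a b ha hb; have [ltat|le] := ltnP a time.
    by rewrite oldpar //; apply: (di_anc I _ hb); lia.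
  have -> : a = time by lia.
  (* A closed interval ends by [time], so only an open one can enclose the new label, and [cur] is
     the deepest open label. *)
  rewrite upd_same; have [eb _|eb] := eqVneq (e b) 0.
    by have [] := cmax b _ eb; lia.
  have bT : b < time by lia.
  by have [h _] := di_end I bT eb; lia.
- move=> a ha ea; have [ltat|le] := ltnP a time; last by rewrite (di_new I) in ea.
  by rewrite oldpar //; apply: (di_nest I _ ea); lia.
- move=> _; split; [lia|by rewrite (di_new I)|].
  move=> a ha ea; split; first lia; move=> a0.
  have [ltat|le] := ltnP a time; last first.
    by rewrite (_ : a = time) ?upd_same //; lia.
  by rewrite oldpar //; have [_] := cmax a ltat ea; apply.
- by move=> r0; case/eqP: run0.
- move=> u i uN; rewrite updE => h; have : i < ptr u \/ u = v /\ i = ptr v.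
    by move: h; have [->|_] := eqVneq u v; lia.
  by case=> [/(di_ptr I uN)/[dup]|[-> ->]]; [move=> /oldpre ->|rewrite upd_same; lia].
- move=> u uN; rewrite updE; have [->|_] := eqVneq u v; first by lia.
  exact: (di_ptr_le I uN).
Qed.

(** Once the list of [cur] has been scanned, all its neighbours carry labels below [time]. Closing
    its interval at [time] therefore encloses every edge to a larger label, which is the DFS
    property. *)
Lemma dfs_inv_finish : let v := orig cur in
  size (nbs v) <= ptr v ->
  dfs_inv orig pre par (upd e cur time) ptr
    (if cur == 0 then cur else par cur) time (if cur == 0 then 0 else run).
Proof.
move=> v lt; have [cl ec cmax] := di_open I run0; have t0 := di_time I.
have vN : v < N by apply: orig_lt.
have efin a : e a != 0 -> upd e cur time a = e a.
  by rewrite updE; have [->|] := eqVneq a cur; rewrite ?ec.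
have e0 a : upd e cur time a == 0 = (a != cur) && (e a == 0).
  by rewrite updE; case: ifP => _ //; lia.
split; try by case: I.
- by move=> a ha; rewrite updE ifF ?(di_new I) //; lia.
- move=> a ha; rewrite updE; have [->|ne] := eqVneq a cur; last exact: (di_end I ha).
  move=> _; split; first lia; move=> x xv.
  have xN := nbs_lt vN xv; have [] := di_pre I xN.
  have := di_ptr I (i := index x (nbs v)) vN; rewrite nth_index // -/v => h.
  have : index x (nbs v) < size (nbs v) by rewrite index_mem.
  by lia.
- move=> a b ha hb h; apply: (di_anc I ha hb).
  by move: h; rewrite e0 updE; have [->|] := eqVneq b cur; rewrite ?ec.
- move=> a ha; rewrite e0 negb_and negbK => h1 h2; rewrite !updE.
  have [ac|ac] := eqVneq a cur.
    have [h5 _] := di_par I ha; have [h3 h4] := cmax cur cl ec; rewrite ac in ha h2 h5.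
    by move: h2; rewrite e0 h4; lia.
  have ea : e a != 0 by move: h1; rewrite (negPf ac).
  have aT : a < time by lia.
  have [h3 _] := di_end I aT ea.
  have [|pc] := eqVneq (par a) cur; first by lia.
  apply: (di_nest I ha ea); by move: h2; rewrite e0 pc.
- case: ifP => // c0 _; have cpos : 0 < cur by lia.
  have [h1 h2] := di_par I (a := cur) (introT andP (conj cpos cl)).
  have [h3 h4] := cmax cur cl ec; split; first lia.
    by rewrite updE ifF ?h4 //; lia.
  (* The other open labels are proper ancestors of [cur], so its parent is now the deepest open
     label. *)
  move=> a ha /eqP; rewrite e0 => /andP[ne /eqP ea]; have [h5 h6] := cmax a ha ea.
  split; first by apply: (di_anc I); rewrite ?ea; lia.
  move=> a0; apply/eqP; rewrite e0 h6 // eqxx andbT.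
  by apply: contraTneq h1 => pc; have [] := di_par I (a := a); lia.
- case: ifP => [/eqP c0 _|c0 r0]; last by case/eqP: run0.
  move=> a ha; rewrite e0 negb_and negbK; have [//|ne] := eqVneq a cur.
  by apply/negP => /eqP ea; have [] := cmax a ha ea; lia.
Qed.

End Step.

Definition label_adj (orig : nat -> nat) : rel nat :=
  fun y x => [&& 0 < y, y < N, 0 < x, x < N & orig x \in nbs (orig y)].

Definition numbering (orig pre par e : nat -> nat) : Prop :=
  [/\ dfs_numbering N (label_adj orig) par e,
      orig 0 = N.-1, pre N.-1 = 0,
      forall a, 0 < a < N -> orig a < N.-1 /\ pre (orig a) = a
    & forall v, v < N.-1 -> 0 < pre v < N /\ orig (pre v) = v].

(** The list of the root contains every other vertex, so when the root is finished all of them have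
    labels; injectivity of the labels then forces [time = N]. *)
Lemma dfs_inv_numbering orig pre par e ptr cur time :
  dfs_inv orig pre par e ptr cur time 0 -> numbering orig pre par e.
Proof.
move=> I; have fin := di_done I (erefl 0); have t0 := di_time I.
have dend a (h : a < time) := di_end I h (fin a h).
have [_ vis] := dend 0 ltac:(lia).
rewrite (di_root I) nbs_root in vis.
have pre0 v : v < N.-1 -> 0 < pre v < e 0 by move=> h; apply: vis; rewrite mem_iota.
have timeN : time = N.
  have : size (map pre (iota 0 N.-1)) <= size (iota 1 time.-1); last first.
    by rewrite size_map !size_iota; lia.
  apply: uniq_leq_size.
    rewrite map_inj_in_uniq ?iota_uniq // => a b; rewrite !mem_iota => ha hb eq.
    have [|_ <-] := di_pre I (v := a); [lia| |by have := pre0 a; lia].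
    by have [|_ <-] := di_pre I (v := b); [lia|rewrite eq|have := pre0 b; lia].
  move=> y /mapP[v]; rewrite mem_iota => hv ->; rewrite mem_iota.
  by have [|h1 _] := di_pre I (v := v); [lia|have := pre0 v; lia].
subst time; split.
- split.
  + split.
    * have [h _] := dend 0 ltac:(lia).
      have [|h1 h2] := di_orig I (a := N.-1); first lia.
      have := pre0 (orig N.-1) h1; lia.
    * by move=> x xN; have [] := di_par I xN.
    * move=> x xN; have [h _] := di_par I xN.
      have [h1 _] := dend x ltac:(lia).
      have := di_nest I xN (fin x ltac:(lia)) (fin (par x) ltac:(lia)); lia.
    * by move=> x a xN ax; apply: (di_anc I); lia.
  + move=> x xN px; have [h1 h2] := di_par I xN.
    by rewrite /label_adj px h2; lia.
  + move=> y x y0 yx /and5P[_ yN _ xN h].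
    have [_ /(_ _ h)] := dend y yN.
    by have [|_ ->] := di_orig I (a := x); lia.
- exact: (di_root I).
- exact: (di_pre_root I).
- exact: (di_orig I).
- move=> v vN; have [h1 h2] := di_pre I vN; have := pre0 v vN; move=> h3.
  by rewrite h2; lia.
Qed.

End DfsInvariant.

Notation rcur := 7.
Notation rtime := 8.
Notation rv := 9.
Notation rrun := 10.
Notation rx := 11.
Notation ry := 12.
Notation rj := 13.
Notation rq := 14.
Notation rnode := 15.

(* Indexed by vertices: [aL] and [aD] hold the adjacency lists and their
   lengths, the list of [v] starting at [v * Z], and [aPre] the labels.
   Indexed by labels: [aOrig] is the inverse of [aPre], [aPar] the parent,
   [aE] the end of the subtree interval; [aM] is the adjacency matrix.
   [aS] and [aC] hold the lists of the segment tree nodes and their lengths,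
   an edge [(x, y)] with [y < x] being packed as [y * N + x]. *)
Notation aPre := 2.
Notation aOrig := 3.
Notation aPar := 4.
Notation aE := 5.
Notation aPtr := 6.
Notation aM := 7.
Notation aC := 8.
Notation aS := 9.

(** The root is entered in no list of another vertex. Its label 0 also marks unvisited vertices, but
    the search never tests the root. *)
Definition link_root :=
  ri ::= K 0 ;; ra ::= R rN [-] K 1 ;;
  Loop (R ri [<] R ra)
    (Put aL (R ra [*] R rZ [+] Get aD (R ra)) (R ri) ;; Put aD (R ra) (Get aD (R ra) [+] K 1) ;;
     ri ::= R ri [+] K 1).

Definition with_root (N : nat) (nbs : nat -> seq nat) (k : nat) : nat -> seq nat :=
  fun v => if v == N.-1 then iota 0 k else nbs v.

Lemma eq_lists L D Z N nbs nbs' : nbs =1 nbs' -> lists L D Z N nbs -> lists L D Z N nbs'.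
Proof. by move=> eq H v /H; rewrite eq. Qed.

Lemma link_rootP w n N Z nbs s : bounds w n N Z ->
  rg s rN = N -> rg s rZ = Z -> lists (mm s aL) (mm s aD) Z N nbs ->
  nbs N.-1 = [::] -> (forall v, v < N -> size (nbs v) < Z) ->
  wp w link_root (fun t s' =>
    lists (mm s' aL) (mm s' aD) Z N (with_root N nbs N.-1) /\ t <= 100 * N) s.
Proof.
move=> bd eN eZ L nil cap.
have [[h1 h2 h3 h4] [h5 h6 h7 nn nZ]] := bounds_le bd; have hw := b_w bd.
apply: wp_sq; apply: wp_set; first by rewrite /=; lia.
apply: wp_sq; apply: wp_set; first by rewrite /= eN; do !split; lia.
rewrite /= eN; set s0 := setr _ ra _.
pose I k s' := lists (mm s' aL) (mm s' aD) Z N (with_root N nbs k).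
apply: (wp_mono (wp_for (I := I) (B := fun=> 80) (k0 := 0) (n := N.-1) _ _ _ _ _ _ _)) => //.
- by rewrite /= subn1.
- lia.
- by apply: eq_lists L => v; rewrite /with_root; case: eqP => // ->.
- move=> k s' F xk bk /andP[_ kN] Lk.
  have eZ' : rg s' rZ = Z by rewrite (fr_rg F).
  have aN : N.-1 < N by lia.
  have capk v : v < N -> size (with_root N nbs k v) < Z.
    by rewrite /with_root => /cap; case: ifP => // _; rewrite size_iota; lia.
  have L1 := lists_push k Lk aN capk.
  have [Da _] := Lk _ aN; move: (Da); rewrite /with_root eqxx size_iota => Dk.
  have ia := index_lt aN (capk _ aN); rewrite -Da in ia.
  apply: wp_sq; apply: wp_put; rewrite /= ?bk ?eZ'; [do !split=> //; lia|by []|].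
  apply: wp_sq; apply: wp_put; rewrite /= ?bk; [do !split=> //; lia|do !split=> //; lia|].
  apply: wp_set; rewrite /= ?xk; first by do !split=> //; lia.
  split=> //; first by rewrite addn1.
  rewrite /I /=; apply: eq_lists L1 => v; rewrite /push /with_root.
  by case: eqP => // _; rewrite -cats1 -addn1 iotaD.
move=> t s' F [_ L' tB]; split=> //; move: tB.
by rewrite sum_nat_const_nat /cost /=; lia.
Qed.

Definition dfs_step :=
  rv ::= Get aOrig (R rcur) ;; ri ::= Get aPtr (R rv) ;;
  Cond (R ri [<] Get aD (R rv))
   (rx ::= Get aL (R rv [*] R rZ [+] R ri) ;; Put aPtr (R rv) (R ri [+] K 1) ;;
    Cond (Get aPre (R rx)) Nop
      (Put aPre (R rx) (R rtime) ;; Put aOrig (R rtime) (R rx) ;; Put aPar (R rtime) (R rcur) ;;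
       rcur ::= R rtime ;; rtime ::= R rtime [+] K 1))
   (Put aE (R rcur) (R rtime) ;;
    Cond (R rcur) (rcur ::= Get aPar (R rcur)) (rrun ::= K 0)).

Definition dfs :=
  Put aOrig (K 0) (R rN [-] K 1) ;; rcur ::= K 0 ;; rtime ::= K 1 ;; rrun ::= K 1 ;;
  Loop (R rrun) dfs_step.

Lemma sum_decr N (f g : nat -> nat) j : (forall v, v < N -> f v <= g v) ->
  j < N -> f j < g j -> \sum_(v < N) f v < \sum_(v < N) g v.
Proof.
move=> le jN lt; rewrite (bigD1 (Ordinal jN)) //= [X in _ < X](bigD1 (Ordinal jN)) //=.
by rewrite -addSn leq_add //; apply: leq_sum => i _; apply: le.
Qed.

Definition dfs_inv_at N nbs s :=
  dfs_inv N nbs (mm s aOrig) (mm s aPre) (mm s aPar) (mm s aE) (mm s aPtr)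
    (rg s rcur) (rg s rtime) (rg s rrun).

Lemma dfsP w n N Z nbs s m : bounds w n N Z ->
  rg s rN = N -> rg s rZ = Z -> lists (mm s aL) (mm s aD) Z N nbs ->
  nbs N.-1 = iota 0 N.-1 -> (forall v, v < N -> size (nbs v) < Z) ->
  (forall v (x : nat), v < N -> x \in nbs v -> x < N.-1) ->
  \sum_(v < N) size (nbs v) <= m ->
  (forall k, 1 < k -> mm s k = fun=> 0) ->
  wp w dfs (fun t s' =>
    numbering N nbs (mm s' aOrig) (mm s' aPre) (mm s' aPar) (mm s' aE) /\
    t <= 200 * (m + N)) s.
Proof.
move=> bd eN eZ L root cap nbs_lt summ zero.
have [[h1 h2 h3 h4] [h5 h6 h7 nn nZ]] := bounds_le bd; have hw := b_w bd.
have N1 : 1 < N by lia.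
apply: wp_sq; apply: wp_put; rewrite /= ?eN; [do !split=> //; lia|do !split=> //; lia|].
apply: wp_sq; apply: wp_set; first by rewrite /=; lia.
apply: wp_sq; apply: wp_set; first by rewrite /=; lia.
apply: wp_sq; apply: wp_set; first by rewrite /=; lia.
set s0 := setr _ rrun _.
(* Potential: list entries not yet scanned plus vertices not yet finished. Every step scans an entry
   or finishes a vertex. *)
pose phi s' := \sum_(v < N) (size (nbs v) - mm s' aPtr v + (mm s' aE v == 0)).
pose I b s' := dfs_inv_at N nbs s' /\ 150 * phi s' <= b.
have I0 : I (150 * (m + N)) s0.
  split; first by rewrite /dfs_inv_at /= !zero // subn1; apply: dfs_inv_init.
  rewrite /phi /= !zero // leq_mul2l /=.
  under eq_bigr => v _ do rewrite subn0.
  by rewrite big_split /= sum_nat_const card_ord muln1 leq_add2r.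
apply: (wp_mono (wp_loop I0 _)) => [b s' F [Iv le]|t s' F [r0 [b [Iv _] le]]]; last first.
  split; last by move: le; rewrite /cost /=; lia.
  rewrite /= in r0; move: Iv; rewrite /dfs_inv_at r0 => Iv.
  exact: (dfs_inv_numbering N1 root Iv).
split=> //= run0; have [cl ec cmax] := di_open Iv run0.
have tN := di_time Iv; have t0 : (rg s' rtime == 0) = false by lia.
have vN := orig_lt N1 Iv run0 cl.
have eZ' : rg s' rZ = Z by rewrite (fr_rg F).
have Ls' : lists (mm s' aL) (mm s' aD) Z N nbs by rewrite !(fr_mm F).
have ptrv := di_ptr_le Iv vN; have capv := cap _ vN.
have [Dv Lv] := Ls' _ vN.
have iv := index_lt vN capv.
have le' X : X < phi s' -> 150 * X <= b - 150 by lia.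
have phi_ptr i : i = mm s' aPtr (mm s' aOrig (rg s' rcur)) ->
   i < size (nbs (mm s' aOrig (rg s' rcur))) ->
   \sum_(v < N) (size (nbs v) - upd (mm s' aPtr) (mm s' aOrig (rg s' rcur)) (i + 1) v + (mm s' aE v == 0)) < phi s'.
  move=> iE lt; apply: (@sum_decr N (fun v => size (nbs v) - upd (mm s' aPtr) (mm s' aOrig (rg s' rcur)) (i + 1) v + (mm s' aE v == 0))
    (fun v => size (nbs v) - mm s' aPtr v + (mm s' aE v == 0)) (mm s' aOrig (rg s' rcur))) => //.
    by move=> v _; rewrite updE; case: eqP => // ->; lia.
  by rewrite upd_same; lia.
apply: wp_sq; apply: wp_set; first by rewrite /=; do !split=> //; lia.
apply: wp_sq; apply: wp_set; first by rewrite /=; do !split=> //; lia.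
apply: wp_cond.
- by rewrite /=; do !split=> //; lia.
- rewrite /= => lt.
  have {}lt : mm s' aPtr (mm s' aOrig (rg s' rcur)) < size (nbs (mm s' aOrig (rg s' rcur))).
    by rewrite -Dv; case: ltnP lt.
  have xN : nth 0 (nbs (mm s' aOrig (rg s' rcur))) (mm s' aPtr (mm s' aOrig (rg s' rcur))) < N.-1.
    by apply: nbs_lt vN _; rewrite mem_nth.
  apply: wp_sq; apply: wp_set; first by rewrite /= eZ'; do !split=> //; lia.
  apply: wp_sq; apply: wp_put; rewrite /= ?eZ' ?Lv //; [do !split=> //; lia|do !split=> //; lia|].
  apply: wp_cond; rewrite /= ?Lv //.
  + by do !split=> //; lia.
  + move=> px; apply: wp_nop; have dec := phi_ptr _ (erefl _) lt.
    exists (b - 150); last by rewrite /cost /=; lia.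
    split; last exact: le' dec.
    by apply: (dfs_inv_skip N1 Iv run0 lt); lia.
  + move=> px; have dec := phi_ptr _ (erefl _) lt.
    have tlt := time_lt N1 Iv run0 xN px.
    apply: wp_sq; apply: wp_put; rewrite /=; [do !split=> //; lia|by []|].
    apply: wp_sq; apply: wp_put; rewrite /=; [do !split=> //; lia|by []|].
    apply: wp_sq; apply: wp_put; rewrite /=; [do !split=> //; lia|by []|].
    apply: wp_sq; apply: wp_set; first by [].
    apply: wp_set; rewrite /=; first by do !split=> //; lia.
    exists (b - 150); last by rewrite /cost /=; lia.
    split; last exact: le' dec.
    exact: (dfs_inv_visit N1 nbs_lt Iv run0 lt px).
- rewrite /= => ge.
  have {}ge : size (nbs (mm s' aOrig (rg s' rcur))) <= mm s' aPtr (mm s' aOrig (rg s' rcur)).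
    by rewrite -Dv; case: ltnP ge.
  have dec : \sum_(v < N) (size (nbs v) - mm s' aPtr v +
      (upd (mm s' aE) (rg s' rcur) (rg s' rtime) v == 0)) < phi s'.
    apply: (@sum_decr N (fun v => size (nbs v) - mm s' aPtr v + (upd (mm s' aE) (rg s' rcur) (rg s' rtime) v == 0))
      (fun v => size (nbs v) - mm s' aPtr v + (mm s' aE v == 0)) (rg s' rcur)).
    + by move=> v _; rewrite updE; case: (v == _); rewrite ?t0 ?leq_add2l.
    + lia.
    + by rewrite upd_same ec t0 eqxx; lia.
  have fin := dfs_inv_finish N1 nbs_lt Iv run0 ge.
  apply: wp_sq; apply: wp_put; rewrite /=; [do !split=> //; lia|by []|].
  apply: wp_cond; rewrite //=.
  + move=> c0; rewrite (negPf c0) in fin.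
    apply: wp_set; rewrite /=; first by do !split=> //; lia.
    exists (b - 150); last by rewrite /cost /=; lia.
    by split; [exact: fin|exact: le' dec].
  + move=> c0; rewrite c0 /= in fin.
    apply: wp_set; rewrite /=; first by lia.
    exists (b - 150); last by rewrite /cost /=; lia.
    split; last exact: le' dec.
    by rewrite /dfs_inv_at /= c0; exact: fin.
Qed.

(** * The edge index *)

Lemma index_inj N a b a' b' : b < N -> b' < N -> a * N + b = a' * N + b' -> a = a' /\ b = b'.
Proof.
move=> bN bN' eq; have N0 : 0 < N by lia.
have := congr1 (divn^~ N) eq; have := congr1 (modn^~ N) eq.
by rewrite /= !modnMDl !divnMDl // !modn_small // !divn_small // !addn0.
Qed.

Lemma divn_index N a b : b < N -> (a * N + b) %/ N = a.
Proof. by move=> bN; rewrite divnMDl ?divn_small ?addn0 //; lia. Qed.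

Lemma modn_index N a b : b < N -> (a * N + b) %% N = b.
Proof. by move=> bN; rewrite modnMDl modn_small. Qed.

(* Node [p = j * N + q] of the segment tree stands for the dyadic interval of
   the labels [x] with [x %/ 2 ^ j = q] *)
Definition in_node (N p x : nat) : bool := (0 < p %% N) && (x %/ 2 ^ (p %/ N) == p %% N).

Definition node_list (N : nat) (ps : seq (nat * nat)) (p : nat) : seq nat :=
  [seq e.1 * N + e.2 | e <- ps & in_node N p e.2].

Definition down (y : nat) (l : seq nat) : seq (nat * nat) := [seq (y, x) | x <- l & y < x].

(** The upper endpoints occur in increasing order, so every node list, taken from this list in
    order, comes out sorted with no sorting step. The edges of the dummy root, label 0, are
    omitted. *)
Definition pairs (pre orig : nat -> nat) (nbs : nat -> seq nat) (y : nat) : seq (nat * nat) :=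
  flatten [seq down a (map pre (nbs (orig a))) | a <- iota 1 y.-1].

Definition adj_table (N : nat) (M : nat -> nat) (ps : seq (nat * nat)) : Prop :=
  forall a b, a < N -> b < N ->
    (M (a * N + b) != 0) = ((a, b) \in ps) || ((b, a) \in ps).

Lemma node_list_size N ps p : size (node_list N ps p) <= size ps.
Proof. by rewrite /node_list size_map size_filter count_size. Qed.

Lemma node_list_rcons N ps y x p : node_list N (rcons ps (y, x)) p =
  if in_node N p x then rcons (node_list N ps p) (y * N + x) else node_list N ps p.
Proof. by rewrite /node_list filter_rcons /=; case: ifP => // _; rewrite map_rcons. Qed.

Lemma down_rcons y l x : down y (rcons l x) = if y < x then rcons (down y l) (y, x) else down y l.
Proof. by rewrite /down filter_rcons; case: ifP => // _; rewrite map_rcons. Qed.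

Lemma pairsS pre orig nbs y : 0 < y ->
  pairs pre orig nbs y.+1 = pairs pre orig nbs y ++ down y (map pre (nbs (orig y))).
Proof.
case: y => // y _; rewrite /pairs (_ : y.+2.-1 = y + 1); last by rewrite addn1.
by rewrite iotaD map_cat flatten_cat /= cats0 add1n.
Qed.

Lemma adj_table_rcons N M ps y x : adj_table N M ps -> y < N -> x < N ->
  adj_table N (upd (upd M (y * N + x) 1) (x * N + y) 1) (rcons ps (y, x)).
Proof.
move=> H yN xN a b aN bN; rewrite !mem_rcons !inE !xpair_eqE !updE.
have key u v u' v' : v < N -> v' < N -> (u * N + v == u' * N + v') = (u == u') && (v == v').
  move=> h h'; apply/eqP/andP => [/(index_inj h h') [-> ->] //|[/eqP-> /eqP->] //].
rewrite !key // [(b == y) && _]andbC.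
case: ((a == x) && (b == y)); first by rewrite /= orbT.
by case: ((a == y) && (b == x)) => //=; apply: H.
Qed.

Lemma node_list_sorted N ps p : (forall e, e \in ps -> e.2 < N) ->
  sorted (fun e f : nat * nat => e.1 <= f.1) ps ->
  sorted (fun u v => u %/ N <= v %/ N) (node_list N ps p).
Proof.
move=> H st; rewrite /node_list sorted_map; set l := filter _ _.
have st' : sorted (fun e f : nat * nat => e.1 <= f.1) l.
  by apply: sorted_filter st => x y z; apply: leq_trans.
have H' e : e \in l -> e.2 < N by rewrite mem_filter => /andP[_ /H].
rewrite (eq_in_sorted (P := fun e => e.2 < N) (e' := fun e f : nat * nat => e.1 <= f.1)) //.
  by move=> e f eN fN /=; rewrite !divn_index.
by apply/allP.
Qed.

Lemma pairs_props pre orig (nbs : nat -> seq nat) y :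
  sorted (fun e f : nat * nat => e.1 <= f.1) (pairs pre orig nbs y) /\
  forall e, (e \in pairs pre orig nbs y) = [&& 0 < e.1, e.1 < y, e.1 < e.2 &
    e.2 \in map pre (nbs (orig e.1))].
Proof.
have mem z e : (e \in pairs pre orig nbs z) = [&& 0 < e.1, e.1 < z, e.1 < e.2 &
    e.2 \in map pre (nbs (orig e.1))].
  apply/flatten_mapP/idP => [[a]|/and4P[h1 h2 h3 h4]].
    rewrite mem_iota => ha /mapP[x]; rewrite mem_filter => /andP[ax xl] -> /=.
    by rewrite ax xl; lia.
  exists e.1; first by rewrite mem_iota; lia.
  by apply/mapP; exists e.2; rewrite ?mem_filter ?h3 //; case: e {h1 h2 h3 h4}.
split=> //; elim: y => [//|[//|y] IH]; rewrite pairsS //.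
rewrite sorted_pairwise => [|u v x]; last exact: leq_trans.
rewrite sorted_pairwise in IH => [|u v x]; last exact: leq_trans.
rewrite pairwise_cat IH /=; apply/andP; split.
  apply/allrelP => e f; rewrite mem => /and4P[_ ey _ _] /mapP[x _ ->] /=; exact: ltnW.
rewrite /down; elim: (filter _ _) => //= x l ->; rewrite andbT.
by apply/allP => f /mapP[z _ ->] /=.
Qed.

Definition index_push :=
  Loop (R rq)
    (rnode ::= R rj [*] R rN [+] R rq ;;
     Put aS (R rnode [*] R rZ [+] Get aC (R rnode)) (R ry [*] R rN [+] R rx) ;;
     Put aC (R rnode) (Get aC (R rnode) [+] K 1) ;;
     rq ::= R rq [/] K 2 ;; rj ::= R rj [+] K 1).

Definition index_vertex :=
  Loop (R ri [<] R rb)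
    (rx ::= Get aPre (Get aL (R rv [*] R rZ [+] R ri)) ;;
     Cond (R ry [<] R rx)
       (Put aM (R ry [*] R rN [+] R rx) (K 1) ;; Put aM (R rx [*] R rN [+] R ry) (K 1) ;;
        rq ::= R rx ;; rj ::= K 0 ;; index_push)
       Nop ;;
     ri ::= R ri [+] K 1).

Definition index_edges :=
  ry ::= K 1 ;;
  Loop (R ry [<] R rN)
    (rv ::= Get aOrig (R ry) ;; rb ::= Get aD (R rv) ;; ri ::= K 0 ;;
     index_vertex ;; ry ::= R ry [+] K 1).

Lemma index_pushP w n N Z lg ps y x s : bounds w n N Z -> N <= 2 ^ lg ->
  rg s rN = N -> rg s rZ = Z -> rg s ry = y -> rg s rx = x -> rg s rq = x -> rg s rj = 0 ->
  0 < x < N -> y < N -> (size ps).+1 < Z ->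
  lists (mm s aS) (mm s aC) Z (N * N) (node_list N ps) ->
  wp w index_push (fun t s' =>
    lists (mm s' aS) (mm s' aC) Z (N * N) (node_list N (rcons ps (y, x))) /\
    t <= 80 * lg + 2) s.
Proof.
move=> bd Nlg eN eZ ey ex eq ej x0 yN psZ L.
have [[h1 h2 h3 h4] [h5 h6 h7 nn nZ]] := bounds_le bd; have hw := b_w bd.
(* Halfway through, only the nodes at levels below [j] have received the edge. *)
pose nbs j p := if in_node N p x && (p %/ N < j) then rcons (node_list N ps p) (y * N + x)
                else node_list N ps p.
pose I b s' := exists2 j, [/\ rg s' rj = j, rg s' rq = x %/ 2 ^ j & j <= lg] &
  lists (mm s' aS) (mm s' aC) Z (N * N) (nbs j) /\ 80 * (lg - j) <= b.
have I0 : I (80 * lg) s.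
  exists 0; first by rewrite expn0 divn1.
  by split; [apply: eq_lists L => p; rewrite /nbs ltn0 andbF | lia].
have xlg : x < 2 ^ lg by lia.
apply: (wp_mono (wp_loop I0 _)) => [b s' F [j [jE qE jlg] [Lj le]]|t s' F [q0 [b [j [jE qE jlg] [Lj _]] le]]]; last first.
  split; last by move: le; rewrite /cost /=; lia.
  apply: eq_lists Lj => p; rewrite /nbs node_list_rcons; case: (boolP (in_node N p x)) => //= /andP[p0 /eqP pE].
  rewrite ifT // ltnNge; apply: contraL p0 => jp; rewrite -pE lt0n negbK divn_small //.
  apply: (@leq_trans (2 ^ j)); last by rewrite leq_exp2l.
  by rewrite -[2 ^ j]mul1n -ltn_divLR ?expn_gt0 // -qE; move: q0 => /= ->.
split=> //= q0; rewrite qE in q0.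
have jx : 2 ^ j <= x by case: leqP q0 => // /divn_small ->.
have jlg' : j < lg by rewrite -(@ltn_exp2l 2) //; lia.
have jN : j < N by have := ltn_expl j (isT : 1 < 2); lia.
have qN : x %/ 2 ^ j < N by have := leq_div x (2 ^ j); lia.
have [eN' eZ'] : rg s' rN = N /\ rg s' rZ = Z by rewrite !(fr_rg F).
have [ey' ex'] : rg s' ry = y /\ rg s' rx = x by rewrite !(fr_rg F).
have pNN := index_lt jN qN; set p := j * N + x %/ 2 ^ j in pNN.
have cap q : q < N * N -> size (nbs j q) < Z.
  move=> _; rewrite /nbs; have := node_list_size N ps q.
  by case: ifP => _; rewrite ?size_rcons; lia.
have yx := index_lt yN (proj2 (andP x0)).
have L1 := lists_push (y * N + x) Lj pNN cap.
have [Cp _] := Lj _ pNN; have capp := cap _ pNN; rewrite -Cp in capp.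
have ip := index_lt pNN capp.
apply: wp_sq; apply: wp_set; rewrite /= jE qE eN' -/p; first by do !split=> //; lia.
apply: wp_sq; apply: wp_put; rewrite /= ?eN' ?eZ' ?ey' ?ex'; [do !split=> //; lia|do !split=> //; lia|].
apply: wp_sq; apply: wp_put; rewrite /=; [do !split=> //; lia|do !split=> //; lia|].
apply: wp_sq; apply: wp_set; first by rewrite /= qE; do !split=> //; lia.
apply: wp_set; rewrite /= jE; first by do !split=> //; lia.
exists (b - 80); last by rewrite /cost /=; lia.
exists j.+1; first by rewrite /= qE addn1 expnSr divnMA.
split; last by lia.
apply: eq_lists L1 => q; rewrite /push /nbs.
have [->|ne] := eqVneq q p; rewrite /in_node.
  by rewrite divn_index // modn_index // eqxx andbT ltnn andbF ltnS leqnn andbT lt0n q0.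
have -> : (q %/ N < j.+1) = (q %/ N == j) || (q %/ N < j) by rewrite ltnS leq_eqVlt.
case: (q %/ N =P j) => //= qj.
rewrite qj ltnn andbF andbT; case: ifP => // /andP[q1 /eqP q2]; case/eqP: ne.
by rewrite /p q2 -qj -divn_eq.
Qed.

Lemma index_edgesP w n N Z lg nbs s m : bounds w n N Z -> N <= 2 ^ lg ->
  rg s rN = N -> rg s rZ = Z -> lists (mm s aL) (mm s aD) Z N nbs ->
  let pre := mm s aPre in let orig := mm s aOrig in
  (forall v, v < N -> size (nbs v) < Z) ->
  (forall v x : nat, v < N -> x \in nbs v -> x < N /\ pre x < N) ->
  (forall a, a < N -> orig a < N) ->
  \sum_(0 <= y < N) size (nbs (orig y)) <= m -> m.+1 < Z ->
  (forall k, k \in [:: aM; aC; aS] -> mm s k = fun=> 0) ->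
  wp w index_edges (fun t s' => let ps := pairs pre orig nbs N in
    lists (mm s' aS) (mm s' aC) Z (N * N) (node_list N ps) /\
    adj_table N (mm s' aM) ps /\ t <= 200 * ((lg + 1) * (m + N))) s.
Proof.
move=> bd Nlg eN eZ L pre orig cap nbs_lt orig_lt summ mZ zero.
have [[h1 h2 h3 h4] [h5 h6 h7 nn nZ]] := bounds_le bd; have hw := b_w bd.
apply: wp_sq; apply: wp_set; rewrite /=; first by lia.
set s0 := setr _ ry _.
pose J ps s' := lists (mm s' aS) (mm s' aC) Z (N * N) (node_list N ps) /\ adj_table N (mm s' aM) ps.
pose I y s' := J (pairs pre orig nbs y) s'.
have sizes y : y <= N -> size (pairs pre orig nbs y) <= \sum_(0 <= a < y) size (nbs (orig a)).
  elim: y => [|[|y] IH] yN //; rewrite pairsS // size_cat big_nat_recr //= leq_add ?IH //.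
  - by lia.
  - by rewrite size_map size_filter -(size_map pre) count_size.
have total y : y <= N -> \sum_(0 <= a < y) size (nbs (orig a)) <= m.
  by move=> yN; apply: leq_trans summ; rewrite [leqRHS](@big_cat_nat _ _ _ y) //= leq_addr.
(* The budget of a label is proportional to its degree, so that the total is governed by the sum of
   the degrees. *)
pose B y := size (nbs (orig y)) * (80 * lg + 90) + 40.
apply: (wp_mono (wp_for (I := I) (B := B) (k0 := 1) (n := N) _ _ _ _ _ _ _)) => //.
- by lia.
- by lia.
- split; first by move=> p _; rewrite /= !zero.
  by move=> a b _ _; rewrite /= zero // /pairs.
- move=> y s' F yE nE /andP[y1 yN] [Ly My].
  have [eN' eZ'] : rg s' rN = N /\ rg s' rZ = Z by rewrite !(fr_rg F).
  have [epre eorig] : mm s' aPre = pre /\ mm s' aOrig = orig by rewrite !(fr_mm F).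
  have Ls' : lists (mm s' aL) (mm s' aD) Z N nbs by rewrite !(fr_mm F).
  have vN := orig_lt y yN; have capv := cap _ vN; have [Dv Lv] := Ls' _ vN.
  have iv := index_lt vN capv.
  set v := orig y in vN capv Dv Lv iv *.
  apply: wp_sq; apply: wp_set; rewrite /= yE; first by do !split; lia.
  apply: wp_sq; apply: wp_set; rewrite /= ?eorig -/v ?Dv; first by do !split; lia.
  apply: wp_sq; apply: wp_set; rewrite /=; first by lia.
  set s1 := setr _ ri _.
  pose I2 i s2 := J (pairs pre orig nbs y ++ down y (take i (map pre (nbs v)))) s2.
  apply: wp_sq.
  apply: (wp_mono (wp_for (I := I2) (B := fun=> 80 * lg + 80) (k0 := 0) (n := size (nbs v)) _ _ _ _ _ _ _)) => //.
  + lia.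
  + by rewrite /I2 take0 /down /= cats0.
  + move=> i s2 F2 iE bE /andP[_ ib] [L2 M2].
    have [eN2 eZ2] : rg s2 rN = N /\ rg s2 rZ = Z by rewrite !(fr_rg F2).
    have [ey2 ev2] : rg s2 ry = y /\ rg s2 rv = v by rewrite !(fr_rg F2).
    have [epre2 eL2] : mm s2 aPre = pre /\ mm s2 aL = mm s' aL by rewrite !(fr_mm F2).
    set x := pre (nth 0 (nbs v) i).
    have [nbN xN] : nth 0 (nbs v) i < N /\ x < N by apply: nbs_lt vN _; rewrite mem_nth.
    set ps := pairs _ _ _ y ++ _ in L2 M2.
    have psm : size ps <= m.
      apply: leq_trans (total y.+1 yN); rewrite big_nat_recr //= size_cat leq_add ?sizes //; first lia.
      rewrite /down size_map size_filter; apply: leq_trans (count_size _ _) _.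
      by rewrite size_take size_map -/v; case: ifP => //; lia.
    have yx := index_lt yN xN; have xy := index_lt xN yN.
    have ivi : v * Z + i < N * Z by lia.
    apply: wp_sq; apply: wp_set; rewrite /= ?ev2 ?eZ2 ?iE ?eL2 ?Lv // ?epre2 -/x.
      by do !split=> //; lia.
    have next : pairs pre orig nbs y ++ down y (take i.+1 (map pre (nbs v))) =
                if y < x then rcons ps (y, x) else ps.
      rewrite (take_nth 0) ?size_map // down_rcons (nth_map 0) // -/x /ps.
      by case: ifP => // _; rewrite rcons_cat.
    apply: wp_sq; apply: wp_cond; rewrite /= ?ey2; first by do !split; lia.
    * move=> lt; have {}lt : y < x by case: ltnP lt.
      apply: wp_sq; apply: wp_put; rewrite /= ?ey2 ?eN2; [do !split=> //; lia|lia|].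
      apply: wp_sq; apply: wp_put; rewrite /= ?ey2 ?eN2; [do !split=> //; lia|lia|].
      apply: wp_sq; apply: wp_set; first by [].
      apply: wp_sq; apply: wp_set; rewrite /=; first by lia.
      set s3 := setr _ rj _.
      apply: (wp_mono (index_pushP (s := s3) (y := y) (x := x) (ps := ps) bd Nlg _ _ _ _ _ _ _ _ _ _)) => //; try lia.
      move=> t s4 F4 [L4 t4]; apply: wp_set; rewrite /= (fr_rg F4) //= iE; first by do !split=> //; lia.
      split; [by rewrite addn1| |by rewrite /cost /=; lia].
      rewrite /I2 next lt; split; first by exact: L4.
      by rewrite /= (fr_mm F4) //=; apply: adj_table_rcons M2 yN xN.
    * move=> ge; have {}ge : x <= y by case: ltnP ge.
      apply: wp_nop; apply: wp_set; rewrite /= iE; first by do !split=> //; lia.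
      split; [by rewrite addn1| |by rewrite /cost /=; lia].
      by rewrite /I2 next ltnNge ge.
  move=> t2 s2 F2 [iE J2 t2B]; have ey2 : rg s2 ry = y by rewrite (fr_rg F2).
  apply: wp_set; rewrite /= ey2; first by do !split=> //; lia.
  split; first by rewrite addn1.
    by rewrite /I pairsS //; move: J2; rewrite /I2 take_oversize // size_map.
  by move: t2B; rewrite sum_nat_const_nat /cost /B /= -/v; nia.
move=> t s' F [_ [L' M'] tB]; split=> //; split=> //.
apply: leq_trans (_ : 6 + (m * (80 * lg + 90) + N * 44) <= _); last first.
  by rewrite mulnDl mul1n mulnDr; nia.
rewrite {1}/cost /=; move: tB; set S := \sum_(_ <= _ < _) _ => tB.
suff : S <= m * (80 * lg + 90) + N.-1 * 44 by lia.
rewrite /S /B; under eq_bigr => k _ do rewrite -addnA.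
rewrite big_split /= -big_distrl /= sum_nat_const_nat leq_add //; last by lia.
by rewrite leq_mul2r; apply/orP; right; apply: leq_trans summ; rewrite [leqRHS]big_ltn //; lia.
Qed.

(** * Searching the index *)

Notation rc := 16.
Notation rw := 17.
Notation rl := 18.
Notation rr := 19.
Notation rbest := 20.
Notation rlo := 21.
Notation rhi := 22.
Notation rmid := 23.

(** The upper endpoint of a packed edge is at least [w] exactly when its code is at least [w * N],
    so the binary search compares codes without unpacking them. *)
Definition search :=
  rlo ::= K 0 ;; rhi ::= Get aC (R rnode) ;;
  Loop (R rlo [<] R rhi)
    (rmid ::= (R rlo [+] R rhi) [/] K 2 ;;
     Cond (Get aS (R rnode [*] R rZ [+] R rmid) [<] R rw [*] R rN)
       (rlo ::= R rmid [+] K 1) (rhi ::= R rmid)) ;;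
  Cond (R rlo [<] Get aC (R rnode))
    (rx ::= Get aS (R rnode [*] R rZ [+] R rlo) ;;
     Cond (R rx [<] R rbest) (rbest ::= R rx) Nop)
    Nop.

(** The bottom-up decomposition of an interval: at each level an odd left end and an odd right end
    are stripped and the corresponding nodes searched, then both ends are halved. *)
Definition query :=
  rbest ::= R rN [*] R rN ;; rl ::= R rc ;; rr ::= Get aE (R rc) ;; rj ::= K 0 ;;
  Loop (R rl [<] R rr)
    (Cond (R rl [%] K 2)
       (rnode ::= R rj [*] R rN [+] R rl ;; search ;; rl ::= R rl [+] K 1) Nop ;;
     Cond (R rr [%] K 2)
       (rr ::= R rr [-] K 1 ;; rnode ::= R rj [*] R rN [+] R rr ;; search) Nop ;;
     rl ::= R rl [/] K 2 ;; rr ::= R rr [/] K 2 ;; rj ::= R rj [+] K 1).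

Lemma searchP w n N Z lg (nbs : nat -> seq nat) p y s : bounds w n N Z -> Z <= 2 ^ lg ->
  rg s rN = N -> rg s rZ = Z -> rg s rnode = p -> p < N * N -> rg s rw = y -> y < N ->
  lists (mm s aS) (mm s aC) Z (N * N) nbs -> size (nbs p) < Z ->
  sorted (fun u v => u %/ N <= v %/ N) (nbs p) -> (forall v : nat, v \in nbs p -> v < N * N) ->
  rg s rbest <= N * N ->
  wp w search (fun t s' => [/\ rg s' rbest <= rg s rbest,
    rg s' rbest = rg s rbest \/ rg s' rbest \in nbs p /\ y * N <= rg s' rbest,
    forall v, v \in nbs p -> y <= v %/ N -> rg s' rbest %/ N <= v %/ N
    & t <= 60 * lg + 100]) s.
Proof.
move=> bd Zlg eN eZ ep pN ey yN L cap st small best.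
have [[h1 h2 h3 h4] [h5 h6 h7 nn nZ]] := bounds_le bd; have hw := b_w bd.
have [Cp Sp] := L _ pN.
have [l lE] : exists l, nbs p = l by exists (nbs p).
rewrite lE in Cp Sp cap st small *; have ip := index_lt pN cap.
have yNN : y * N < N * N by nia.
apply: wp_sq; apply: wp_set; rewrite /=; first by lia.
apply: wp_sq; apply: wp_set; rewrite /= ?ep ?Cp; first by do !split=> //; lia.
set s0 := setr _ rhi _.
have mono i j : i <= j -> j < size l -> nth 0 l i %/ N <= nth 0 l j %/ N.
  move=> ij jl; apply: (sorted_leq_nth (leT := fun u v => u %/ N <= v %/ N)) => //.
  - by move=> u v x; apply: leq_trans.
  - by rewrite inE; lia.
(* The length still to be searched is below [2 ^ d]; entries before [rlo] have too small an upper
   endpoint, those from [rhi] on are admissible. *)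
pose I b s' := exists d, [/\ rg s' rlo <= rg s' rhi <= size l, rg s' rhi - rg s' rlo < 2 ^ d,
  forall i, i < rg s' rlo -> nth 0 l i %/ N < y,
  forall i, rg s' rhi <= i < size l -> y <= nth 0 l i %/ N & 50 * d <= b].
have I0 : I (50 * lg) s0.
  by exists lg; split=> //= [|i]; lia.
apply: wp_sq; apply: (wp_mono (wp_loop I0 _)) => [b s' F [d [lohi wd lo hi le]]|t s1 F [z [b [d [lohi wd lo hi le]] tb]]].
  have [eN' eZ'] : rg s' rN = N /\ rg s' rZ = Z by rewrite !(fr_rg F).
  have [ep' ey'] : rg s' rnode = p /\ rg s' rw = y by rewrite !(fr_rg F).
  have L' : mm s' aS = mm s aS by rewrite (fr_mm F).
  split; first by rewrite /=; do !split=> //; lia.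
  rewrite /= => lt; have {}lt : rg s' rlo < rg s' rhi by case: ltnP lt.
  have d0 : 0 < d by case: d wd {le} => //; rewrite expn0; lia.
  have [mid midd] : exists mid, (rg s' rlo + rg s' rhi) %/ 2 = mid by eexists.
  have midE : 2 * mid <= rg s' rlo + rg s' rhi < 2 * mid + 2 by clear -midd; lia.
  have ml : rg s' rlo <= mid < rg s' rhi by clear -midE lt; lia.
  have [wl wr] : mid - rg s' rlo < 2 ^ d.-1 /\ rg s' rhi - mid.+1 < 2 ^ d.-1.
    have e2 : 2 ^ d = 2 * 2 ^ d.-1 by rewrite -expnS prednK.
    by move: wd e2; move: (2 ^ d) (2 ^ d.-1) => A A' wd e2; clear -midE ml wd e2; lia.
  have mls : mid < size l by lia.
  have vN : nth 0 l mid < N * N by apply: small; rewrite mem_nth.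
  have cmp : (nth 0 l mid < y * N) = (nth 0 l mid %/ N < y) by rewrite ltn_divLR //; lia.
  apply: wp_sq; apply: wp_set; rewrite /= midd; first by clear -lohi ml mls cap h1 h2 h3 h4 hw; do !split=> //; lia.
  clear midd.
  apply: wp_cond; rewrite /= ?ep' ?eZ' ?eN' ?ey' ?L' ?Sp; try lia.
  - by do !split=> //; lia.
  - rewrite cmp => c; have {}c : nth 0 l mid %/ N < y by case: ltnP c.
    apply: wp_set; rewrite /=; first by do !split=> //; lia.
    exists (b - 50); last by rewrite /cost /=; lia.
    exists d.-1; split=> /=; [lia|lia| |by move=> i hi'; apply: hi; lia|lia].
    by move=> i il; have := mono i mid; lia.
  - rewrite cmp => c; have {}c : y <= nth 0 l mid %/ N by case: ltnP c.
    apply: wp_set; rewrite //=.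
    exists (b - 50); last by rewrite /cost /=; lia.
    exists d.-1; split=> /=; [lia|lia|by move=> i il; apply: lo; lia| |lia].
    by move=> i il; have := mono mid i; lia.
have [eN1 eZ1] : rg s1 rN = N /\ rg s1 rZ = Z by rewrite !(fr_rg F).
have [ep1 eb1] : rg s1 rnode = p /\ rg s1 rbest = rg s rbest by rewrite !(fr_rg F).
have [S1 C1] : mm s1 aS = mm s aS /\ mm s1 aC = mm s aC by rewrite !(fr_mm F).
have {}z : rg s1 rhi <= rg s1 rlo by move: z => /=; case: ltnP.
have first_big v : v \in l -> y <= v %/ N -> rg s1 rlo < size l /\ nth 0 l (rg s1 rlo) %/ N <= v %/ N.
  move=> vl yv; have := lo (index v l); rewrite nth_index // => h.
  have il : index v l < size l by rewrite index_mem.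
  have := mono (rg s1 rlo) (index v l); rewrite nth_index //; lia.
apply: wp_cond; rewrite /= ?ep1 ?C1 ?Cp; first by do !split=> //; lia.
  move=> lt; have {}lt : rg s1 rlo < size l by case: ltnP lt.
  have xl : nth 0 l (rg s1 rlo) \in l by rewrite mem_nth.
  have xN := small _ xl; have yx := hi (rg s1 rlo).
  have yxN : y * N <= nth 0 l (rg s1 rlo) by rewrite -leq_divRL; lia.
  apply: wp_sq; apply: wp_set; rewrite /= ?ep1 ?eZ1 ?S1 ?Sp //; first by do !split=> //; lia.
  apply: wp_cond; rewrite /= ?eb1; first by do !split=> //; lia.
  - move=> c; have {}c : nth 0 l (rg s1 rlo) < rg s rbest by case: ltnP c.
    apply: wp_set => //=; split; [lia|by right|by move=> v vl /(first_big v vl)[]|].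
    by move: tb; rewrite /cost /=; lia.
  - move=> c; have {}c : rg s rbest <= nth 0 l (rg s1 rlo) by case: ltnP c.
    apply: wp_nop => /=; rewrite eb1; split; [lia|by left| |].
      by move=> v vl /(first_big v vl)[_ h]; have := leq_div2r N c; lia.
    by move: tb; rewrite /cost /=; lia.
move=> ge; have {}ge : size l <= rg s1 rlo by case: ltnP ge.
apply: wp_nop; rewrite eb1; split=> //; first by left.
  by move=> v vl /(first_big v vl); lia.
by move: tb; rewrite /cost /=; lia.
Qed.

Definition search_result (N y : nat) (l : seq nat) (best best' : nat) : Prop :=
  [/\ best' <= best, best' = best \/ best' \in l /\ y * N <= best'
    & forall v : nat, v \in l -> y <= v %/ N -> best' %/ N <= v %/ N].

Section Cover.
Variables (N : nat) (ps : seq (nat * nat)) (c e y : nat).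
Hypothesis psN : forall a x : nat, (a, x) \in ps -> a < x < N.
Hypothesis N0 : 0 < N.

(* [best = N * N] is the sentinel meaning that no edge has been found yet *)
Record cover (j l r best : nat) : Prop := Cover {
  cv_l : 0 < l;
  cv_lr : l <= r;
  cv_c : c <= l * 2 ^ j;
  cv_e : r * 2 ^ j <= e;
  cv_best : best <= N * N;
  cv_good : best = N * N \/ exists a x : nat,
    [/\ best = a * N + x, (a, x) \in ps, c <= x < e & y <= a];
  cv_done : forall a x : nat, (a, x) \in ps -> c <= x < e -> y <= a ->
    l * 2 ^ j <= x < r * 2 ^ j \/ best %/ N <= a }.

Lemma node_listP j q v : q < N -> 0 < q -> v \in node_list N ps (j * N + q) <->
  exists a x : nat, [/\ v = a * N + x, (a, x) \in ps & q * 2 ^ j <= x < q.+1 * 2 ^ j].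
Proof.
move=> qN q0; have inE2 x : in_node N (j * N + q) x = (q * 2 ^ j <= x < q.+1 * 2 ^ j).
  rewrite /in_node modn_index // divn_index // q0 /= eqn_leq.
  by rewrite -ltn_divLR ?expn_gt0 // ltnS -leq_divRL ?expn_gt0 // andbC.
split=> [/mapP[[a x]]|[a [x [-> h1 h2]]]].
  by rewrite mem_filter inE2 /= => /andP[h1 h2 ->]; exists a, x.
by apply/mapP; exists (a, x) => //; rewrite mem_filter inE2 h2.
Qed.

Lemma search_good j q best best' : q < N -> 0 < q -> c <= q * 2 ^ j -> q.+1 * 2 ^ j <= e ->
  search_result N y (node_list N ps (j * N + q)) best best' -> best <= N * N ->
  (best = N * N \/ exists a x : nat, [/\ best = a * N + x, (a, x) \in ps, c <= x < e & y <= a]) ->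
  (best' = N * N \/ exists a x : nat, [/\ best' = a * N + x, (a, x) \in ps, c <= x < e & y <= a]).
Proof.
move=> qN q0 cq qe [_ [-> _ _|[/(node_listP _ _ qN q0)[a [x [-> aps xq]]] yb] _ _ _]] //.
right; exists a, x; split=> //; first lia.
have /andP[_ xN] := psN aps.
by have := leq_div2r N yb; rewrite mulnK // divn_index.
Qed.

Lemma search_done j q best best' a x : q < N -> 0 < q ->
  search_result N y (node_list N ps (j * N + q)) best best' ->
  (a, x) \in ps -> y <= a -> q * 2 ^ j <= x < q.+1 * 2 ^ j \/ best %/ N <= a ->
  best' %/ N <= a.
Proof.
move=> qN q0 [le _ min] aps ya [xq|h]; last by apply: leq_trans h; apply: leq_div2r.
have ax := psN aps; have xN : x < N by lia.
have := min (a * N + x); rewrite divn_index // => h; apply: h => //.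
by apply/node_listP => //; exists a, x.
Qed.

(** Searching node [l] moves its edges from those still pending to those that the best edge already
    matches or beats. *)
Lemma cover_left j l r best best' : cover j l r best -> l < r -> l < N ->
  search_result N y (node_list N ps (j * N + l)) best best' ->
  cover j l.+1 r best'.
Proof.
move=> [l0 lr cl re bN good dn] lt lN sr; have [le _ _] := sr.
have leE : l.+1 * 2 ^ j <= e by apply: leq_trans re; rewrite leq_mul2r lt orbT.
have cE : c <= l.+1 * 2 ^ j by rewrite mulSn; lia.
split=> //; try lia.
- exact: search_good sr bN good.
- move=> a x aps xc ya; have [xl|h] := dn a x aps xc ya.
    have [h|h] := leqP (l.+1 * 2 ^ j) x; first by left; lia.
    by right; apply: (search_done lN l0 sr aps ya); left; lia.
  by right; apply: (search_done lN l0 sr aps ya); right.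
Qed.

Lemma cover_right j l r best best' : cover j l r.+1 best -> l <= r -> r < N ->
  search_result N y (node_list N ps (j * N + r)) best best' ->
  cover j l r best'.
Proof.
move=> [l0 lr cl re bN good dn] lt rN sr; have [le _ _] := sr.
have r0 : 0 < r by lia.
have leE : l * 2 ^ j <= r * 2 ^ j by rewrite leq_mul2r lt orbT.
have reE : r * 2 ^ j <= e by move: re; rewrite mulSn; lia.
split=> //; try lia.
- by apply: (search_good rN r0 _ re sr bN good); lia.
- move=> a x aps xc ya; have [xl|h] := dn a x aps xc ya.
    have [h|h] := leqP (r * 2 ^ j) x; last by left; lia.
    by right; apply: (search_done rN r0 sr aps ya); left; lia.
  by right; apply: (search_done rN r0 sr aps ya); right.
Qed.

Lemma cover_half j l r best : cover j l.*2 r.*2 best -> cover j.+1 l r best.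
Proof.
move=> [l0 lr cl re bN good dn].
have E k : k * 2 ^ j.+1 = k.*2 * 2 ^ j by rewrite expnS mulnA muln2.
by split=> //; rewrite ?E //; try lia; move=> a x aps xc ya; rewrite !E; apply: dn.
Qed.

Lemma cover_end j l best : cover j l l best ->
  (exists a x : nat, [/\ (a, x) \in ps, c <= x < e & y <= a]) ->
  exists a x : nat, [/\ best = a * N + x, a < x < N, (a, x) \in ps, c <= x < e & y <= a] /\
  forall a' x', (a', x') \in ps -> c <= x' < e -> y <= a' -> a <= a'.
Proof.
move=> [_ _ _ _ _ good dn] [a0 [x0 [h1 h2 h3]]].
have dn' a x : (a, x) \in ps -> c <= x < e -> y <= a -> best %/ N <= a.
  by move=> aps xc ya; have [|//] := dn a x aps xc ya; lia.
(* The sentinel has quotient [N], larger than any label, so an existing candidate rules it out. *)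
case: good => [bE|[a [x [bE aps xc ya]]]].
  by have := dn' a0 x0 h1 h2 h3; rewrite bE mulnK //; have := psN h1; lia.
exists a, x; split; first by split=> //; exact: psN.
have ax := psN aps; move=> a' x' h1' h2' h3'; have := dn' a' x' h1' h2' h3'.
by rewrite bE divn_index //; lia.
Qed.

End Cover.

Lemma queryP w n N Z lg (ps : seq (nat * nat)) c y e s : bounds w n N Z -> N <= 2 ^ lg ->
  rg s rN = N -> rg s rZ = Z -> rg s rc = c -> rg s rw = y -> mm s aE c = e ->
  0 < c < e -> e <= N -> y < N ->
  lists (mm s aS) (mm s aC) Z (N * N) (node_list N ps) -> size ps < Z ->
  (forall a x : nat, (a, x) \in ps -> a < x < N) ->
  sorted (fun u v : nat * nat => u.1 <= v.1) ps ->
  (exists a x : nat, [/\ (a, x) \in ps, c <= x < e & y <= a]) ->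
  wp w query (fun t s' => t <= 1000 * ((lg + 1) * (lg + 1)) /\
    exists a x : nat, [/\ rg s' rbest = a * N + x, a < x < N, (a, x) \in ps, c <= x < e & y <= a] /\
    forall a' x' : nat, (a', x') \in ps -> c <= x' < e -> y <= a' -> a <= a') s.
Proof.
move=> bd Nlg eN eZ ec ey eE ce eleN yN L psZ psN st cand.
have [[h1 h2 h3 h4] [h5 h6 h7 nn nZ]] := bounds_le bd; have hw := b_w bd.
have N0 : 0 < N by lia.
(* The node lists are only known to be shorter than [Z = N ^ 3], whence up to [3 * lg] rounds of
   binary search. *)
have Zlg : Z <= 2 ^ (3 * lg).
  have -> : 2 ^ (3 * lg) = 2 ^ lg * 2 ^ lg * 2 ^ lg by rewrite !mulSn mul0n addn0 !expnD mulnA.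
  by rewrite (b_Z bd) !leq_mul.
have sz p : size (node_list N ps p) < Z by apply: leq_ltn_trans (node_list_size _ _ _) psZ.
have srt p : sorted (fun u v => u %/ N <= v %/ N) (node_list N ps p).
  by apply: node_list_sorted => // -[a x] /psN /andP[].
have sml p (v : nat) : v \in node_list N ps p -> v < N * N.
  move=> /mapP[[a x]]; rewrite mem_filter => /andP[_ /psN ax] -> /=.
  by apply: index_lt; lia.
have srch j q s0 : rg s0 rN = N -> rg s0 rZ = Z -> rg s0 rw = y -> mm s0 aS = mm s aS ->
    mm s0 aC = mm s aC -> rg s0 rnode = j * N + q -> j < N -> q < N -> rg s0 rbest <= N * N ->
    wp w search (fun t s' => search_result N y (node_list N ps (j * N + q)) (rg s0 rbest) (rg s' rbest)
       /\ t <= 180 * lg + 100) s0.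
  move=> eN0 eZ0 ey0 S0 C0 ep jN qN b0.
  apply: (wp_mono (searchP (p := j * N + q) bd Zlg _ _ _ _ ey0 yN (nbs := node_list N ps) _ _ _ _ _)) => //.
  - exact: index_lt.
  - by rewrite S0 C0.
  - exact: sml.
  by move=> t s' _ [a1 a2 a3 a4]; split; [split|lia].
apply: wp_sq; apply: wp_set; rewrite /= eN; first by do !split=> //; lia.
apply: wp_sq; apply: wp_set; rewrite //=.
apply: wp_sq; apply: wp_set; rewrite /= ec ?eE; first by do !split=> //; lia.
apply: wp_sq; apply: wp_set; rewrite /=; first by lia.
set s0 := setr _ rj _.
pose I b s' := exists2 j, rg s' rj = j /\ j <= lg &
  cover N ps c e y j (rg s' rl) (rg s' rr) (rg s' rbest) /\ 900 * ((lg + 1) * (lg - j)) <= b.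
have I0 : I (900 * ((lg + 1) * lg)) s0.
  exists 0; first by [].
  split; last by rewrite subn0.
  rewrite /=; split; rewrite ?expn0 ?muln1 //; lia.
apply: (wp_mono (wp_loop I0 _)) => [b s1 F [j [jE jlg] [cv le]]|t s1 F [z [b [j _ [cv _]] tb]]]; last first.
  have ge : rg s1 rr <= rg s1 rl by move: z => /=; case: ltnP.
  have lr : rg s1 rl = rg s1 rr by have := cv_lr cv; lia.
  rewrite lr in cv; split; first by move: tb; rewrite /cost /=; nia.
  exact: (cover_end psN N0 cv cand).
have [eN1 eZ1] : rg s1 rN = N /\ rg s1 rZ = Z by rewrite !(fr_rg F).
have ey1 : rg s1 rw = y by rewrite (fr_rg F).
have [S1 C1] : mm s1 aS = mm s aS /\ mm s1 aC = mm s aC by rewrite !(fr_mm F).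
split; first by rewrite /=; do !split=> //; lia.
rewrite /= => lt; have {}lt : rg s1 rl < rg s1 rr by case: ltnP lt.
have rE := cv_e cv; have l0 := cv_l cv; have bN := cv_best cv.
(* The left end is positive and smaller than the right end, so the right end is at least 2. This
   bounds the number of levels by [lg]. *)
have j2 : 2 * 2 ^ j <= N by apply: leq_trans eleN; apply: leq_trans rE; rewrite leq_mul2r; lia.
have jlg' : j < lg by rewrite -(@leq_exp2l 2) // expnS; lia.
have jN : j < N by have := ltn_expl j (isT : 1 < 2); lia.
have rN' : rg s1 rr <= N.
  apply: leq_trans (leq_trans rE eleN); rewrite -{1}[rg s1 rr]muln1 leq_mul2l expn_gt0 orbT //.
have pl := index_lt jN (_ : rg s1 rl < N); have {}pl : j * N + rg s1 rl < N * N by apply: pl; lia.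
pose Q1 t s2 := ~~ odd (rg s2 rl) /\ cover N ps c e y j (rg s2 rl) (rg s2 rr) (rg s2 rbest) /\
  t <= 180 * lg + 130.
apply: wp_sq; apply: (wp_mono (Q := Q1)).
  apply: wp_cond; rewrite /=; first by do !split=> //; lia.
  - move=> od; apply: wp_sq; apply: wp_set; rewrite /= ?jE ?eN1; first by do !split=> //; lia.
    apply: wp_sq; set s2 := setr _ _ _; have ep : rg s2 rnode = j * N + rg s1 rl by [].
    apply: (wp_mono (srch j (rg s1 rl) s2 _ _ _ _ _ ep _ _ _)) => //; first lia.
    move=> t s3 F3 [sr tB]; have l3 : rg s3 rl = rg s1 rl by rewrite (fr_rg F3).
    have r3 : rg s3 rr = rg s1 rr by rewrite (fr_rg F3).
    apply: wp_set; rewrite /= l3; first by do !split=> //; lia.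
    split; first by rewrite /= addn1 /= negbK; lia.
    split; last by rewrite /cost /=; lia.
    by rewrite /= addn1 r3; apply: (cover_left psN N0 cv lt _ sr); lia.
  - move=> ev; apply: wp_nop; split; first by lia.
    by split=> //; rewrite /cost /=; lia.
move=> t1 s2 F2 [ev2 [cv2 t1B]].
have [eN2 eZ2] : rg s2 rN = N /\ rg s2 rZ = Z by rewrite !(fr_rg F2).
have ey2 : rg s2 rw = y by rewrite (fr_rg F2).
have [r2 j2E] : rg s2 rr = rg s1 rr /\ rg s2 rj = j by rewrite !(fr_rg F2).
have [S2 C2] : mm s2 aS = mm s aS /\ mm s2 aC = mm s aC by rewrite !(fr_mm F2).
have lr2 := cv_lr cv2; have bN2 := cv_best cv2.
have rN2 : rg s2 rr <= N by rewrite r2.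
pose Q2 t s3 := ~~ odd (rg s3 rl) /\ ~~ odd (rg s3 rr) /\ 
  cover N ps c e y j (rg s3 rl) (rg s3 rr) (rg s3 rbest) /\ t <= 180 * lg + 130.
apply: wp_sq; apply: (wp_mono (Q := Q2)).
  apply: wp_cond; rewrite /=; first by do !split=> //; lia.
  - move=> od; have [k kE] : exists k, rg s2 rr = k.+1 by exists (rg s2 rr).-1; lia.
    rewrite kE in cv2 lr2 rN2 od.
    have pk := index_lt jN (rN2 : k < N).
    apply: wp_sq; apply: wp_set; rewrite /= kE ?subn1 /=; first by do !split=> //; lia.
    apply: wp_sq; apply: wp_set; rewrite /= ?j2E ?eN2; first by do !split=> //; lia.
    set s3 := setr _ rnode _; have ep : rg s3 rnode = j * N + k by [].
    apply: (wp_mono (srch j k s3 _ _ _ _ _ ep _ _ _)) => //.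
    move=> t s4 F4 [sr tB]; have l4 : rg s4 rl = rg s2 rl by rewrite (fr_rg F4).
    have r4 : rg s4 rr = k by rewrite (fr_rg F4).
    split; first by rewrite l4.
    split; first by rewrite r4; lia.
    split; last by rewrite /cost /=; lia.
    by rewrite l4 r4; apply: (cover_right psN N0 cv2 _ _ sr); lia.
  - move=> ev; apply: wp_nop; split; first by [].
    split; first by lia.
    by split=> //; rewrite /cost /=; lia.
move=> t2 s3 F3 [evl [evr [cv3 t2B]]].
have j3 : rg s3 rj = j by rewrite (fr_rg F3).
have r3 : rg s3 rr <= N.
  have := cv_e cv3; move=> rE3; apply: leq_trans (leq_trans rE3 eleN).
  by rewrite -{1}[rg s3 rr]muln1 leq_mul2l expn_gt0 orbT.
have l3 := cv_lr cv3.
apply: wp_sq; apply: wp_set; rewrite /=; first by do !split=> //; lia.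
apply: wp_sq; apply: wp_set; rewrite /=; first by do !split=> //; lia.
apply: wp_set; rewrite /= j3; first by do !split=> //; lia.
exists (b - 900 * (lg + 1)); last by rewrite /cost /=; nia.
exists j.+1; first by rewrite /= addn1.
split; last first.
  have [k kE] : exists k, lg - j = k.+1 by exists (lg - j).-1; lia.
  have -> : lg - j.+1 = k by lia.
  by move: le; rewrite kE mulnS; lia.
rewrite /=; apply: (cover_half N0).
by rewrite !divn2 !even_halfK.
Qed.

(** * The sweep *)

Notation rop := 25.
Notation ru := 26.
Notation rs := 27.

(* [aTop c] is the subtree root whose rerooting path contains [c], [aX w] the
   vertex at which the subtree of [w] is rerooted, [aP] the new parent *)
Notation aNxt := 10.
Notation aTop := 11.
Notation aX := 12.
Notation aP := 13.

(** The next neighbour of [U] at or after [c] tells in constant time whether the interval of [c]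
    contains one, and which. The entry at [N] is a sentinel. *)
Definition next_neighbours :=
  Put aNxt (R rN) (R rN) ;; ri ::= K 0 ;;
  Loop (R ri [<] R rN)
    (ra ::= R rN [-] K 1 [-] R ri ;;
     Cond (Get aM (R ru [*] R rN [+] R ra)) (Put aNxt (R ra) (R ra))
       (Put aNxt (R ra) (Get aNxt (R ra [+] K 1))) ;;
     ri ::= R ri [+] K 1).

Definition next_in (N : nat) (row : pred nat) (nxt : nat -> nat) (i : nat) : Prop :=
  [/\ i <= nxt i <= N, nxt i < N -> row (nxt i) & forall z, i <= z < nxt i -> ~~ row z].

Lemma next_neighboursP w n N Z U s : bounds w n N Z -> rg s rN = N -> rg s ru = U -> U < N ->
  wp w next_neighbours (fun t s' => t <= 100 * N /\
    forall i, i < N -> next_in N (fun x => mm s aM (U * N + x) != 0) (mm s' aNxt) i) s.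
Proof.
move=> bd eN eU UN; pose row : pred nat := fun x => mm s aM (U * N + x) != 0.
have [[h1 h2 h3 h4] [h5 h6 h7 nn nZ]] := bounds_le bd; have hw := b_w bd.
apply: wp_sq; apply: wp_put; rewrite /= ?eN; [by do !split=> //; lia|by []|].
apply: wp_sq; apply: wp_set; rewrite /=; first by lia.
set s0 := setr _ _ _.
pose I k s' := mm s' aNxt N = N /\
  forall i, N - k <= i < N -> next_in N row (mm s' aNxt) i.
apply: (wp_mono (wp_for (I := I) (B := fun=> 70) (k0 := 0) (n := N) _ _ _ _ _ _ _)) => //.
- lia.
- by split=> [|i]; [rewrite /= upd_same|lia].
- move=> k s' F iE NE /andP[_ kN] [eNN nx].
  have eU' : rg s' ru = U by rewrite (fr_rg F).
  have M' : mm s' aM = mm s aM by rewrite (fr_mm F).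
  have [a aE] : exists a, N - 1 - k = a by eexists.
  have aN : a < N by clear -aE kN; lia.
  have ak : N - k = a.+1 by clear -aE kN; lia.
  have ak' : N - k.+1 = a by clear -aE kN; lia.
  have ua := index_lt UN aN.
  have old i v : a < i -> upd (mm s' aNxt) a v i = mm s' aNxt i.
    by move=> lt; rewrite upd_other //; lia.
  have keep v : next_in N row (upd (mm s' aNxt) a v) a ->
      forall i, N - k.+1 <= i < N -> next_in N row (upd (mm s' aNxt) a v) i.
    rewrite ak' => ha i; have [->|ne] := eqVneq i a; first by [].
    move=> ai; have lt : a < i by lia.
    rewrite /next_in old //; apply: nx; rewrite ak; lia.
  apply: wp_sq; apply: wp_set; rewrite /= NE iE aE; first by do !split; lia.
  apply: wp_sq; apply: wp_cond; rewrite /= ?eU' ?NE ?M'; first by do !split; lia.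
  + move=> ra1; apply: wp_put; rewrite /=; [by do !split; lia|by []|].
    apply: wp_set; rewrite /= iE; first by do !split; lia.
    split; [by rewrite addn1| |by rewrite /cost /=; lia].
    split; first by rewrite /= old.
    rewrite /=; apply: keep; rewrite /next_in upd_same; split=> [|//|z]; lia.
  + move=> ra1; apply: wp_put; rewrite /=; [by do !split; lia|by do !split; lia|].
    apply: wp_set; rewrite /= iE; first by do !split; lia.
    split; [by rewrite addn1| |by rewrite /cost /=; lia].
    split; first by rewrite /= old.
    rewrite /=; apply: keep; rewrite /next_in upd_same addn1.
    have [b1 b2 b3] : next_in N row (mm s' aNxt) a.+1.
      have [lt|ge] := ltnP a.+1 N; first by apply: nx; lia.
      have -> : a.+1 = N by lia.
      by rewrite /next_in eNN; split=> [||z]; lia.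
    split=> //; first lia.
    move=> z az; have [->|ne] := eqVneq z a; first by rewrite /row ra1.
    by apply: b3; lia.
move=> t s' F [_ [_ nx] tB]; split; last by move=> i iN; apply: nx; lia.
by move: tB; rewrite sum_nat_const_nat /cost /=; lia.
Qed.

(** Products stand for conjunctions and [1 - (a < b)] for [b <= a]. The rerooting at [U] itself
    comes last, overriding what the row of [U] suggested. *)
Definition sweep_tree :=
  rc ::= K 1 ;;
  Loop (R rc [<] R rN)
    (rq ::= Get aPar (R rc) ;; rw ::= Get aTop (R rq) ;; ra ::= Get aX (R rw) ;;
     Cond ((K 1 [-] (R ra [<] R rc)) [*] (R ra [<] Get aE (R rc)))
       (Put aTop (R rc) (R rw) ;; Put aP (R rq) (R rc))
       (Cond (R rq) (query ;; ra ::= R rbest [%] R rN ;; rb ::= R rbest [/] R rN)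
          (rb ::= R ru) ;;
        Cond (R rb [=] R ru)
          (ra ::= Get aNxt (R rc) ;;
           Cond (R ra [<] Get aE (R rc)) Nop (ra ::= R rc ;; rb ::= K 0)) Nop ;;
        Cond ((R rq [=] K 0) [*] ((K 1 [-] (R ru [<] R rc)) [*] (R ru [<] Get aE (R rc))))
          (ra ::= R ru ;; rb ::= K 0) Nop ;;
        Put aTop (R rc) (R rc) ;; Put aX (R rc) (R ra) ;; Put aP (R ra) (R rb)) ;;
     rc ::= R rc [+] K 1).

Lemma sweep_treeP w n N Z lg (ps : seq (nat * nat)) (G : rel nat) U row s :
  bounds w n N Z -> N <= 2 ^ lg -> rg s rN = N -> rg s rZ = Z -> rg s ru = U -> 0 < U < N ->
  dfs_numbering N G (mm s aPar) (mm s aE) ->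
  lists (mm s aS) (mm s aC) Z (N * N) (node_list N ps) -> size ps < Z ->
  sorted (fun u v : nat * nat => u.1 <= v.1) ps ->
  (forall a x : nat, ((a, x) \in ps) = [&& 0 < a, a < x, x < N & G a x]) ->
  (forall c, 0 < c < N -> next_in N row (mm s aNxt) c) ->
  (forall k, k \in [:: aTop; aX; aP] -> mm s k = fun=> 0) ->
  wp w sweep_tree (fun t s' => t <= 2000 * ((lg + 1) * (lg + 1) * N) /\
    sweep N G U row (mm s aPar) (mm s aE) (mm s' aTop) (mm s' aX) (mm s' aP)) s.
Proof.
move=> bd Nlg eN eZ eU UN T L psZ st psE nx zero.
have [[h1 h2 h3 h4] [h5 h6 h7 nn nZ]] := bounds_le bd; have hw := b_w bd.
have N0 : 0 < N by lia.
apply: wp_sq; apply: wp_set; rewrite /=; first by lia.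
set s0 := setr _ _ _; set par := mm s aPar in T *; set e := mm s aE in T *.
pose I k s' := sweep k G U row par e (mm s' aTop) (mm s' aX) (mm s' aP).
apply: (wp_mono (wp_for (I := I) (B := fun=> 1600 * ((lg + 1) * (lg + 1))) (k0 := 1) (n := N) _ _ _ _ _ _ _)) => //.
- lia.
- by split; rewrite /= ?zero // => c; lia.
- move=> c s' F cE NE /andP[c1 ck] S.
  have cN : 0 < c < N by lia.
  have eZ' : rg s' rZ = Z by rewrite (fr_rg F).
  have eU' : rg s' ru = U by rewrite (fr_rg F).
  have [Par' E'] : mm s' aPar = par /\ mm s' aE = e by rewrite !(fr_mm F).
  have [S' C'] : mm s' aS = mm s aS /\ mm s' aC = mm s aC by rewrite !(fr_mm F).
  have Nx' : mm s' aNxt = mm s aNxt by rewrite (fr_mm F).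
  have pk := pt_par T cN; have ek := pt_end T cN; have elN := end_le T (proj2 (andP cN)).
  have [w1 w2 w3 w4] := top_spec T (ltnW ck) N0 S pk.
  have wc : mm s' aTop (par c) <= par c by lia.
  have [q qE] : exists q, par c = q by eexists.
  have [v vE] : exists v, mm s' aTop q = v by eexists.
  have [x xE] : exists x, mm s' aX v = x by eexists.
  rewrite qE vE xE in pk w1 w2 w3 wc; rewrite qE vE in w4.
  have eqN := end_le T (ltn_trans pk ck).
  apply: wp_sq; apply: wp_set; rewrite /= cE ?Par' ?qE; first by do !split; lia.
  apply: wp_sq; apply: wp_set; rewrite /= ?vE; first by do !split; lia.
  apply: wp_sq; apply: wp_set; rewrite /= ?xE; first by do !split; lia.
  apply: wp_sq; apply: wp_cond; rewrite /= ?cE ?E'.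
  + by do !split; try lia; case: (x < e c); lia.
  + move=> cond; have {}cond : c <= x < e c by move: cond; case: (ltnP x c); case: (ltnP x (e c)).
    apply: wp_sq; apply: wp_put; rewrite /= ?cE; [by do !split; lia|by []|].
    apply: wp_put; rewrite /=; [by do !split; lia|by []|].
    apply: wp_set; rewrite /= ?cE; first by do !split; lia.
    split; [by rewrite addn1| |by rewrite /cost /=; nia].
    rewrite /I /= -{1}vE -qE; apply: (sweep_extend_path T (ltnW ck) N0 S) => //.
    by rewrite qE vE xE.
  + move=> cond; have {}cond : ~~ (c <= x < e c) by move: cond; case: (ltnP x c); case: (ltnP x (e c)).
    set s1 := setr _ ra _.
    (* Children of label 0 make no query; storing [U] in [rb] sends them into the branch of the
       subtrees whose best edge ends at [U]. *)
    pose Q1 t s2 := t <= 1000 * ((lg + 1) * (lg + 1)) + 50 /\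
      if q == 0 then rg s2 rb = U
      else highest_edge G e c v (rg s2 ra) (rg s2 rb).
    apply: wp_sq; apply: (wp_mono (Q := Q1)).
      apply: wp_cond; first by [].
      + rewrite /= => q0; have q0' : 0 < q by lia.
        have Gqc : G q c by rewrite -qE; apply: (dn_edge T cN); rewrite qE.
        have v0 : 0 < v by apply: w4.
        apply: wp_sq; apply: (wp_mono (queryP (s := s1) (ps := ps) (c := c) (y := v) (e := e c) bd Nlg _ _ _ _ _ _ _ _ _ psZ _ st _)) => //=.
        * by rewrite E'.
        * by lia.
        * by lia.
        * by rewrite S' C'.
        * by move=> a z; rewrite psE => /and4P[? ? ? ?]; lia.
        (* The tree edge above [c] guarantees that the query has an answer. *)
        * by exists q, c; rewrite psE q0' Gqc; split; lia.
        move=> t s2 F2 [tB [a [z [[bE az azp zc va] minE]]]].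
        have eN2 : rg s2 rN = N by rewrite (fr_rg F2).
        have zN : z < N by lia.
        apply: wp_sq; apply: wp_set; rewrite /= bE eN2 ?modn_index //; first by do !split; lia.
        apply: wp_set; rewrite /= bE eN2 ?divn_index //; first by do !split; lia.
        split; first by rewrite /cost /=; lia.
        rewrite (negPf q0) /=; move: azp; rewrite psE => /and4P[a0 _ _ Gaz].
        split=> //; first by lia.
        move=> x' y' xc' yx' Gyx; apply: (minE _ x') => //; last by lia.
        by rewrite psE Gyx; lia.
      + rewrite /= => q0; apply: wp_set => //; split; first by rewrite /cost /=; lia.
        by rewrite q0 /= eU'.
    move=> t2 s2 F2 [t2B Q1s].
    have eU2 : rg s2 ru = U by rewrite (fr_rg F2).
    have [c2 q2] : rg s2 rc = c /\ rg s2 rq = q by rewrite !(fr_rg F2).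
    have [N2 E2] : mm s2 aNxt = mm s aNxt /\ mm s2 aE = e by rewrite !(fr_mm F2).
    have [nx1 nx2 nx3] := nx c cN.
    pose Q2 t s3 := t <= 50 /\
      if q == 0 then attach_to U row e c (rg s3 ra) (rg s3 rb)
      else exists x0 y0, highest_edge G e c v x0 y0 /\
        if y0 == U then attach_to U row e c (rg s3 ra) (rg s3 rb)
        else rg s3 ra = x0 /\ rg s3 rb = y0.
    have Q2P t x' y' s3 : t <= 50 -> rg s3 ra = x' -> rg s3 rb = y' ->
        (if rg s2 rb == U then attach_to U row e c x' y' else x' = rg s2 ra /\ y' = rg s2 rb) -> Q2 t s3.
      move=> tB xE' yE' H; split=> //; rewrite xE' yE'; move: Q1s; case: ifP => _ h.
        by move: H; rewrite h eqxx.
      by exists (rg s2 ra), (rg s2 rb).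
    apply: wp_sq; apply: (wp_mono (Q := Q2)).
      apply: wp_cond; rewrite /= ?eU2; first by do !split; lia.
      + move=> yU; have {}yU : rg s2 rb = U by case: (rg s2 rb =P U) yU.
        apply: wp_sq; apply: wp_set; rewrite /= c2 ?N2; first by do !split; lia.
        apply: wp_cond; rewrite /= ?c2 ?E2; first by do !split; lia.
        * move=> lt; have {}lt : mm s aNxt c < e c by case: ltnP lt.
          apply: wp_nop; apply: (Q2P _ (mm s aNxt c) U) => //.
          by rewrite yU eqxx; left; split; [by []|lia|apply: nx2; lia].
        * move=> ge; have {}ge : e c <= mm s aNxt c by case: ltnP ge.
          apply: wp_sq; apply: wp_set; rewrite //=.
          apply: wp_set; rewrite /=; first by lia.
          apply: (Q2P _ c 0) => //.
          by rewrite yU eqxx; right; split=> // z zc; apply: nx3; lia.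
      + move=> yU; have {}yU : (rg s2 rb == U) = false by case: (rg s2 rb == U) yU.
        by apply: wp_nop; apply: (Q2P _ (rg s2 ra) (rg s2 rb)); rewrite // yU.
    move=> t3 s3 F3 [t3B Q2s].
    have eU3 : rg s3 ru = U by rewrite (fr_rg F3).
    have [c3 q3] : rg s3 rc = c /\ rg s3 rq = q by rewrite !(fr_rg F3).
    have E3 : mm s3 aE = e by rewrite (fr_mm F3).
    pose Q3 t s4 := t <= 50 /\ hook G U row par e (mm s' aTop) c (rg s4 ra) (rg s4 rb).
    apply: wp_sq; apply: (wp_mono (Q := Q3)).
      apply: wp_cond; rewrite /= ?eU3 ?c3 ?q3 ?E3.
      + by do !split; try lia; case: (q == 0); case: (U < c); case: (U < e c); lia.
      + move=> cnd; have [q0 cU] : q = 0 /\ c <= U < e c.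
          by move: cnd; case: (q =P 0) => //; case: (ltnP U c); case: (ltnP U (e c)).
        apply: wp_sq; apply: wp_set; rewrite //=.
        apply: wp_set; rewrite /=; first by lia.
        by split=> //; rewrite /hook qE q0 eqxx cU /= eU3.
      + move=> cnd; apply: wp_nop; split=> //; rewrite /hook qE vE; move: Q2s.
        case: (q =P 0) => [q0|//]; case: ifP => // cU.
        by move: cnd; rewrite q0 /=; case: (ltnP U c); case: (ltnP U (e c)) => //; lia.
    move=> t4 s4 F4 [t4B hk].
    have c4 : rg s4 rc = c by rewrite (fr_rg F4).
    have kx := hook_in T (ltnW ck) N0 cN hk.
    have [T4 X4] : mm s4 aTop = mm s' aTop /\ mm s4 aX = mm s' aX.
      by rewrite (fr_mm F4) // (fr_mm F3) // (fr_mm F2) // (fr_mm F4) // (fr_mm F3) // (fr_mm F2).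
    have P4 : mm s4 aP = mm s' aP by rewrite (fr_mm F4) // (fr_mm F3) // (fr_mm F2).
    apply: wp_sq; apply: wp_put; rewrite /= ?c4; [by do !split; lia|by []|].
    apply: wp_sq; apply: wp_put; rewrite /= ?c4; [by do !split; lia|by []|].
    apply: wp_put; rewrite /=; [by do !split; lia|by []|].
    apply: wp_set; rewrite /= ?c4; first by do !split; lia.
    split; [by rewrite addn1| |].
      rewrite /I /= T4 X4 P4; apply: (sweep_extend_hang T (ltnW ck) N0 S) => //.
      by rewrite qE vE xE.
    have : 0 < (lg + 1) * (lg + 1) by rewrite muln_gt0 addn1.
    by move: ((lg + 1) * (lg + 1)) t2B => A t2B A0; rewrite /cost /=; lia.
move=> t s' F [_ S tB]; split=> //; move: tB; rewrite sum_nat_const_nat /cost /=.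
have : 0 < (lg + 1) * (lg + 1) by rewrite muln_gt0 addn1.
by move: ((lg + 1) * (lg + 1)) => A A0; nia.
Qed.

(** * From labels to DFS trees *)

Section Transfer.
Variables (V : finType) (adj : rel V) (P : nat -> nat) (lab : V -> nat).
Hypothesis lab_inj : injective lab.
Hypothesis lab_pos : forall v, 0 < lab v.
Hypothesis P0 : P 0 = 0.

(** A label of no vertex of the updated graph decodes to the dummy root. This is how the label of a
    deleted vertex disappears: its children become children of the root. *)
Definition decode (a : nat) : option V := [pick v | lab v == a].

Definition decoded_parent (x : option V) : option V :=
  if x is Some v then decode (P (lab v)) else None.

Lemma decode_lab v : decode (lab v) = Some v.
Proof.
by rewrite /decode; case: pickP => [u /eqP/lab_inj -> //|/(_ v)]; rewrite eqxx.
Qed.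

Lemma decode_some a v : decode a = Some v -> a = lab v.
Proof. by rewrite /decode; case: pickP => // u /eqP <- [->]. Qed.

Lemma decode0 : decode 0 = None.
Proof. by rewrite /decode; case: pickP => // v /eqP v0; have := lab_pos v; rewrite v0. Qed.

Hypothesis P_edge : forall v v', P (lab v) = lab v' -> adj v v'.
Hypothesis P_closed : forall v, (exists v', P (lab v) = lab v') \/ P (P (lab v)) = 0.
Hypothesis P_root : forall v, anc P 0 (lab v).
Hypothesis P_comparable : forall v v', adj v v' ->
  anc P (lab v) (lab v') \/ anc P (lab v') (lab v).

Let good (a : nat) : Prop := (exists v, a = lab v) \/ P a = 0.

(** Labels reached from a vertex belong to a vertex or have parent 0, so merging the latter into the
    root commutes with taking parents. *)
Lemma decode_step a : good a -> good (P a) /\ decode (P a) = decoded_parent (decode a).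
Proof.
case=> [[v ->]|Pa].
  rewrite decode_lab; split; last by [].
  by case: (P_closed v) => [[v' Pv]|Pv]; [left; exists v'|right].
split; first by right; rewrite Pa P0.
rewrite Pa decode0; case E: (decode a) => [v|//] /=.
by rewrite -(decode_some E) Pa decode0.
Qed.

Lemma decode_anc b v : anc P b (lab v) -> fconnect decoded_parent (Some v) (decode b).
Proof.
case=> k <-; suff [_ ->] : good (iter k P (lab v)) /\
    decode (iter k P (lab v)) = iter k decoded_parent (Some v) by apply: fconnect_iter.
elim: k => [|k [g E]] /=; first by rewrite decode_lab; split=> //; left; exists v.
by rewrite -E; apply: decode_step.
Qed.

Lemma decoded_dfs_tree : dfs_tree (add_vertex adj xpredT) None decoded_parent.
Proof.
have root x : fconnect decoded_parent x None.
  by case: x => [v|]; [rewrite -decode0; apply: decode_anc|apply: connect0].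
split.
  split=> // -[v|//] _ /=; case E: (decode _) => [v'|//].
  by apply: P_edge; apply: decode_some.
move=> [v|] [v'|] //= h _ _; rewrite ?root ?orbT //.
by have [/decode_anc|/decode_anc] := P_comparable h; rewrite decode_lab => ->; rewrite ?orbT.
Qed.

End Transfer.

Lemma enum_by_code (V : finType) (code : V -> nat) (ids : seq nat) :
  injective code -> uniq ids -> (forall i, (i \in ids) <-> exists v, code v = i) ->
  exists vs, perm_eq vs (enum V) /\ map code vs = ids.
Proof.
move=> inj un H; pose f i := [pick v | code v == i].
have fE i : i \in ids -> omap code (f i) = Some i.
  move=> /H[v vi]; rewrite /f; case: pickP => [u /eqP <- //|/(_ v)]; by rewrite vi eqxx.
have mE : map code (pmap f ids) = ids.
  elim: ids {un H} fE => //= i l IH fE; have := fE i (mem_head _ _).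
  case: (f i) => //= v [->]; rewrite IH // => j jl; apply: fE.
  by rewrite inE jl orbT.
exists (pmap f ids); split=> //; apply: uniq_perm; first by rewrite -(map_inj_uniq inj) mE.
  exact: enum_uniq.
move=> v; rewrite mem_enum -(mem_map inj) mE; apply/H; by exists v.
Qed.

(** * The finished data structure *)

Definition build := link_root ;; dfs ;; index_edges.

Definition valid_edges (n : nat) (es : seq (nat * nat)) : bool :=
  all (fun e => (e.1 < n) && (e.2 < n)) es.

Definition neighbours (N : nat) (es : seq (nat * nat)) : nat -> seq nat :=
  with_root N (incident^~ es) N.-1.

Definition edge_rel (es : seq (nat * nat)) : rel nat :=
  fun u v => ((u, v) \in es) || ((v, u) \in es).

Definition label_rel (N : nat) (orig : nat -> nat) (E : rel nat) : rel nat :=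
  fun y x => [&& 0 < y, y < N, 0 < x, x < N & E (orig y) (orig x)].

Record raw (n N Z : nat) (es : seq (nat * nat)) (s : astate) : Prop := Raw {
  rw_N : rg s rN = N;
  rw_Z : rg s rZ = Z;
  rw_n : rg s rn = n;
  rw_lists : lists (mm s aL) (mm s aD) Z N (incident^~ es);
  rw_zero : forall k, 1 < k -> mm s k = fun=> 0 }.

(** The contract between preprocessing and report. [bl_zero] concerns the arrays that only the
    report uses, which must still be blank. *)
Record built (n N Z : nat) (es ps : seq (nat * nat)) (s : astate) : Prop := Built {
  bl_N : rg s rN = N;
  bl_Z : rg s rZ = Z;
  bl_n : rg s rn = n;
  bl_dfs : dfs_numbering N (label_rel N (mm s aOrig) (edge_rel es)) (mm s aPar) (mm s aE);
  bl_orig0 : mm s aOrig 0 = N.-1;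
  bl_orig : forall a, 0 < a < N -> mm s aOrig a < N.-1 /\ mm s aPre (mm s aOrig a) = a;
  bl_pre : forall v, v < N.-1 -> 0 < mm s aPre v < N /\ mm s aOrig (mm s aPre v) = v;
  bl_lists : lists (mm s aS) (mm s aC) Z (N * N) (node_list N ps);
  bl_size : size ps < Z;
  bl_sorted : sorted (fun u v : nat * nat => u.1 <= v.1) ps;
  bl_mem : forall a x : nat, ((a, x) \in ps) =
    [&& 0 < a, a < x, x < N & label_rel N (mm s aOrig) (edge_rel es) a x];
  bl_adj : forall a b, 0 < a < N -> 0 < b < N -> a != b ->
    (mm s aM (a * N + b) != 0) = label_rel N (mm s aOrig) (edge_rel es) a b;
  bl_diag : forall a, a < N -> mm s aM (a * N + a) = 0;
  bl_zero : forall k, 9 < k -> mm s k = fun=> 0 }.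

Lemma edge_rel_sym es u v : edge_rel es u v = edge_rel es v u.
Proof. by rewrite /edge_rel orbC. Qed.

Lemma label_rel_sym N orig E : symmetric E -> symmetric (label_rel N orig E).
Proof.
move=> sym a b; rewrite /label_rel sym.
by case: (0 < a); case: (a < N); case: (0 < b); case: (b < N).
Qed.

Lemma eq_dfs_numbering N G G' par e : (forall a b, G a b = G' a b) ->
  dfs_numbering N G par e -> dfs_numbering N G' par e.
Proof.
move=> eq [T edge back]; split=> //.
- by move=> x *; rewrite -eq; apply: edge.
- by move=> y x y0 yx; rewrite -eq; apply: back.
Qed.

(** Turns the degree sum over labels into the one over vertices, which bounds the time for building
    the index. *)
Lemma numbering_perm N nbs orig pre par e : 1 < N -> numbering N nbs orig pre par e ->
  perm_eq (map orig (iota 0 N)) (iota 0 N).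
Proof.
move=> N1 [_ o0 _ oa po].
have orig_lt a : a < N -> orig a < N.
  by case: a => [|a] aN; [lia|have [] := oa a.+1; lia].
have un : uniq (map orig (iota 0 N)).
  rewrite map_inj_in_uniq ?iota_uniq // => a b; rewrite !mem_iota => aN bN eq.
  case: a b aN bN eq => [|a] [|b] aN bN eq //.
  - by have [] := oa b.+1; lia.
  - by have [] := oa a.+1; lia.
  - have [|_ <-] := oa a.+1; first lia.
    by have [|_ <-] := oa b.+1; [lia|rewrite eq].
apply: uniq_perm => //; first exact: iota_uniq.
apply: (uniq_min_size un _ _).2; last by rewrite size_map.
by move=> y /mapP[a]; rewrite !mem_iota => aN ->; apply: orig_lt; lia.
Qed.

Lemma buildP w n N Z lg es s : bounds w n N Z -> N <= 2 ^ lg ->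
  valid_edges n es -> size es <= n * n -> (forall u, ~~ edge_rel es u u) ->
  raw n N Z es s ->
  wp w build (fun t s' => t <= 2000 * ((lg + 1) * (size es + N)) /\
    exists ps, built n N Z es ps s') s.
Proof.
move=> bd Nlg esn esz irr [eN eZ en L zero].
have [[h1 h2 h3 h4] [h5 h6 h7 nn nZ]] := bounds_le bd.
have N1 : 1 < N by lia.
have incn v : n <= v -> incident v es = [::].
  move=> nv; have : forall x, x \notin incident v es.
    move=> x; rewrite mem_incident; apply/negP => /orP[] /(allP esn) /=; lia.
  by case: (incident v es) => // x l /(_ x); rewrite mem_head.
have cap v : size (incident v es) < Z by have := incident_size es v; lia.
apply: wp_sq; apply: (wp_mono (link_rootP bd eN eZ L _ _)) => //; first by apply: incn; lia.
move=> t1 s1 F1 [L1 t1B].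
have [eN1 eZ1] : rg s1 rN = N /\ rg s1 rZ = Z by rewrite !(fr_rg F1).
rewrite -/(neighbours N es) in L1; set nbs := neighbours N es in L1.
have nbsE v : v < N -> v != N.-1 -> nbs v = incident v es.
  by rewrite /nbs /neighbours /with_root => _ /negPf ->.
have root : nbs N.-1 = iota 0 N.-1 by rewrite /nbs /neighbours /with_root eqxx.
have capn v : v < N -> size (nbs v) < Z.
  move=> vN; have [->|ne] := eqVneq v N.-1; first by rewrite root size_iota; lia.
  by rewrite nbsE.
have nbs_lt v (x : nat) : v < N -> x \in nbs v -> x < N.-1.
  move=> vN; have [->|ne] := eqVneq v N.-1; first by rewrite root mem_iota.
  by rewrite nbsE // mem_incident => /orP[] /(allP esn) /=; lia.
(* Every edge counts twice, and the list of the dummy root adds [N - 1]. *)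
have sumn : \sum_(v < N) size (nbs v) <= 2 * size es + N.
  have NE : N = n.+2 by lia.
  have n1 : N.-1 = n.+1 by lia.
  have si := sum_incident esn.
  rewrite -(big_mkord xpredT (fun v => size (incident v es))) in si.
  rewrite -(big_mkord xpredT (fun v => size (nbs v))) {1}NE !big_nat_recr //=.
  have -> : \sum_(0 <= v < n) size (nbs v) = \sum_(0 <= v < n) size (incident v es).
    by apply: eq_big_nat => v vn; rewrite nbsE //; lia.
  rewrite si -n1 root size_iota nbsE ?incn /=; lia.
have zero1 k : 1 < k -> mm s1 k = fun=> 0.
  by move=> k1; rewrite (fr_mm F1) ?zero // !inE; lia.
apply: wp_sq; apply: (wp_mono (dfsP bd eN1 eZ1 L1 root capn nbs_lt sumn zero1)).
move=> t2 s2 F2 [num t2B]; have pe := numbering_perm N1 num.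
have [eN2 eZ2] : rg s2 rN = N /\ rg s2 rZ = Z by rewrite !(fr_rg F2).
have L2 : lists (mm s2 aL) (mm s2 aD) Z N nbs by rewrite !(fr_mm F2).
have [T o0 p0 oa po] := num.
set orig := mm s2 aOrig in T o0 oa po pe num; set pre := mm s2 aPre in p0 oa po num.
have orig_lt a : a < N -> orig a < N.
  by case: a => [|a] aN; [lia|have [] := oa a.+1; lia].
have sum2 : \sum_(0 <= y < N) size (nbs (orig y)) <= 2 * size es + N.
  apply: leq_trans sumn; rewrite -(big_mkord xpredT (fun v => size (nbs v))).
  by rewrite /index_iota subn0 -(big_map orig xpredT (fun v => size (nbs v))) (perm_big _ pe).
apply: (wp_mono (index_edgesP bd Nlg eN2 eZ2 L2 capn _ orig_lt sum2 _ _)).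
- move=> v x vN xv; have xN := nbs_lt v x vN xv; have [/andP[_ ?] _] := po x xN; rewrite -/pre; split; lia.
- lia.
- move=> k; rewrite !inE => kk; rewrite (fr_mm F2) ?zero1 // ?inE; move: kk; do 2?case/orP; by move=> /eqP ->.
move=> t3 s3 F3; set ps := pairs pre orig nbs N => -[L3 [M3 t3B]].
have [st psE] := pairs_props pre orig nbs N.
have [o3 p3] : mm s3 aOrig = orig /\ mm s3 aPre = pre by rewrite !(fr_mm F3).
have [pa3 e3] : mm s3 aPar = mm s2 aPar /\ mm s3 aE = mm s2 aE by rewrite !(fr_mm F3).
have GE a b : label_adj N nbs orig a b = label_rel N orig (edge_rel es) a b.
  rewrite /label_adj /label_rel; case a0 : (0 < a); case aN : (a < N) => //=.
  have [|olt _] := oa a; first by rewrite a0 aN.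
  by rewrite nbsE ?mem_incident //; lia.
have memE a x : ((a, x) \in ps) = [&& 0 < a, a < x, x < N & label_rel N orig (edge_rel es) a x].
  rewrite psE -GE /label_adj /=; case a0 : (0 < a) => //=.
  case ax : (a < x); rewrite ?andbF //=.
  have -> : 0 < x by lia.
  case aN : (a < N) => /=; last by rewrite andbF.
  apply/mapP/andP => [[u un ->]|[xN /andP[_ h]]].
    have uN := nbs_lt _ _ (orig_lt a aN) un; have [/andP[_ pu1] pu2] := po u uN.
    by rewrite pu1 pu2.
  exists (orig x) => //; have [|_ ->] := oa x; first lia.
  by [].
split; first by nia.
exists ps; split; rewrite ?o3 ?p3 ?pa3 ?e3 //.
- by rewrite (fr_rg F3) // (fr_rg F2) // (fr_rg F1).
- by rewrite (fr_rg F3) // (fr_rg F2) // (fr_rg F1).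
- by rewrite (fr_rg F3) // (fr_rg F2) // (fr_rg F1).
- exact: eq_dfs_numbering GE T.
- apply: leq_ltn_trans (_ : 2 * size es + N < _); last by lia.
  apply: leq_trans sum2; rewrite /ps /pairs size_flatten /shape -map_comp sumnE big_map.
  rewrite /index_iota subn0.
  have -> : iota 0 N = 0 :: iota 1 N.-1 by rewrite -{1}(prednK (ltnW N1)).
  rewrite big_cons; apply: leq_trans (leq_addl _ _).
  apply: leq_sum => a _ /=; rewrite /down size_map size_filter.
  by apply: leq_trans (count_size _ _) _; rewrite size_map.
- move=> a b aN bN ab; rewrite M3; try lia.
  rewrite !memE (label_rel_sym _ _ (edge_rel_sym es) b a).
  have [a0 aN'] := andP aN; have [b0 bN'] := andP bN; rewrite a0 aN' b0 bN' /=.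
  by case: (ltngtP a b) ab => //= _ _; rewrite ?orbF.
- move=> a aN; apply/eqP; rewrite -[_ == 0]negbK M3 // orbb memE.
  by rewrite ltnn /= andbF.
- move=> k k9; rewrite (fr_mm F3); last by rewrite /= !inE; lia.
  by rewrite (fr_mm F2); [rewrite zero1 //; lia|rewrite /= !inE; lia].
Qed.

(** * From the printed tables to the reported tree *)

Lemma reports_by_labels n (adj : rel 'I_n) (Up : update 'I_n) (pre O P : nat -> nat) (ids : seq nat) :
  let code := @vertex_code n Up in
  injective code -> injective (fun v => pre (code v)) -> (forall v, 0 < pre (code v)) -> P 0 = 0 ->
  (forall v v', P (pre (code v)) = pre (code v') -> updated_adj adj v v') ->
  (forall v, (exists v', P (pre (code v)) = pre (code v')) \/
     P (P (pre (code v))) = 0 /\ O (P (pre (code v))) = n.+1) ->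
  (forall v, anc P 0 (pre (code v))) ->
  (forall v v', updated_adj adj v v' ->
     anc P (pre (code v)) (pre (code v')) \/ anc P (pre (code v')) (pre (code v))) ->
  (forall v, O (pre (code v)) = code v) ->
  uniq ids -> (forall i, (i \in ids) <-> exists v, code v = i) ->
  reports_dfs_tree adj Up (flatten [seq [:: i; O (P (pre i))] | i <- ids]).
Proof.
move=> code inj linj pos P0 edge closed root comp OE un idsE.
pose lab v := pre (code v); exists (decoded_parent P lab).
have [vs [perm vsE]] := enum_by_code inj un idsE.
exists vs; split=> //.
- apply: decoded_dfs_tree => // v; first by have [|[]] := closed v; [left|right].
rewrite -vsE -map_comp; congr flatten; apply: eq_map => v /=; congr [:: _; _].
case E: (decode lab (P (pre (code v)))) => [v'|] /=.
  by rewrite (decode_some E) OE.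
by have [[v' Pv]|[_ ->//]] := closed v; rewrite Pv (decode_lab linj) in E.
Qed.

Record rerooted (N U : nat) (G' : rel nat) (P : nat -> nat) : Prop := Rerooted {
  rr_0 : P 0 = 0;
  rr_U : P U = 0;
  rr_parent : forall v, 0 < v < N -> P v = 0 \/ 0 < P v < N /\ G' v (P v);
  rr_root : forall v, v < N -> anc P 0 v;
  rr_comparable : forall a b, 0 < a < N -> 0 < b < N -> G' a b -> anc P a b \/ anc P b a }.

Definition print_tree :=
  rb ::= R rn [+] (R rop [=] K 0) ;; rv ::= K 0 ;;
  Loop (R rv [<] R rb)
    (Cond ((R rop [=] K 1) [*] (R rv [=] R rs)) Nop
       (Out (R rv) ;; Out (Get aOrig (Get aP (Get aPre (R rv))))) ;;
     rv ::= R rv [+] K 1).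

Definition finish := next_neighbours ;; sweep_tree ;; print_tree.

Definition printed_ids (n op u : nat) : seq nat :=
  [seq v <- iota 0 (n + (op == 0)) | ~~ ((op == 1) && (v == u))].

Lemma print_treeP w n N Z s : bounds w n N Z -> rg s rn = n -> aout s = [::] ->
  (forall v, v <= n -> mm s aPre v < N /\ mm s aP (mm s aPre v) < N) ->
  wp w print_tree (fun t s' => t <= 100 * N /\
    aout s' = flatten [seq [:: v; mm s aOrig (mm s aP (mm s aPre v))] |
                       v <- printed_ids n (rg s rop) (rg s rs)]) s.
Proof.
move=> bd en out lt.
have [[h1 h2 h3 h4] [h5 h6 h7 nn nZ]] := bounds_le bd; have hw := b_w bd.
apply: wp_sq; apply: wp_set; rewrite /= en; first by do !split; case: (rg s rop == 0); lia.
apply: wp_sq; apply: wp_set; rewrite /=; first by lia.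
set s0 := setr _ _ _.
pose I k s' := aout s' = flatten [seq [:: v; mm s aOrig (mm s aP (mm s aPre v))] |
   v <- iota 0 k & ~~ ((rg s rop == 1) && (v == rg s rs))].
apply: (wp_mono (wp_for (I := I) (B := fun=> 60) (k0 := 0) (n := n + (rg s rop == 0)) _ _ _ _ _ _ _)) => //.
- lia.
- move=> k s' F kE nE /andP[_ kn] Ik.
  have [op' rs'] : rg s' rop = rg s rop /\ rg s' rs = rg s rs by rewrite !(fr_rg F).
  have [O' [P' Pre']] : mm s' aOrig = mm s aOrig /\ mm s' aP = mm s aP /\ mm s' aPre = mm s aPre.
    by rewrite !(fr_mm F).
  have kn' : k <= n by move: kn; case: (rg s rop == 0); lia.
  have [l1 l2] := lt k kn'.
  apply: wp_sq; apply: wp_cond; rewrite /= ?op' ?rs' ?kE.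
  + by do !split; case: (rg s rop == 1); case: (k == rg s rs); lia.
  + move=> c; have sk : (rg s rop == 1) && (k == rg s rs) by case: (_ == 1) c; case: (k == rg s rs).
    apply: wp_nop; apply: wp_set; rewrite /= kE; first by do !split; lia.
    split; [by rewrite addn1| |by rewrite /cost /=; lia].
    by rewrite /I -[k.+1]addn1 iotaD filter_cat /= add0n sk /= cats0.
  + move=> c; have sk : (rg s rop == 1) && (k == rg s rs) = false by case: (_ == 1) c; case: (k == rg s rs).
    apply: wp_sq; apply: wp_out; first by [].
    apply: wp_out; rewrite /= ?kE ?O' ?P' ?Pre'; first by do !split; lia.
    apply: wp_set; rewrite /= ?kE; first by do !split; lia.
    split; [by rewrite addn1| |by rewrite /cost /=; lia].
    rewrite /I -[k.+1]addn1 iotaD filter_cat /= add0n sk /= map_cat flatten_cat /= Ik.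
    by rewrite -!cats1 -catA.
move=> t s' F [_ Is tB]; split=> //; move: tB; rewrite sum_nat_const_nat /cost /=.
by case: (rg s rop == 0); lia.
Qed.

Lemma finishP w n N Z lg (ps : seq (nat * nat)) (G G' : rel nat) U s :
  bounds w n N Z -> N <= 2 ^ lg -> rg s rN = N -> rg s rZ = Z -> rg s rn = n ->
  rg s ru = U -> 0 < U < N ->
  dfs_numbering N G (mm s aPar) (mm s aE) ->
  lists (mm s aS) (mm s aC) Z (N * N) (node_list N ps) -> size ps < Z ->
  sorted (fun u v : nat * nat => u.1 <= v.1) ps ->
  (forall a x : nat, ((a, x) \in ps) = [&& 0 < a, a < x, x < N & G a x]) ->
  (forall k, 9 < k -> mm s k = fun=> 0) ->
  (forall v, v <= n -> 0 < mm s aPre v < N) -> aout s = [::] ->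
  (forall a b, 0 < a < N -> 0 < b < N -> a != U -> b != U -> G' a b = G a b) ->
  symmetric G -> symmetric G' ->
  (forall x, 0 < x < N -> x != mm s aPar U -> (mm s aM (U * N + x) != 0) = G' U x) ->
  (0 < mm s aPar U -> G' (mm s aPar U) U) ->
  wp w finish (fun t s' => t <= 3000 * ((lg + 1) * (lg + 1) * N) /\
    exists2 P, rerooted N U G' P &
    aout s' = flatten [seq [:: v; mm s aOrig (P (mm s aPre v))] |
                       v <- printed_ids n (rg s rop) (rg s rs)]) s.
Proof.
move=> bd Nlg eN eZ en eU UN T L psZ st psE zero preN out GG' Gsym G'sym rowE parU.
have UN' : U < N by lia.
apply: wp_sq; apply: (wp_mono (next_neighboursP bd eN eU UN')) => t1 s1 F1 [t1B nx].
have [eN1 eZ1] : rg s1 rN = N /\ rg s1 rZ = Z by rewrite !(fr_rg F1).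
have eU1 : rg s1 ru = U by rewrite (fr_rg F1).
have [Par1 E1] : mm s1 aPar = mm s aPar /\ mm s1 aE = mm s aE by rewrite !(fr_mm F1).
have [S1 C1] : mm s1 aS = mm s aS /\ mm s1 aC = mm s aC by rewrite !(fr_mm F1).
apply: wp_sq; apply: (wp_mono (sweep_treeP (s := s1) (ps := ps) (G := G)
   (row := fun x => mm s aM (U * N + x) != 0) bd Nlg eN1 eZ1 eU1 UN _ _ psZ st psE _ _)).
- by rewrite Par1 E1.
- by rewrite S1 C1.
- by move=> c cN; apply: nx; lia.
- by move=> k; rewrite !inE => /or3P[] /eqP ->; rewrite (fr_mm F1) ?zero.
rewrite Par1 E1 => t2 s2 F2 [t2B S].
have pE v : 0 < v < N -> mm s2 aP v = 0 \/ 0 < mm s2 aP v < N /\ G' v (mm s2 aP v).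
  by apply: (sweep_parent T S UN GG' G'sym Gsym rowE parU).
have pre2 : mm s2 aPre = mm s aPre by rewrite (fr_mm F2) // (fr_mm F1).
have orig2 : mm s2 aOrig = mm s aOrig by rewrite (fr_mm F2) // (fr_mm F1).
apply: (wp_mono (print_treeP (s := s2) bd _ _ _)).
- by rewrite (fr_rg F2) // (fr_rg F1).
- by rewrite (fr_out F2) // (fr_out F1).
- move=> v vn; rewrite pre2; have pv := preN v vn; split; first lia.
  by have [->|[/andP[]]] := pE _ pv; lia.
move=> t3 s3 F3 [t3B ->]; split.
  have : 0 < (lg + 1) * (lg + 1) by rewrite muln_gt0 addn1.
  by move: ((lg + 1) * (lg + 1)) t2B => A t2B A0; nia.
exists (mm s2 aP); last first.
  rewrite pre2 orig2; have [-> ->//] : rg s2 rop = rg s rop /\ rg s2 rs = rg s rs.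
  by rewrite !(fr_rg F2) // !(fr_rg F1).
split=> //.
- exact: (sw_P0 S).
- exact: (sweep_U T S UN parU).
- exact: (sweep_root T S UN parU).
- exact: (sweep_comparable T S UN GG' G'sym Gsym rowE parU).
Qed.

(** * Updates *)

(** Only the row of [U] is read afterwards, so the symmetric entries of the matrix may stay stale,
    here and in the other updates. Vertex [n] has had its label since the numbering was built. *)
Definition insert_vertex :=
  ru ::= Get aPre (R rn) ;; In rb ;; ri ::= K 0 ;;
  Loop (R ri [<] R rb)
    (In ra ;; Put aM (R ru [*] R rN [+] Get aPre (R ra)) (K 1) ;; ri ::= R ri [+] K 1).

(** Overwriting the printed name of [U] by the code of the dummy root makes the children of [U] in
    the new tree report the root as their parent. *)
Definition delete_vertex :=
  In rs ;; ru ::= Get aPre (R rs) ;; Put aOrig (R ru) (R rn [+] K 1) ;; ri ::= K 0 ;;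
  Loop (R ri [<] R rN)
    (Put aM (R ru [*] R rN [+] R ri) (K 0) ;; ri ::= R ri [+] K 1).

(** [U] becomes the endpoint with the smaller label: the other endpoint is then not its parent, so
    the tree edge above [U] survives a deletion. The opcode test writes 1 for an insertion and 0 for
    a deletion. *)
Definition change_edge :=
  In ra ;; In rb ;; ru ::= Get aPre (R ra) ;; rv ::= Get aPre (R rb) ;;
  Cond (R rv [<] R ru) (rx ::= R ru ;; ru ::= R rv ;; rv ::= R rx) Nop ;;
  Put aM (R ru [*] R rN [+] R rv) (R rop [=] K 2).

Definition update_graph :=
  In rop ;;
  Cond (R rop [=] K 0) insert_vertex
    (Cond (R rop [=] K 1) delete_vertex change_edge).

Section Updates.
Variables (w n N Z : nat) (s : astate).
Hypothesis bd : bounds w n N Z.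
Hypothesis eN : rg s rN = N.
Hypothesis en : rg s rn = n.
Hypothesis preN : forall v, v <= n -> mm s aPre v < N.

Lemma insert_vertexP l : ain s = size l :: l -> all (fun v => v < n) l -> size l <= n ->
  wp w insert_vertex (fun t s' => [/\ t <= 100 * N, rg s' ru = mm s aPre n &
    forall x, x < N -> (mm s' aM (mm s aPre n * N + x) != 0) =
      (mm s aM (mm s aPre n * N + x) != 0) || (x \in map (mm s aPre) l)]) s.
Proof.
move=> tape ln sz.
have [[h1 h2 h3 h4] [h5 h6 h7 nn nZ]] := bounds_le bd; have hw := b_w bd.
have UN := preN (leqnn n); set U := mm s aPre n in UN *.
apply: wp_sq; apply: wp_set; rewrite /= en -/U; first by do !split; lia.
apply: wp_sq; apply: wp_in; [exact: tape|lia|].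
apply: wp_sq; apply: wp_set; rewrite /=; first by lia.
set s0 := setr _ _ _.
pose I k s' := ain s' = drop k l /\ forall x, x < N -> (mm s' aM (U * N + x) != 0) =
      (mm s aM (U * N + x) != 0) || (x \in map (mm s aPre) (take k l)).
apply: (wp_mono (wp_for (I := I) (B := fun=> 60) (k0 := 0) (n := size l) _ _ _ _ _ _ _)) => //.
- lia.
- by split=> [|x _]; rewrite ?drop0 // take0 orbF.
- move=> k s' F kE nE /andP[_ kl] [tp rowE].
  have [eN' eU'] : rg s' rN = N /\ rg s' ru = U by rewrite !(fr_rg F).
  have Pre' : mm s' aPre = mm s aPre by rewrite (fr_mm F).
  rewrite (drop_nth 0) // in tp.
  have [v vE] : exists v, nth 0 l k = v by eexists.
  have vn : v < n by rewrite -vE; apply: (allP ln); rewrite mem_nth.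
  rewrite vE in tp; have pv := preN (ltnW vn); have uv := index_lt UN pv.
  apply: wp_sq; apply: (wp_in tp); first lia.
  apply: wp_sq; apply: wp_put; rewrite /= ?eU' ?eN' ?Pre'; [by do !split; lia|lia|].
  apply: wp_set; rewrite /= ?kE; first by do !split; lia.
  split; [by rewrite addn1| |by rewrite /cost /=; lia].
  split=> // x xN; rewrite /= updE (take_nth 0) // vE map_rcons mem_rcons inE -orbCA -rowE //.
  have -> : (U * N + x == U * N + mm s aPre v) = (x == mm s aPre v) by rewrite eqn_add2l.
  by case: (x == _).
move=> t s' F [_ [_ rowE] tB]; split.
- by move: tB; rewrite sum_nat_const_nat /cost /=; lia.
- by rewrite (fr_rg F).
- by move=> x xN; rewrite rowE // take_size.
Qed.

Lemma delete_vertexP u : ain s = [:: u] -> u < n ->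
  wp w delete_vertex (fun t s' => [/\ t <= 100 * N, rg s' ru = mm s aPre u, rg s' rs = u,
    mm s' aOrig = upd (mm s aOrig) (mm s aPre u) n.+1 &
    forall x, x < N -> mm s' aM (mm s aPre u * N + x) = 0]) s.
Proof.
move=> tape un.
have [[h1 h2 h3 h4] [h5 h6 h7 nn nZ]] := bounds_le bd; have hw := b_w bd.
have UN := preN (ltnW un); set U := mm s aPre u in UN *.
apply: wp_sq; apply: (wp_in tape); first lia.
apply: wp_sq; apply: wp_set; rewrite /= -/U; first by do !split; lia.
apply: wp_sq; apply: wp_put; rewrite /= ?en; [by do !split; lia|by do !split; lia|].
apply: wp_sq; apply: wp_set; rewrite /=; first by lia.
set s0 := setr _ _ _.
pose I k s' := forall x, x < k -> mm s' aM (U * N + x) = 0.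
apply: (wp_mono (wp_for (I := I) (B := fun=> 60) (k0 := 0) (n := N) _ _ _ _ _ _ _)) => //.
- lia.
- move=> k s' F kE NE /andP[_ kN] z.
  have eU' : rg s' ru = U by rewrite (fr_rg F).
  have uk := index_lt UN kN.
  apply: wp_sq; apply: wp_put; rewrite /= ?eU' ?NE ?kE; [by do !split; lia|lia|].
  apply: wp_set; rewrite /= ?kE; first by do !split; lia.
  split; [by rewrite addn1| |by rewrite /cost /=; lia].
  move=> x; rewrite ltnS leq_eqVlt /= updE eqn_add2l; case: eqP => //= _; exact: z.
move=> t s' F [_ z tB]; split=> //.
- by move: tB; rewrite sum_nat_const_nat /cost /=; lia.
- by rewrite (fr_rg F).
- by rewrite (fr_rg F).
- by rewrite (fr_mm F) //= addn1.
Qed.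

Lemma change_edgeP u v : ain s = [:: u; v] -> u < n -> v < n ->
  wp w change_edge (fun t s' => exists U V, [/\ t <= 100 * N, rg s' ru = U, U <= V,
    (U, V) = (mm s aPre u, mm s aPre v) \/ (U, V) = (mm s aPre v, mm s aPre u) &
    mm s' aM = upd (mm s aM) (U * N + V) (rg s rop == 2)]) s.
Proof.
move=> tape un vn.
have [[h1 h2 h3 h4] [h5 h6 h7 nn nZ]] := bounds_le bd; have hw := b_w bd.
have [pu pv] : mm s aPre u < N /\ mm s aPre v < N by rewrite !preN // ltnW.
have uv := index_lt pu pv; have vu := index_lt pv pu.
apply: wp_sq; apply: (wp_in tape); first lia.
apply: wp_sq; apply: wp_in; [by []|lia|].
apply: wp_sq; apply: wp_set; rewrite /=; first by do !split; lia.
apply: wp_sq; apply: wp_set; rewrite /=; first by do !split; lia.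
have op : (rg s rop == 2) < 2 by case: (_ == _).
apply: wp_sq; apply: wp_cond; rewrite /=; first by do !split; lia.
- move=> c; have lt : mm s aPre v < mm s aPre u by case: ltnP c.
  apply: wp_sq; apply: wp_set; rewrite //=.
  apply: wp_sq; apply: wp_set; rewrite //=.
  apply: wp_set; rewrite //=.
  apply: wp_put; rewrite /= ?eN; [by do !split; lia|by do !split; lia|].
  exists (mm s aPre v), (mm s aPre u); split=> //; [by rewrite /cost /=; lia|lia|by right].
- move=> c; have le : mm s aPre u <= mm s aPre v by case: ltnP c.
  apply: wp_nop; apply: wp_put; rewrite /= ?eN; [by do !split; lia|by do !split; lia|].
  exists (mm s aPre u), (mm s aPre v); split=> //; [by rewrite /cost /=; lia|by left].
Qed.

End Updates.

Definition same_pair (u v : nat) : rel nat :=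
  fun a b => (a == u) && (b == v) || (a == v) && (b == u).

Lemma same_pair_sym u v : symmetric (same_pair u v).
Proof.
move=> a b; rewrite /same_pair.
by case: (a == u); case: (b == v); case: (a == v); case: (b == u).
Qed.

Lemma same_pairC u v a b : same_pair u v a b = same_pair v u a b.
Proof. by rewrite /same_pair orbC. Qed.

Lemma set2_eq (T : finType) (x y u v : T) :
  ([set x; y] == [set u; v]) = (x == u) && (y == v) || (x == v) && (y == u).
Proof.
apply/eqP/orP => [E|[/andP[/eqP-> /eqP->]|/andP[/eqP-> /eqP->]]] //; last by rewrite setUC.
move/setP: E => E; have := E x; have := E y; have := E u; have := E v.
rewrite !inE !eqxx ?orbT /= [u == x]eq_sym [u == y]eq_sym [v == x]eq_sym [v == y]eq_sym.
by case: (x == u); case: (x == v); case: (y == u); case: (y == v) => //=; auto.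
Qed.

Section Report.
Variables (w n N Z lg : nat) (es ps : seq (nat * nat)) (s : astate).
Hypothesis bd : bounds w n N Z.
Hypothesis Nlg : N <= 2 ^ lg.
Hypothesis B : built n N Z es ps s.
Hypothesis es_valid : valid_edges n es.
Hypothesis es_irr : forall u, ~~ edge_rel es u u.
Hypothesis out : aout s = [::].

Let pre := mm s aPre.
Let orig := mm s aOrig.
Let par := mm s aPar.
Let E := edge_rel es.

Lemma N_eq : N = n.+2.
Proof. by rewrite (b_N bd) addn2. Qed.

Lemma pre_spec v : v <= n -> 0 < pre v < N /\ orig (pre v) = v.
Proof. by move=> vn; apply: (bl_pre B); rewrite N_eq ltnS. Qed.

Lemma orig_spec a : 0 < a < N -> orig a <= n /\ pre (orig a) = a.
Proof. by move=> /(bl_orig B); rewrite N_eq ltnS. Qed.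

Lemma edge_lt u v : E u v -> u < n /\ v < n.
Proof. by rewrite /E /edge_rel => /orP[] /(allP es_valid) /andP[]. Qed.

Lemma row_adj U x : 0 < U < N -> 0 < x < N ->
  (mm s aM (U * N + x) != 0) = label_rel N orig E U x.
Proof.
move=> UN xN; have [->|ne] := eqVneq x U; last by rewrite (bl_adj B) // eq_sym.
rewrite (bl_diag B); last by case/andP: UN.
by rewrite /label_rel /E (negPf (es_irr _)) !andbF.
Qed.

Lemma label_relE (R : rel nat) a b : 0 < a < N -> 0 < b < N ->
  label_rel N orig R a b = R (orig a) (orig b).
Proof. by rewrite /label_rel => /andP[-> ->] /andP[-> ->]. Qed.

Lemma finish_updated U O (E' : rel nat) s2 : frame update_graph s s2 ->
  rg s2 ru = U -> 0 < U < N -> mm s2 aOrig = O -> symmetric E' ->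
  (forall a b, a != orig U -> b != orig U -> E' a b = E a b) ->
  (forall x, 0 < x < N -> x != par U -> (mm s2 aM (U * N + x) != 0) = E' (orig U) (orig x)) ->
  (0 < par U -> E' (orig (par U)) (orig U)) ->
  wp w finish (fun t s' => t <= 3000 * ((lg + 1) * (lg + 1) * N) /\
    exists2 P, rerooted N U (label_rel N orig E') P &
    aout s' = flatten [seq [:: v; O (P (pre v))] | v <- printed_ids n (rg s2 rop) (rg s2 rs)]) s2.
Proof.
move=> F eU UN eO symE' EE' rowE parE.
have Epar : mm s2 aPar = par by rewrite (fr_mm F).
have Ee : mm s2 aE = mm s aE by rewrite (fr_mm F).
have Epre : mm s2 aPre = pre by rewrite (fr_mm F).
have parN := pt_par (bl_dfs B) UN; rewrite -/par in parN.
apply: (wp_mono (finishP (ps := ps) (G := label_rel N orig E) (G' := label_rel N orig E') (U := U) bd Nlg _ _ _ eU UN _ _ (bl_size B) (bl_sorted B) (bl_mem B) _ _ _ _ _ _ _ _)).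
- by rewrite (fr_rg F) // (bl_N B).
- by rewrite (fr_rg F) // (bl_Z B).
- by rewrite (fr_rg F) // (bl_n B).
- by rewrite Epar Ee; exact: (bl_dfs B).
- by rewrite !(fr_mm F) //; exact: (bl_lists B).
- by move=> k k9; rewrite (fr_mm F) ?(bl_zero B) // !inE; lia.
- by move=> v vn; rewrite Epre; have [] := pre_spec vn.
- by rewrite (fr_out F).
- move=> a b aN bN aU bU; rewrite !label_relE //.
  by apply: EE'; [apply: contra aU|apply: contra bU] => /eqP eq;
    [have [_ <-] := orig_spec aN|have [_ <-] := orig_spec bN]; have [_ <-] := orig_spec UN; rewrite eq.
- exact/label_rel_sym/edge_rel_sym.
- exact/label_rel_sym.
- by rewrite Epar => x xN xp; rewrite rowE // label_relE.
- by rewrite Epar => p0; rewrite label_relE //; [apply: parE|lia].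
by move=> t s' _ [tB [P rr ->]]; split=> //; exists P => //; rewrite Epre eO.
Qed.

(** The endpoint of an edge that is no vertex of the updated graph can only be the erased [U], which
    [P] places directly below 0. *)
Lemma reports_rerooted (adj : rel 'I_n) (Up : update 'I_n) (E' : rel nat) U O P ids :
  let code := @vertex_code n Up in
  injective code -> (forall v, code v <= n) ->
  (forall v v', updated_adj adj v v' = E' (code v) (code v')) ->
  (forall a b, E' a b -> (exists v, code v = b) \/ pre b = U /\ O U = n.+1) ->
  rerooted N U (label_rel N orig E') P -> O 0 = n.+1 ->
  (forall v, O (pre (code v)) = code v) -> 
  uniq ids -> (forall i, (i \in ids) <-> exists v, code v = i) ->
  reports_dfs_tree adj Up (flatten [seq [:: i; O (P (pre i))] | i <- ids]).
Proof.
move=> code inj code_le adjE closed [P0 PU par_ root comp] O0 OE un idsE.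
have lab v := proj1 (pre_spec (code_le v)); have orig_lab v := proj2 (pre_spec (code_le v)).
have parent v : P (pre (code v)) = 0 \/ exists b, [/\ b <= n, P (pre (code v)) = pre b & E' (code v) b].
  have [|[PN]] := par_ _ (lab v); [by left|rewrite label_relE // orig_lab => h; right].
  by have [ob <-] := orig_spec PN; exists (orig (P (pre (code v)))); split.
apply: (@reports_by_labels n adj Up pre O P ids inj) => //.
- by move=> u v /(congr1 orig); rewrite !orig_lab => /inj.
- by move=> v; have /andP[] := lab v.
- move=> v v' Pv; have [Pv0|[b [bn Pb h]]] := parent v; first by have /andP[] := lab v'; rewrite -Pv Pv0.
  by rewrite adjE -(orig_lab v') -Pv Pb (pre_spec bn).2.
- move=> v; have [->|[b [bn -> /closed[[v' <-]|[-> ->]]]]] := parent v; [by right|by left; exists v'|by right].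
- by move=> v; apply: root; have /andP[] := lab v.
- by move=> v v'; rewrite adjE => h; apply: comp; rewrite ?label_relE ?orig_lab.
Qed.

End Report.

(** * The four updates *)

Section Cases.
Variables (w n N Z lg : nat) (es ps : seq (nat * nat)) (s : astate) (adj : rel 'I_n).
Hypothesis bd : bounds w n N Z.
Hypothesis Nlg : N <= 2 ^ lg.
Hypothesis B : built n N Z es ps s.
Hypothesis es_valid : valid_edges n es.
Hypothesis es_irr : forall u, ~~ edge_rel es u u.
Hypothesis out : aout s = [::].
Hypothesis adjE : forall u v : 'I_n, adj u v = edge_rel es u v.

Let pre := mm s aPre.
Let orig := mm s aOrig.
Let par := mm s aPar.
Let E := edge_rel es.

Let reported (Up : update 'I_n) (t : nat) (s' : astate) : Prop :=
  t <= 4000 * ((lg + 1) * (lg + 1) * N) /\ reports_dfs_tree adj Up (aout s').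

Let w_ge3 : 3 < 2 ^ w.
Proof. by have [[h1 h2 h3 h4] [h5 h6 h7 nn nZ]] := bounds_le bd; have := b_w bd; lia. Qed.

Let fits_small k : k < 4 -> k < 2 ^ w.
Proof. by move=> h; apply: leq_trans h w_ge3. Qed.

Let preN v : v <= n -> pre v < N.
Proof. by move=> /(pre_spec bd B) [/andP[]]. Qed.

Let budget t : t <= 100 * N + 30 -> forall t', t' <= 3000 * ((lg + 1) * (lg + 1) * N) ->
  t + t' <= 4000 * ((lg + 1) * (lg + 1) * N).
Proof.
move=> tB t' t'B; have N2 : 1 < N by rewrite (N_eq bd).
have : N <= (lg + 1) * (lg + 1) * N by rewrite leq_pmull // muln_gt0 addn1.
by move: ((lg + 1) * (lg + 1) * N) t'B => A; lia.
Qed.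

Let E_sym : symmetric E. Proof. exact: edge_rel_sym. Qed.

Let edge_to_parent U : 0 < U < N -> 0 < par U -> E (orig (par U)) (orig U).
Proof. by move=> UN p0; have := dn_edge (bl_dfs B) UN p0; rewrite /label_rel => /and5P[]. Qed.

Let parU U : 0 < U < N -> par U < U.
Proof. exact: (pt_par (bl_dfs B)). Qed.

Lemma report_insert_vertex (l : seq 'I_n) : uniq l ->
  ain s = update_code (InsertVertex l) ->
  wp w (update_graph ;; finish) (reported (InsertVertex l)) s.
Proof.
move=> ul tape; set l' := map (@nat_of_ord n) l in tape *; set U := pre n.
have ln : all (fun v => v < n) l' by apply/allP => _ /mapP[v _ ->].
have szl : size l' <= n.
  by rewrite size_map -(card_uniqP ul) -[X in _ <= X]card_ord max_card.
have [UN oU] := pre_spec bd B (leqnn n).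
pose Q t s' := [/\ t <= 100 * N + 30, rg s' rop = 0, rg s' ru = U, mm s' aOrig = orig
  & forall x, x < N -> (mm s' aM (U * N + x) != 0) =
      (mm s aM (U * N + x) != 0) || (x \in map pre l')].
apply: wp_sq; apply: (wp_mono (Q := Q)).
  have tape' : ain s = [:: 0, size l' & l'] by rewrite tape /= size_map.
  apply: wp_sq; apply: (wp_in tape'); first exact: fits_small.
  set s1 := AState _ _ _ _; apply: wp_cond; rewrite //=; first by do !split; apply: fits_small.
  move=> _; apply: (wp_mono (insert_vertexP (s := s1) bd (bl_N B) (bl_n B) preN (erefl _) ln szl)).
  move=> t s' F [tB ruE rowE]; split=> //; first by rewrite /cost /=; clear -tB; lia.
    by rewrite (fr_rg F).
  by rewrite (fr_mm F).
move=> t s2 F [tB opE ruE oE rowE].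
pose E' : rel nat := fun a b => [|| E a b, (a == n) && (b \in l') | (b == n) && (a \in l')].
have nl : n \notin l' by apply/negP => /(allP ln); rewrite ltnn.
have E'sym : symmetric E'.
  by move=> a b; rewrite /E' E_sym; congr (_ || _); rewrite orbC.
apply: (wp_mono (finish_updated bd Nlg B es_valid out (E' := E') F ruE UN oE E'sym _ _ _)).
- by move=> a b; rewrite oU /E' => /negPf -> /negPf ->; rewrite orbF.
- move=> x xN _; rewrite rowE; last by case/andP: xN.
  rewrite (row_adj B es_irr) // label_relE // oU /E' eqxx (negPf nl) andbF orbF /=.
  have [ox pox] := orig_spec bd B xN; congr (_ || _); apply/mapP/idP => [[v vl xE]|xl].
    by have /ltnW vn := allP ln _ vl; rewrite xE (pre_spec bd B vn).2.
  by exists (orig x).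
- by move=> p0; rewrite /E' edge_to_parent.
move=> t' s' _ [t'B [P rr outE]]; rewrite /reported outE; split; first exact: budget.
apply: (reports_rerooted bd B (E' := E') (U := U) (O := orig)) => //.
- by move=> [u|] [v|] //= => [/val_inj ->|eq|eq] //; [have := ltn_ord u|have := ltn_ord v]; rewrite ?eq -?eq ltnn.
- by move=> [u|] //=; apply/ltnW/ltn_ord.
- have nel (v : 'I_n) : (val v == n) = false by rewrite ltn_eqF //; apply: ltn_ord.
  have mem (v : 'I_n) : (val v \in l') = (v \in l) by rewrite mem_map //; apply: val_inj.
  have noE a : E n a = false by apply/negP => /(edge_lt es_valid)[]; rewrite ltnn.
  move=> [u|] [v|] /=; rewrite /E' ?adjE ?eqxx ?nel ?mem ?(negPf nl) ?noE ?orbF //.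
  + by rewrite E_sym noE.
- move=> a b h; left; have bn : b <= n.
    case/or3P: h => [/(edge_lt es_valid)[_ /ltnW]|/andP[_ /(allP ln)/ltnW]|/andP[/eqP->]] //.
  have [lt|ge] := ltnP b n; first by exists (Some (Ordinal lt)).
  by exists None; apply/eqP; rewrite /= eqn_leq ge bn.
- by rewrite /orig (bl_orig0 B) (N_eq bd).
- move=> v; apply: (pre_spec bd B _).2.
  by case: v => //= v; apply: ltnW.
- by rewrite filter_uniq ?iota_uniq.
- move=> i; rewrite /printed_ids opE /= filter_predT mem_iota /= addn1 ltnS; split.
    move=> bn; have [lt|ge] := ltnP i n; first by exists (Some (Ordinal lt)).
    by exists None; apply/eqP; rewrite /= eqn_leq ge bn.
  by move=> [[v|] <-] //=; apply: ltnW.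
Qed.

Lemma report_delete_vertex (u : 'I_n) : ain s = update_code (DeleteVertex u) ->
  wp w (update_graph ;; finish) (reported (DeleteVertex u)) s.
Proof.
move=> tape; have un := ltn_ord u; have [UN oU] := pre_spec bd B (ltnW un).
pose U := pre u.
have tape' : ain s = [:: 1; nat_of_ord u] by [].
pose Q t s' := [/\ t <= 100 * N + 30, rg s' rop = 1 /\ rg s' rs = u, rg s' ru = U,
  mm s' aOrig = upd orig U n.+1 & forall x, x < N -> mm s' aM (U * N + x) = 0].
apply: wp_sq; apply: (wp_mono (Q := Q)).
  apply: wp_sq; apply: (wp_in tape'); first exact: fits_small.
  set s1 := AState _ _ _ _; apply: wp_cond; rewrite //=; first by do !split; apply: fits_small.
  move=> _; apply: wp_cond; rewrite //=; first by do !split; apply: fits_small.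
  move=> _; apply: (wp_mono (delete_vertexP (s := s1) bd (bl_N B) (bl_n B) preN (erefl _) un)).
  move=> t s' F [tB ruE rsE oE rowE]; split=> //; first by rewrite /cost /=; clear -tB; lia.
  by split=> //; rewrite (fr_rg F).
move=> t s2 F [tB [opE rsE] ruE oE rowE].
(* Keeping the edge from [U] to its tree parent lets [U] be the root of the
   new tree; erasing this root then leaves its only child at the top *)
pose E' : rel nat := fun a b => if (a == u) || (b == u) then (0 < par U) && same_pair u (orig (par U)) a b
                                else E a b.
have E'sym : symmetric E'.
  by move=> a b; rewrite /E' E_sym same_pair_sym orbC.
have parN := parU UN; rewrite -/U in parN.
apply: (wp_mono (finish_updated bd Nlg B es_valid out (E' := E') F ruE UN oE E'sym _ _ _)).
- by move=> a b; rewrite oU /E' => /negPf -> /negPf ->.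
(* The cleared row differs from [E'] only in the edge kept to the parent, which is the exempted
   position. *)
- move=> x xN xp; rewrite rowE; last by case/andP: xN.
  rewrite /= oU /E' eqxx /=; symmetry; apply/negbTE/negP => /andP[p0].
  have pN : 0 < par U < N by rewrite p0; apply: ltn_trans parN _; case/andP: UN.
  have [op pp] := orig_spec bd B pN; have [ox px] := orig_spec bd B xN.
  rewrite /same_pair eqxx /= => /orP[/eqP eq|/andP[/eqP eq _]].
    by case/eqP: xp; have := congr1 pre eq; rewrite [LHS]px [RHS]pp.
  by move: parN; have := congr1 pre eq; rewrite [RHS]pp => <-; rewrite ltnn.
- by move=> p0; rewrite oU /E' eqxx orbT p0 /same_pair !eqxx orbT.
move=> t' s' _ [t'B [P rr outE]]; rewrite /reported outE; split; first exact: budget.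
apply: (reports_rerooted bd B (E' := E') (U := U)) => //.
- by move=> a b /= /val_inj/val_inj.
- by move=> a /=; apply/ltnW/ltn_ord.
- move=> a b /=; rewrite /E' adjE.
  by rewrite !(inj_eq val_inj) (negPf (valP a)) (negPf (valP b)).
- move=> a b; have [->|bu] := eqVneq b (u : nat).
    by move=> _; right; rewrite upd_same.
  move=> h; left; have bn : b < n.
    move: h; rewrite /E' (negPf bu) orbF; case: (a == u); last by move=> /(edge_lt es_valid)[].
    case/andP=> p0; rewrite /same_pair (negPf bu) andbF orbF => /andP[_ /eqP ->].
    by have /(edge_lt es_valid)[] := edge_to_parent UN p0.
  have bu' : Ordinal bn != u by rewrite -val_eqE.
  by exists (Sub (Ordinal bn) bu').
- by rewrite upd_other /orig ?(bl_orig0 B) ?(N_eq bd) // eq_sym -lt0n; case/andP: UN.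
- move=> a /=; have an : val a <= n by apply/ltnW/ltn_ord.
  have [_ oa] := pre_spec bd B an; rewrite upd_other //.
  apply: contra (valP a) => /eqP /(congr1 orig); rewrite [LHS]oa [RHS]oU => eq.
  by rewrite -val_eqE /= eq.
- by rewrite filter_uniq ?iota_uniq.
- move=> i; rewrite /printed_ids opE rsE /= addn0 mem_filter mem_iota /= add0n; split.
    move=> /andP[iu lt]; have iu' : Ordinal lt != u by rewrite -val_eqE.
    by exists (Sub (Ordinal lt) iu').
  by move=> [a <-]; rewrite ltn_ord andbT (inj_eq val_inj) (valP a).
Qed.

Lemma report_change_edge (u v : 'I_n) (b : bool) :
  let Up := if b then InsertEdge u v else DeleteEdge u v in
  valid_update adj Up -> ain s = update_code Up ->
  wp w (update_graph ;; finish) (reported Up) s.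
Proof.
move=> Up valid tape.
have un := ltn_ord u; have vn := ltn_ord v.
have [puN ou] := pre_spec bd B (ltnW un); have [pvN ov] := pre_spec bd B (ltnW vn).
have uv : u != v :> nat.
  move: valid; rewrite /Up; case: (b) => /= [/andP[]//|].
  by rewrite adjE; apply: contraTneq => ->.
have tape' : ain s = [:: if b then 2 else 3; nat_of_ord u; nat_of_ord v].
  by rewrite tape /Up; case: (b).
pose Q t s' := exists U V, [/\ t <= 100 * N + 30, rg s' rop != 0 /\ rg s' rop != 1, rg s' ru = U /\ U <= V,
  (U, V) = (pre u, pre v) \/ (U, V) = (pre v, pre u)
  & mm s' aOrig = orig /\ mm s' aM = upd (mm s aM) (U * N + V) b].
apply: wp_sq; apply: (wp_mono (Q := Q)).
  apply: wp_sq; apply: (wp_in tape'); first by apply: fits_small; case: (b).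
  set s1 := AState _ _ _ _; apply: wp_cond; rewrite //=; first by do !split; apply: fits_small; case: (b).
    by case: (b).
  move=> _; apply: wp_cond; rewrite //=; first by do !split; apply: fits_small; case: (b).
    by case: (b).
  move=> _; apply: (wp_mono (change_edgeP (s := s1) bd (bl_N B) (bl_n B) preN (erefl _) un vn)).
  move=> t s' F [U [V [tB ruE UV eq ME]]]; exists U, V; split=> //.
  - by rewrite /cost /=; clear -tB; lia.
  - by rewrite (fr_rg F) //=; case: (b).
  - by rewrite (fr_mm F) // ME /=; split=> //; case: (b).
move=> t s2 F [U [V [tB [op0 op1] [ruE UV] eq [oE ME]]]].
have [UN VN] : 0 < U < N /\ 0 < V < N by case: eq => -[-> ->].
have oUV : (orig U, orig V) = (u : nat, v : nat) \/ (orig U, orig V) = (v : nat, u : nat).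
  by case: eq => -[-> ->]; rewrite /orig ou ov; [left|right].
have pairE x y : same_pair (orig U) (orig V) x y = same_pair u v x y.
  by case: oUV => -[-> ->]; rewrite // same_pairC.
have nUV : orig U != orig V by case: oUV => -[-> ->]; rewrite // eq_sym.
have ltUV : U < V by rewrite ltn_neqAle UV andbT; apply: contra nUV => /eqP ->.
pose E' : rel nat := fun x y => if same_pair (orig U) (orig V) x y then b else E x y.
have E'sym : symmetric E' by move=> x y; rewrite /E' E_sym same_pair_sym.
have parN := parU UN.
apply: (wp_mono (finish_updated bd Nlg B es_valid out (E' := E') F ruE UN oE E'sym _ _ _)).
- by move=> x y; rewrite /E' /same_pair => /negPf xU /negPf yU; rewrite xU yU andbF.
- move=> x xN _; rewrite ME updE eqn_add2l /E' /same_pair eqxx (negPf nUV) /= orbF.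
  have -> : (orig x == orig V) = (x == V).
    apply/eqP/eqP => [h|->//]; have [_ <-] := orig_spec bd B xN.
    by have [_ <-] := orig_spec bd B VN; rewrite -/orig h.
  case: ifP => _; first by case: (b).
  by rewrite (row_adj B es_irr) // label_relE.
- move=> p0; have pN : 0 < par U < N.
    by rewrite p0; apply: ltn_trans parN _; case/andP: UN.
  rewrite /E' /same_pair [orig U == orig V](negPf nUV) andbF /= eqxx andbT.
  (* As [par U < U < V], the changed edge is not the tree edge above [U]. *)
  have -> : (orig (par U) == orig V) = false.
    apply/negP => /eqP h; have [_ h1] := orig_spec bd B pN; have [_ h2] := orig_spec bd B VN.
    have := congr1 pre h; rewrite [LHS]h1 [RHS]h2 => pV.
    by have := ltn_trans parN ltUV; rewrite pV ltnn.
  exact: edge_to_parent.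
move=> t' s' _ [t'B [P rr outE]]; rewrite /reported outE; split; first by apply: budget.
have ids : printed_ids n (rg s2 rop) (rg s2 rs) = iota 0 n.
  by rewrite /printed_ids (negPf op0) (negPf op1) addn0 /= filter_predT.
rewrite ids.
have E'lt x y : E' x y -> y < n.
  rewrite /E' pairE; case: ifP => [|_]; last by move=> /(edge_lt es_valid)[].
  by rewrite /same_pair => /orP[] /andP[_ /eqP ->].
have O0 : orig 0 = n.+1 by rewrite /orig (bl_orig0 B) (N_eq bd).
have idsP i : (i \in iota 0 n) <-> exists x : 'I_n, x = i :> nat.
  by rewrite mem_iota /= add0n; split=> [lt|[x <-] //]; exists (Ordinal lt).
have adjE' (x y : 'I_n) : E' x y = (if b then adj x y || ([set x; y] == [set u; v])
                                    else adj x y && ([set x; y] != [set u; v])).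
  rewrite /E' pairE set2_eq adjE /same_pair -!(inj_eq val_inj).
  by case: ifP => _; case: (b); rewrite ?orbT ?orbF ?andbT ?andbF.
rewrite /Up; case bE : b adjE' => adjE'.
  apply: (reports_rerooted bd B (E' := E') (U := U) (O := orig)) => //.
  - by move=> x y /= /val_inj.
  - by move=> x; apply/ltnW/ltn_ord.
  - by move=> x y; rewrite adjE'.
  - by move=> x y h; left; exists (Ordinal (E'lt x y h)).
  - by move=> x; apply: (pre_spec bd B _).2; apply/ltnW/ltn_ord.
  - exact: iota_uniq.
apply: (reports_rerooted bd B (E' := E') (U := U) (O := orig)) => //.
- by move=> x y /= /val_inj.
- by move=> x; apply/ltnW/ltn_ord.
- by move=> x y; rewrite adjE'.
- by move=> x y h; left; exists (Ordinal (E'lt x y h)).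
- by move=> x; apply: (pre_spec bd B _).2; apply/ltnW/ltn_ord.
- exact: iota_uniq.
Qed.

Lemma reportP (Up : update 'I_n) : valid_update adj Up -> ain s = update_code Up ->
  wp w (update_graph ;; finish) (reported Up) s.
Proof.
case: Up => [l|u|u v|u v] valid tape.
- exact: report_insert_vertex.
- exact: report_delete_vertex.
- exact: (@report_change_edge u v true).
- exact: (@report_change_edge u v false).
Qed.

End Cases.

(** * Running times and the theorem *)

(* When [m < n] the linear-time bound leaves no time to number the vertices, so the index is built by the report *)
Definition preprocess_prog := read_edges ;; Cond (R rm [<] R rn) Nop build.
Definition report_prog := Cond (R rm [<] R rn) build Nop ;; update_graph ;; finish.

(** Addresses stay below [16 * N ^ 5 + 16]. As [N ^ 5 >= 32], this is less than [N ^ 10], whence ten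
    times the logarithm. *)
Lemma word_bounds n : bounds (word_size 10 n) n (n + 2) ((n + 2) * (n + 2) * (n + 2)) /\
  n + 2 <= 2 ^ up_log 2 n.+2.
Proof.
have le : n + 2 <= 2 ^ up_log 2 n.+2 by rewrite addn2; apply: up_logP.
split=> //; split=> //; rewrite /word_size [10 * _]mulnC expnM.
have N1 : 1 < n + 2 by lia.
apply: leq_trans (_ : (n + 2) ^ 10 <= _); last by rewrite leq_exp2r.
move: (n + 2) N1 => N N1.
have e5 : N * N * (N * N * N) = N ^ 5 by rewrite !expnS expn0; lia.
rewrite e5 (_ : 10 = 5 + 5) // expnD.
have : 2 ^ 5 <= N ^ 5 by rewrite leq_exp2r.
rewrite (_ : 2 ^ 5 = 32) //; move: (N ^ 5) => A hA; nia.
Qed.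

Section Graph.
Variables (n : nat) (adj : rel 'I_n) (es : seq ('I_n * 'I_n)).
Hypothesis adj_sym : symmetric adj.
Hypothesis adj_irr : irreflexive adj.
Hypothesis esE : edge_list adj es.

Definition nat_edges : seq (nat * nat) := [seq (nat_of_ord e.1, nat_of_ord e.2) | e <- es].

Lemma size_edges : size nat_edges = #|edges adj|.
Proof. by rewrite size_map cardE -(perm_size esE) size_map. Qed.

Lemma nat_edges_valid : valid_edges n nat_edges.
Proof. by apply/allP => _ /mapP[e _ ->] /=; rewrite !ltn_ord. Qed.

(** The list of edges has no duplicates because its image among the unordered pairs has none. *)
Lemma size_edges_le : size nat_edges <= n * n.
Proof.
have ue : uniq es by apply: (@map_uniq _ _ (fun e => [set e.1; e.2])); rewrite (perm_uniq esE) enum_uniq.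
by rewrite size_map -(card_uniqP ue) (leq_trans (max_card _)) // card_prod card_ord.
Qed.

Lemma adj_nat_edges (u v : 'I_n) : adj u v = edge_rel nat_edges u v.
Proof.
have mem (x y : 'I_n) : ((nat_of_ord x, nat_of_ord y) \in nat_edges) = ((x, y) \in es).
  apply/mapP/idP => [[[a b] h [/val_inj -> /val_inj ->]] //|h].
  by exists (x, y).
rewrite /edge_rel !mem; apply/idP/idP => [uv|].
  have : [set u; v] \in enum (edges adj) by rewrite mem_enum; apply/imset2P; exists u v.
  rewrite -(perm_mem esE) => /mapP[[a b] h /eqP]; rewrite set2_eq /=.
  by case/orP => /andP[/eqP-> /eqP->]; rewrite h ?orbT.
have inc (x y : 'I_n) : (x, y) \in es -> adj x y.
  move=> h; have : [set x; y] \in enum (edges adj).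
    by rewrite -(perm_mem esE); apply/mapP; exists (x, y).
  rewrite mem_enum => /imset2P[a b _ ab /eqP]; have {}ab : adj a b := ab; rewrite set2_eq.
  by case/orP => /andP[/eqP-> /eqP->] //; rewrite adj_sym.
by case/orP => /inc //; rewrite adj_sym.
Qed.

Lemma nat_edges_irr u : ~~ edge_rel nat_edges u u.
Proof.
apply/negP => h; have [un _] : u < n /\ u < n.
  by move: h; rewrite /edge_rel => /orP[] /(allP nat_edges_valid) /andP[].
by move: (adj_nat_edges (Ordinal un) (Ordinal un)); rewrite adj_irr h.
Qed.

Lemma graph_code_nat : graph_code es = n :: size nat_edges :: flat nat_edges.
Proof. by rewrite /graph_code /flat /nat_edges size_map -map_comp. Qed.

End Graph.

Lemma up_log_add2 n : 0 < n -> up_log 2 n.+2 <= up_log 2 n + 2.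
Proof.
move=> n0; apply: up_log_min => //; rewrite expnD.
by have := @up_logP 2 n isT; rewrite (_ : 2 ^ 2 = 4) //; lia.
Qed.

Lemma up_log_ge1 n : 1 < n -> 0 < up_log 2 n.
Proof. by move=> n1; rewrite up_log_gt0. Qed.

(** With [n <= m] the number of vertices is absorbed by [m]; with [m < n] nothing is done beyond
    reading. When [n <= 1], [up_log 2 n] is 0 and the additive constant has to suffice. *)
Lemma preprocess_time n m lg t1 t2 : lg = up_log 2 n.+2 -> m <= n * n ->
  t1 <= 200 * (m + 1) -> t2 <= (if m < n then 10 else 2000 * ((lg + 1) * (m + (n + 2))) + 10) ->
  t1 + t2 <= 400 * 400 * (m * up_log 2 n + 1).
Proof.
move=> lgE mn t1B; have [m0|m0] := posnP m.
  rewrite m0 in t1B *; case: n lgE mn => [|n] -> _ /=; last by lia.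
  by rewrite (_ : up_log 2 2 = 1) //; lia.
have n1 : 1 < n \/ n = 1 by case: n mn {lgE} => [|[|n]] mn; [lia|right|left].
case: n1 => [n1|n1]; last first.
  have -> : lg = 2 by rewrite lgE n1.
  have m1 : m <= 1 by rewrite n1 in mn.
  by case: ifP => _; lia.
have L0 := up_log_ge1 n1; have := @up_log_add2 n (ltnW n1); rewrite -lgE.
move: (up_log 2 n) L0 => L L0 lgL.
have mL : m <= m * L by rewrite leq_pmulr.
case: ltnP => [_|nm] t2B; first by lia.
have hA : (lg + 1) * (m + (n + 2)) <= 4 * L * (3 * m) by rewrite leq_mul //; lia.
move: hA t2B; rewrite (_ : 4 * L * (3 * m) = 12 * (m * L)); last by lia.
by move: ((lg + 1) * (m + (n + 2))) (m * L) mL => a b *; lia.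
Qed.

(** A postponed construction takes only O(n log n) time. The factor [400 * 400] covers
    [4000 * 32 + 2000 * 12], where 32 and 12 come from [lg + 1 <= 4 * L] and from bounding the
    counts by [2 * k] and [3 * k]. *)
Lemma report_time n m lg t1 t2 : lg = up_log 2 n.+2 ->
  t1 <= (if m < n then 2000 * ((lg + 1) * (m + (n + 2))) + 10 else 10) ->
  t2 <= 4000 * ((lg + 1) * (lg + 1) * (n + 2)) ->
  t1 + t2 <= 400 * 400 * (n * up_log 2 n ^ 3 + 1).
Proof.
case: n => [|[|n]].
- by rewrite ltn0 (_ : up_log 2 2 = 1) // => ->; lia.
- rewrite (_ : up_log 2 3 = 2) // => -> t1B t2B.
  have t1B' : t1 <= 2000 * ((2 + 1) * 3) + 10 by apply: leq_trans t1B _; case: ifP => ?; lia.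
  by move: t1B' t2B; clear; lia.
set k := n.+2 => lgE; have k1 : 1 < k by [].
have L0 := up_log_ge1 k1; have := @up_log_add2 k isT; rewrite -lgE.
move: (up_log 2 k) L0 => L L0 lgL t1B t2B.
have A4 : lg + 1 <= 4 * L by lia.
have n2 : k + 2 <= 2 * k by lia.
have hA2 : (lg + 1) * (lg + 1) * (k + 2) <= 4 * L * (4 * L) * (2 * k) by rewrite !leq_mul.
have hA : (lg + 1) * (2 * k + 2) <= 4 * L * (3 * k) by rewrite leq_mul //; lia.
have t1B' : t1 <= 2000 * ((lg + 1) * (2 * k + 2)) + 10.
  apply: leq_trans t1B _; case: ifP => [lt|_]; last by lia.
  by rewrite leq_add2r leq_mul2l leq_mul2l /=; lia.
have LL : L * k <= L * L * k by rewrite leq_mul2r leq_pmull ?orbT.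
have L3 : L * L * k <= k * L ^ 3.
  by rewrite mulnC leq_mul2l !expnS expn0 muln1 leq_mul2l leq_pmull ?orbT.
move: hA2 hA LL L3 t1B' t2B; clear.
rewrite (_ : 4 * L * (4 * L) * (2 * k) = 32 * (L * L * k)); last by lia.
rewrite (_ : 4 * L * (3 * k) = 12 * (L * k)); last by lia.
move: ((lg + 1) * (lg + 1) * (k + 2)) ((lg + 1) * (2 * k + 2)) (L * L * k) (L * k) (k * L ^ 3).
by move=> a b c d e; lia.
Qed.

Theorem theorem3 :
  exists (preprocess report : cmd) (c C : nat),
  forall (n : nat) (adj : rel 'I_n) (es : seq ('I_n * 'I_n)),
    symmetric adj -> irreflexive adj -> edge_list adj es ->
    exists (t1 : nat) (s1 : state),
      [/\ exec (word_size c n) preprocess (feed (graph_code es) blank) t1 s1,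
          t1 <= C * (#|edges adj| * up_log 2 n + 1)
        & forall U : update 'I_n, valid_update adj U ->
          exists (t2 : nat) (s2 : state),
            [/\ exec (word_size c n) report (feed (update_code U) s1) t2 s2,
                t2 <= C * (n * up_log 2 n ^ 3 + 1)
              & reports_dfs_tree adj U (tape_out s2)]].
Proof.
exists (cprog preprocess_prog), (cprog report_prog), 10, (400 * 400).
move=> n adj es adj_sym adj_irr esE.
have [bd Nlg] := word_bounds n; set w := word_size 10 n in bd *.
set N := n + 2 in bd Nlg; set Z := N * N * N in bd; set lg := up_log 2 n.+2 in Nlg.
have valid := nat_edges_valid es; set es' := nat_edges es in valid.
have esz := size_edges_le esE; have irr := nat_edges_irr adj_sym adj_irr esE.
rewrite -/es' in esz irr; rewrite -(size_edges esE) -/es'.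
have w16 : 16 < 2 ^ w.
  by have := b_w bd; have [[h1 h2 h3 h4] [h5 h6 h7 nn nZ]] := bounds_le bd; lia.
have w1 : 1 < 2 ^ w by lia.
pose s0 := AState (fun=> 0) (fun _ _ => 0) (graph_code es) [::].
have i0 : implements (feed (graph_code es) blank) s0 by [].
pose small := size es' < n.
pose Q1 t s := t <= 400 * 400 * (size es' * up_log 2 n + 1) /\
  [/\ rg s rn = n, rg s rm = size es' & if small then raw n N Z es' s else exists ps, built n N Z es' ps s].
have [t1 [a1 [ex1 [t1B [rn1 rm1 st1]]]]] : wp w preprocess_prog Q1 s0.
  apply: wp_sq; apply: (wp_mono (read_edgesP (s := s0) bd valid esz (graph_code_nat es) _)) => //.
  move=> t s F [[eN eZ en em] [L tB]].
  have rw : raw n N Z es' s.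
    by split=> // k k1; rewrite (fr_mm F) // !inE; lia.
  apply: wp_cond; rewrite /= ?en ?em; first by do !split; case: (_ < n); lia.
    move=> lt; have sm : small by rewrite /small; case: (_ < n) lt.
    apply: wp_nop; split; last by rewrite sm.
    by apply: (preprocess_time (lg := lg)) => //; rewrite [_ < n]sm /cost /=.
  move=> ge; have sm : small = false by rewrite /small; case: (_ < n) ge.
  apply: (wp_mono (buildP bd Nlg valid esz irr rw)) => t' s' F' [t'B bl].
  split; last by rewrite sm !(fr_rg F').
  by apply: (preprocess_time (lg := lg)) => //; rewrite [_ < n]sm /cost /=; lia.
have [b1 exec1 i1] := aexec_exec w16 ex1 i0.
exists t1, b1; split=> // U valU.
pose s2 := AState (rg a1) (mm a1) (update_code U) [::].
have i2 : implements (feed (update_code U) b1) s2 by case: i1 => h1 h2 _ _; split.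
pose Q2 t s := t <= 400 * 400 * (n * up_log 2 n ^ 3 + 1) /\ reports_dfs_tree adj U (aout s).
have [t2 [a2 [ex2 [t2B rep]]]] : wp w report_prog Q2 s2.
  pose Q3 t s := t <= (if small then 2000 * ((lg + 1) * (size es' + N)) + 10 else 10) /\
     [/\ exists ps, built n N Z es' ps s, ain s = update_code U & aout s = [::]].
  apply: wp_sq; apply: (wp_mono (Q := Q3)).
    apply: wp_cond; rewrite /= ?rn1 ?rm1; first by do !split; case: (_ < n); lia.
      move=> lt; have sm : small by rewrite /small; case: (_ < n) lt.
      rewrite sm in st1; have rw : raw n N Z es' s2 by case: st1.
      apply: (wp_mono (buildP bd Nlg valid esz irr rw)) => t s F [tB bl].
      split; first by rewrite sm /cost /=; lia.
      by split=> //; [rewrite (fr_in F)|rewrite (fr_out F)].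
    move=> ge; have sm : small = false by rewrite /small; case: (_ < n) ge.
    rewrite sm in st1; apply: wp_nop; split; first by rewrite sm.
    by split=> //; have [ps bl] := st1; exists ps; case: bl.
  move=> t s F [tB [[ps bl] tape out]].
  apply: (wp_mono (reportP bd Nlg bl valid irr out (adj_nat_edges adj_sym esE) valU tape)).
  move=> t' s' _ [t'B rep]; split=> //.
  by apply: (report_time (lg := lg) (m := size es')).
have [b2 exec2 [_ _ _ oE]] := aexec_exec w16 ex2 i2.
by exists t2, b2; split=> //; rewrite oE.
Qed.
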